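(* Let $G$ be a finitely generated group that is a limit of left orderable amenable groups in the space of marked group presentations. Then for every sequence $(N_i)_{i\in\mathbb N}$ of finite index normal subgroups of $G$ satisfying $N_1\ge N_2\ge\cdots$ and $\bigcap_{i=1}^\infty N_i=\{1\}$, the limit below exists and $$\beta_1^{(2)}(G)=\lim_{i\to\infty}\frac{\beta_1(N_i)}{[G:N_i]} .$$
   Context: For a countable discrete group $G$, $\beta_1^{(2)}(G)\in[0,\infty]$ denotes its first $\ell^2$-Betti number, and for a finitely generated group $H$, $\beta_1(H)=\mathrm{rk}_{\mathbb Z}\,\mathrm{Hom}(H,\mathbb Z)$ is its ordinary first Betti number. Space of marked groups: for $n\in\mathbb N$, $\mathcal G_n$ is the set of pairs $(G,S)$, where $G$ is a group and $S$ is an ordered generating $n$-tuple of $G$; equivalently (up to the natural isomorphism of marked groups), the set of epimorphisms $F_n\to G$, or the set of normal subgroups $N\lhd F_n$ (with $G=F_n/N$), where $F_n$ is the free group of rank $n$ with a fixed basis. The metric on $\mathcal G_n$ is $d(N_1,N_2)=\inf\{2^{-k}\mid k\in\mathbb N,\ N_1\cap B_{F_n}(k)=N_2\cap B_{F_n}(k)\}$, where $B_{F_n}(k)$ is the closed ball of radius $k$ about $1$ in $F_n$ with respect to the fixed basis. A finitely generated group $G$ is a limit of groups from a class $\mathcal C$ in the space of marked group presentations if for some $n$ there are groups $G_i\in\mathcal C$ ($i\in\mathbb N$) and ordered generating $n$-tuples $S_i$ of $G_i$ and $S$ of $G$ such that $(G_i,S_i)\to(G,S)$ in $\mathcal G_n$.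 A group is left orderable if it admits a total order invariant under left multiplication. *)

(* Defs.v *)
From HB Require Import structures.
From mathcomp Require Export all_boot all_order all_algebra.
From mathcomp Require Export finmap.
From mathcomp Require Export all_classical all_reals all_analysis.
From mathcomp Require Import complex.
Export numFieldNormedType.Exports.
Set Implicit Arguments.
Unset Strict Implicit.
Unset Printing Implicit Defensive.
Import Order.TTheory GRing.Theory Num.Theory.

Global Open Scope classical_set_scope.
Global Open Scope ring_scope.

Definition left_orderable (G : groupType) : Prop :=
  exists le : G -> G -> Prop,
    [/\ forall x, le x x,
        forall x y, le x y -> le y x -> x = y,
        forall x y z, le x y -> le y z -> le x z,
        forall x y, le x y \/ le y x &
        forall g x y, le x y -> le (g * x)%g (g * y)%g].

Definition ltranslate (G : groupType) (g : G) (F : {fset G}) : {fset G} :=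
  [fset (g * x)%g | x in F]%fset.

(* The Folner condition. *)
Definition amenable (R : realType) (G : groupType) : Prop :=
  forall (K : {fset G}) (e : R), 0 < e ->
  exists2 F : {fset G}, F != fset0 &
    forall g, g \in K ->
      #|` ((ltranslate g F `\` F) `|` (F `\` ltranslate g F))%fset|%:R
        <= e * #|` F|%:R.

(* A letter (k, true) stands for the k-th basis element of the free group of
   rank n and (k, false) for its inverse; the free group is identified with
   the set of reduced words. *)
Definition word (n : nat) := seq ('I_n * bool).

Definition noncancelling n : rel ('I_n * bool) :=
  [rel a b | ~~ ((a.1 == b.1) && (a.2 != b.2))].

Definition reduced n (w : word n) : bool := sorted (@noncancelling n) w.

Definition word_eval (G : groupType) n (S : 'I_n -> G) (w : word n) : G :=
  (\prod_(a <- w) (if a.2 then S a.1 else (S a.1)^-1))%g.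

Definition generates (G : groupType) n (S : 'I_n -> G) : Prop :=
  forall g, exists w : word n, word_eval S w = g.

Definition marked_kernel (G : groupType) n (S : 'I_n -> G) : set (word n) :=
  [set w | reduced w /\ word_eval S w = 1%g].

Definition free_ball n (k : nat) : set (word n) :=
  [set w | reduced w /\ (size w <= k)%N].

Definition marked_dist (R : realType) n (N1 N2 : set (word n)) : R :=
  inf [set 2 ^- k | k in [set k : nat |
         N1 `&` free_ball k = N2 `&` free_ball k]].

Definition marked_limit (R : realType) (C : groupType -> Prop)
    (G : groupType) : Prop :=
  exists (n : nat) (H : nat -> groupType) (T : forall i, 'I_n -> H i)
         (S : 'I_n -> G),
    [/\ forall i, C (H i),
        forall i, generates (T i),
        generates S &
        (fun i => marked_dist R (marked_kernel (T i)) (marked_kernel S))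
          @ \oo --> (0 : R)].

Definition normal_subgroup (G : groupType) (N : set G) : Prop :=
  [/\ N 1%g,
      forall x y, N x -> N y -> N (x * y^-1)%g &
      forall g x, N x -> N (g * x * g^-1)%g].

Definition left_cosets (G : groupType) (N : set G) : set (set G) :=
  [set [set (g * x)%g | x in N] | g in [set: G]].

Definition finite_index (G : groupType) (N : set G) : Prop :=
  finite_set (left_cosets N).

Definition subgroup_index (G : groupType) (N : set G) : nat :=
  #|` fset_set (left_cosets N)|%fset.

Definition hom_to_Z (G : groupType) (N : set G) (f : G -> int) : Prop :=
  forall x y, N x -> N y -> f (x * y)%g = f x + f y.

Definition Z_independent (G : groupType) (N : set G) k
    (f : 'I_k -> G -> int) : Prop :=
  forall c : 'I_k -> int,
    (forall x, N x -> \sum_(i < k) c i * f i x = 0) -> forall i, c i = 0.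

Definition has_indep_homs (G : groupType) (N : set G) (k : nat) : Prop :=
  exists f : 'I_k -> G -> int,
    (forall i, hom_to_Z N (f i)) /\ Z_independent N f.

(* The rank of Hom(N, Z): the maximal size of a Z-independent family.  The
   default value 0 is taken only if this rank is infinite, which does not
   happen for finitely generated N. *)
Definition betti1 (G : groupType) (N : set G) : nat :=
  xget 0%N [set k | has_indep_homs N k /\
                    forall m, has_indep_homs N m -> (m <= k)%N].

Definition rsum (R : realType) (I : choiceType) (a : I -> R) : R :=
  fine (\esum_(i in [set: I]) (Num.max (a i) 0)%:E)
  - fine (\esum_(i in [set: I]) (Num.max (- a i) 0)%:E).

Definition csum (R : realType) (I : choiceType) (a : I -> R[i]) : R[i] :=
  Complex (rsum (fun i => complex.Re (a i))) (rsum (fun i => complex.Im (a i))).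

Definition in_l2 (R : realType) (I : choiceType) (f : I -> R[i]) : Prop :=
  (\esum_(i in [set: I])
     (complex.Re (f i) ^+ 2 + complex.Im (f i) ^+ 2)%:E < +oo)%E.

Section VonNeumannDimension.
Variables (R : realType) (G : groupType) (n : nat).
Let vec := 'I_n -> G -> R[i].

Definition dot (x y : vec) : R[i] := \sum_k csum (fun g => x k g * (y k g)^*).

Definition orth_proj (V : set vec) (x : vec) : vec :=
  xget (fun=> fun=> 0)
    [set p | V p /\
             forall v, V v -> dot (fun k g => x k g - p k g) v = 0].

Definition l2_unit (k : 'I_n) : vec :=
  fun j g => ((j == k) && (g == 1%g))%:R.

(* For a closed subspace V of l2(G)^n that is invariant under right
   translation by G: the trace of the orthogonal projection onto V. *)
Definition vn_dim (V : set vec) : R :=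
  \sum_k complex.Re (dot (orth_proj V (l2_unit k)) (l2_unit k)).

End VonNeumannDimension.

Section L2Betti.
Variables (R : realType) (G : groupType) (n : nat) (S : 'I_n -> G).

Definition lshift (g : G) (f : G -> R[i]) : G -> R[i] :=
  fun x => f (g^-1 * x)%g.

Definition cocycle (b : G -> G -> R[i]) : Prop :=
  (forall g, in_l2 (b g)) /\
  (forall g h x, b (g * h)%g x = b g x + lshift g (b h) x).

(* A cocycle is determined by its values on a generating tuple S, so for
   generating S these are Z^1(G, l2 G) and B^1(G, l2 G) inside l2(G)^n. *)
Definition Z1 : set ('I_n -> G -> R[i]) :=
  [set x | exists2 b, cocycle b & x = fun k => b (S k)].

Definition B1 : set ('I_n -> G -> R[i]) :=
  [set x | exists2 f, in_l2 f & x = fun k g => lshift (S k) f g - f g].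

(* Z1 is closed, so the reduced first l2-cohomology of G, the quotient of Z1
   by the closure of B1, is identified with the orthogonal complement of B1
   in Z1. *)
Definition reduced_l2_H1 : set ('I_n -> G -> R[i]) :=
  [set x | Z1 x /\ forall y, B1 y -> dot x y = 0].

(* The first l2-Betti number of the group generated by S; it does not depend
   on the choice of the finite generating tuple S. *)
Definition l2_betti1 : R := vn_dim reduced_l2_H1.

End L2Betti.
Arguments l2_betti1 R {G n} S.

(* Main.v *)
Require Import Defs.
From mathcomp Require Import spectral mxpoly complex sesquilinear.
From mathcomp Require Import zify lra ring.
Set Implicit Arguments. Unset Strict Implicit. Unset Printing Implicit Defensive.
Import Order.TTheory GRing.Theory Num.Theory.

(** The first l2-Betti number of [G] is the trace, at a vertex of the Cayley
    graph, of the projection to the square summable harmonic cochains: functions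
    on the edges whose sums along the relators and whose divergence vanish
    ([l2_betti1_projections]). For a normal subgroup [N] of index [q], the same
    equations on the Cayley graph of [G / N] have a solution space of dimension
    [betti1 N] ([betti1_harmonic]), since a harmonic cochain there is determined
    by its periods over the loops that represent elements of [N]. So the theorem
    compares the trace per vertex of a projection on a graph and on its finite
    quotients.

    That the limit superior of [betti1 (N i) / q_i] is at most the l2-Betti number
    is a matter of compactness ([limsup_betti1_le]). Projections of basis vectors
    in the finite quotients, centered at a vertex of at least average trace, are
    pulled back to [G]; a pointwise ultralimit of them is harmonic, and its squared
    norm is at most its value at the base point, which bounds that value by the
    value of the projection in [G].

    The other inequality holds for each [N] separately ([l2_betti1_le]) and is where
    the approximating groups enter. Finitely many rows M define the harmonic
    cochains on the quotient graph. If C is large, the operator A equal to 1 minus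
    the sum of the operators M^* M divided by C is a contraction fixing the
    harmonic cochains, so the trace of every even power of A at a vertex bounds the
    l2-Betti number. This trace only depends on a ball in the Cayley graph, so it may
    be computed in the product of the graph of G / N with the Cayley graph of a
    left orderable amenable group H that agrees with [G] on that ball, and there
    over a large Folner set F in H. Over F the operator is a symmetric integer
    matrix; the product of its nonzero eigenvalues is at least 1, so few of them are
    small ([integer_trace_power]), and the trace of high powers is nearly the
    nullity. Finally the nullity is at most [betti1 N] for each element of F: the
    cochains on the graph of G / N supported on a maximal independent set of edges
    contain no solution of the equations, and over the locally indicable group H
    this remains true in the product ([prod_independent_edges]). This last step is
    the theorem of Gersten and of Howie and Schneebeli on matrices over group rings
    ([locally_indicable_op_inj]); it applies because left orderable amenable groups
    are locally indicable, by a theorem of Morris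
    ([left_orderable_amenable_locally_indicable]). *)

(** * Matrices over the group ring of a locally indicable group *)

Definition subgrp (H : groupType) (L : set H) : Prop :=
  L 1%g /\ forall x y, L x -> L y -> L (x^-1 * y)%g.

Definition genby (H : groupType) (T : seq H) : set H :=
  [set x | forall L, subgrp L -> (forall t, t \in T -> L t) -> L x].

Section Subgroups.
Variable H : groupType.
Implicit Type L : set H.

Lemma subgrpV L x : subgrp L -> L x -> L x^-1%g.
Proof. by move=> [L1 LM] Lx; rewrite -[(x^-1)%g]mulg1; exact: LM. Qed.

Lemma subgrpM L x y : subgrp L -> L x -> L y -> L (x * y)%g.
Proof.
by move=> sL Lx Ly; rewrite -[x]invgK; apply sL.2 => //; exact: subgrpV.
Qed.

Lemma genby_subgrp T : subgrp (@genby H T).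
Proof.
split=> [L [] //|x y gx gy L sL TL].
by apply sL.2; [exact: gx|exact: gy].
Qed.

Lemma genby_mem (T : seq H) t : t \in T -> (genby T t : Prop).
Proof. by move=> tT L _; apply. Qed.

Lemma genby_sub (T : seq H) L : subgrp L -> (forall t, t \in T -> L t) -> genby T `<=` L.
Proof. by move=> sL TL x; exact. Qed.

End Subgroups.

(** Homomorphisms with real values suffice here, as a finitely generated group of
    reals is free abelian; they are functions on [H] that need be additive on
    the finitely generated subgroup only. *)
Definition locally_indicable (R : realType) (H : groupType) : Prop :=
  forall T : seq H, (exists2 t, t \in T & t != 1%g) ->
  exists phi : H -> R,
    (forall x y, genby T x -> genby T y -> phi (x * y)%g = phi x + phi y) /\
    exists2 t, t \in T & phi t != 0.

Section FiniteSums.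
Variables (R : fieldType) (T : choiceType).
Implicit Type f : T -> R.

Lemma fsum_seq f (s : seq T) : uniq s -> (forall r, f r != 0 -> r \in s) ->
  \sum_(r \in [set: T]) f r = \sum_(r <- s) f r.
Proof.
move=> us fs; rewrite (fsbigE s) //=; last by move=> r _ nr; apply/eqP; apply: contraNT nr; exact: fs.
by apply: eq_bigl => r; rewrite in_setT.
Qed.

End FiniteSums.

Section Tower.
Variables (R : realType) (H : groupType) (J : eqType) (I : finType).
Variable op : I -> seq (R * H * J).
Implicit Types (u : J -> H -> R) (L : set H).

(** A matrix over the group ring, given by its rows. It acts by left translations,
    hence preserves invariance on the right. *)
Definition opapp u i h : R := \sum_(a <- op i) a.1.1 * u a.2 (a.1.2 * h)%g.

Definition rinv L u := forall j h l, L l -> u j (h * l)%g = u j h.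

Definition supp_in (P : seq H) L u :=
  forall j h, u j h != 0 -> exists2 p, p \in P & L (p^-1 * h)%g.

(** Injectivity on the functions on the coset space of [L] whose support lies over
    [P]. For the whole group these are constant and the matrix acts through its
    augmentation; for the trivial subgroup they are the functions on [H] with
    support in [P]. *)
Definition op_inj P L := forall u, rinv L u -> supp_in P L u ->
  (forall i h, opapp u i h = 0) -> forall j h, u j h = 0.

Section Step.
Variables (P : seq H) (L : set H) (phi : H -> R).
Hypotheses (sL : subgrp L)
  (phiM : forall x y, L x -> L y -> phi (x * y)%g = phi x + phi y).

Let K : set H := [set l | L l /\ phi l = 0].

Lemma phi1 : phi 1%g = 0.
Proof.
by apply: (@addrI _ (phi 1%g)); rewrite addr0 -phiM ?mulg1 //; case: sL.
Qed.

Lemma phiV x : L x -> phi x^-1%g = - phi x.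
Proof.
move=> Lx; apply/eqP; rewrite -addr_eq0 -phiM ?mulVg ?phi1 //.
exact: subgrpV.
Qed.

(** A function invariant under the kernel of [phi] depends, on the coset [h * L],
    only on the value of [phi]; it is extended by 0 to the values not taken. *)
Definition fiber u j h (r : R) : R :=
  if pselect (exists l, L l /\ phi l = r) is left e
  then u j (h * projT1 (cid e))%g else 0.

Lemma fiberE u j h l : rinv K u -> L l -> fiber u j h (phi l) = u j (h * l)%g.
Proof.
move=> iu Ll; rewrite /fiber; case: pselect => [e|[]]; last by exists l.
case: (cid e) => /= l' [Ll' el'].
rewrite -[in RHS](iu _ _ (l^-1 * l')%g); first by rewrite -mulgA mulVKg.
split; first exact: sL.2.
by rewrite phiM ?phiV ?el' ?addNr //; exact: subgrpV.
Qed.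

Lemma fiber_shift u j h l r : rinv K u -> L l ->
  fiber u j (h * l)%g r = fiber u j h (r + phi l).
Proof.
move=> iu Ll; have [[l' [Ll' <-]]|nr] := pselect (exists l', L l' /\ phi l' = r).
  rewrite fiberE // [phi l' + _]addrC -phiM // fiberE ?mulgA //.
  exact: subgrpM.
rewrite /fiber; case: pselect => // _; case: pselect => // -[l' [Ll' el']].
case: nr; exists (l' * l^-1)%g; split; first by apply: subgrpM => //; exact: subgrpV.
by rewrite phiM ?phiV ?el' ?addrK //; exact: subgrpV.
Qed.

Definition fsupp h : seq R := undup [seq phi (h^-1 * p)%g | p <- P].

Lemma fiber_supp u j h r : rinv K u -> supp_in P K u ->
  fiber u j h r != 0 -> r \in fsupp h.
Proof.
move=> iu su; have [[l [Ll <-]]|nr] := pselect (exists l, L l /\ phi l = r); last first.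
  by rewrite /fiber; case: pselect => // _; rewrite eqxx.
rewrite fiberE // => /su[p pP [Lp php]]; rewrite mem_undup; apply/mapP; exists p => //.
have -> : (h^-1 * p = l * (p^-1 * (h * l))^-1)%g by rewrite !invgM invgK !mulgA mulgV mul1g.
by rewrite phiM ?phiV ?php ?subr0 //; exact: subgrpV.
Qed.

Definition moment u (p : {poly R}) j h : R :=
  \sum_(r \in [set: R]) fiber u j h r * p.[r].

Lemma momentE u p j h s : rinv K u -> supp_in P K u -> uniq s ->
  {subset fsupp h <= s} -> moment u p j h = \sum_(r <- s) fiber u j h r * p.[r].
Proof.
move=> iu su us hs; apply: fsum_seq => // r; rewrite mulf_eq0 negb_or => /andP[nr _].
by apply: hs; exact: fiber_supp nr.
Qed.

Lemma momentB u p q j h : rinv K u -> supp_in P K u ->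
  moment u (p - q) j h = moment u p j h - moment u q j h.
Proof.
move=> iu su; rewrite !(momentE _ _ iu su (undup_uniq _) (fun _ => id)) -sumrB.
by apply: eq_bigr => r _; rewrite hornerD hornerN mulrBr.
Qed.

Lemma moment_shift u p j h l : rinv K u -> supp_in P K u -> L l ->
  moment u p j (h * l)%g = moment u (p \Po ('X - (phi l)%:P)) j h.
Proof.
move=> iu su Ll; rewrite /moment.
rewrite [RHS](@reindex_fsbigT _ _ _ _ _ (fun r => r + phi l)) /=; last first.
  by exists (fun r => r - phi l) => r; rewrite ?addrK ?subrK.
apply: eq_fsbigr => r _; rewrite fiber_shift //.
by rewrite horner_comp !hornerE addrK.
Qed.

Lemma opapp_fiber u i h r : rinv K u -> (forall i h, opapp u i h = 0) ->
  \sum_(a <- op i) a.1.1 * fiber u a.2 (a.1.2 * h)%g r = 0.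
Proof.
move=> iu u0; have [[l [Ll <-]]|nr] := pselect (exists l, L l /\ phi l = r).
  rewrite -[RHS](u0 i (h * l)%g); apply: eq_bigr => a _.
  by rewrite fiberE // mulgA.
by rewrite big1 // => a _; rewrite /fiber; case: pselect => // _; rewrite mulr0.
Qed.

Lemma opapp_moment u p i h : rinv K u -> supp_in P K u ->
  (forall i h, opapp u i h = 0) -> opapp (moment u p) i h = 0.
Proof.
move=> iu su u0; pose s := undup (flatten [seq fsupp (a.1.2 * h)%g | a <- op i]).
have hs a : a \in op i -> {subset fsupp (a.1.2 * h)%g <= s}.
  move=> ain r rin; rewrite mem_undup; apply/flatten_mapP; by exists a.
rewrite /opapp big_seq_cond.
under eq_bigr => a /andP[ain _].
  rewrite (momentE _ _ iu su (undup_uniq _) (hs a ain)) mulr_sumr; over.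
rewrite -big_seq_cond exchange_big /= big1 // => r _.
transitivity ((\sum_(a <- op i) a.1.1 * fiber u a.2 (a.1.2 * h)%g r) * p.[r]).
  by rewrite mulr_suml; apply: eq_bigr => a _; rewrite mulrA.
by rewrite opapp_fiber // mul0r.
Qed.

Lemma size_comp_sub_lt (p : {poly R}) c : p != 0 ->
  (size (p - (p \Po ('X - c%:P)))%R < size p)%N.
Proof.
move=> p0; have s2 : size (p \Po ('X - c%:P)) = size p.
  by apply: size_comp_poly2; rewrite size_XsubC.
rewrite -[size p]prednK ?size_poly_gt0 // ltnS; apply/leq_sizeP => k.
rewrite leq_eqVlt => /orP[/eqP <-|lt].
  have -> : (p - (p \Po ('X - c%:P)))`_(size p).-1 =
      lead_coef p - lead_coef (p \Po ('X - c%:P)) by rewrite coefB /lead_coef s2.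
  by rewrite lead_coef_comp ?size_XsubC // lead_coefXsubC expr1n mulr1 subrr.
have le : (size p <= k)%N by rewrite -[size p]prednK ?size_poly_gt0.
by rewrite coefB !nth_default ?subrr ?s2.
Qed.

(** The moment of a polynomial along [phi] changes under translation by a moment of
    lower degree. By induction on the degree each moment is therefore invariant
    under the larger subgroup [L], is killed by the operator and vanishes; and
    the moments determine a finitely supported function. *)
Lemma op_inj_ker : op_inj P L -> op_inj P K.
Proof.
move=> injL u iu su u0.
have m0 k : forall p : {poly R}, (size p <= k)%N -> forall j h, moment u p j h = 0.
  elim: k => [|k IH] p sp.
    move: sp; rewrite leqn0 size_poly_eq0 => /eqP -> j h.
    by rewrite /moment fsbig1 // => r _; rewrite horner0 mulr0.
  have [->|p0] := eqVneq p 0; first by apply: IH; rewrite size_poly0.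
  apply: injL.
  - move=> j h l Ll; rewrite moment_shift //; apply/esym/eqP.
    rewrite -subr_eq0 -momentB //; apply/eqP/IH.
    by rewrite -ltnS; apply: leq_trans sp; apply: size_comp_sub_lt.
  - move=> j h; apply: contraNP => nh; apply/eqP.
    rewrite /moment fsbig1 // => r _; apply/eqP; rewrite mulf_eq0; apply/orP; left.
    apply/negPn/negP => fr; apply: nh; move: fr; rewrite /fiber.
    case: pselect => [e|]; last by rewrite eqxx.
    case: (cid e) => /= l [Ll _] /su [p' pP [Lp _]]; exists p' => //.
    by rewrite -[h](mulgK l) mulgA; apply: subgrpM => //; exact: subgrpV.
  - by move=> i h; exact: opapp_moment.
move=> j h; set s := fsupp h.
have L1 : L 1%g by case: sL.
rewrite -[h]mulg1 -fiberE // phi1; apply/eqP; apply/negPn/negP => f0.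
(* The roots are the values of [phi] other than 0, so the moment of [p] at [h]
   is a multiple of the value of [u] at [h]. *)
pose p : {poly R} := \prod_(r <- rem 0 s) ('X - r%:P).
have us : uniq s by exact: undup_uniq.
have s0 : 0 \in s by exact: fiber_supp f0.
have := m0 _ p (leqnn _) j h; rewrite (momentE _ _ iu su us (fun _ => id)).
rewrite (big_rem 0) //= big_seq_cond big1 ?addr0; last first.
  move=> r /andP[rs _]; suff -> : p.[r] = 0 by rewrite mulr0.
  by apply/eqP; rewrite -/(root p r) root_prod_XsubC.
move/eqP; rewrite mulf_eq0 (negPf f0) /= -/(root p 0) root_prod_XsubC.
by rewrite mem_rem_uniq // inE eqxx.
Qed.

End Step.

(** If [L] identifies no more points of the support, or of its translates under the
    operator, than [L'] does, then a function on the cosets of [L'] can be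
    carried over to the cosets of [L]. *)
Lemma op_inj_sub P (L L' : set H) : subgrp L -> subgrp L' -> L' `<=` L ->
  (forall i a b p q, a \in op i -> b \in op i -> p \in P -> q \in P ->
     L (p^-1 * a.1.2 * b.1.2^-1 * q)%g -> L' (p^-1 * a.1.2 * b.1.2^-1 * q)%g) ->
  (forall p q, p \in P -> q \in P -> L (p^-1 * q)%g -> L' (p^-1 * q)%g) ->
  op_inj P L -> op_inj P L'.
Proof.
move=> sL sL' sub H1 H2 inj u iu su u0.
pose v j h := if pselect (exists p, p \in P /\ L (p^-1 * h)%g) is left e
  then u j (projT1 (cid e)) else 0.
have vE j p l : p \in P -> L l -> v j (p * l)%g = u j p.
  move=> pP Ll; rewrite /v; case: pselect => [e|[]]; last first.
    by exists p; rewrite mulKg.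
  case: (cid e) => /= q [qP]; rewrite mulgA => Lq.
  have : L (q^-1 * p)%g by rewrite -[(_ * p)%g](mulgK l); apply: subgrpM => //; exact: subgrpV.
  by move/(H2 _ _ qP pP) => L'q; rewrite -[p](mulVKg q) iu.
have v0 j h : ~ (exists p, p \in P /\ L (p^-1 * h)%g) -> v j h = 0.
  by rewrite /v; case: pselect.
have iv : rinv L v.
  move=> j h l Ll; have [[p [pP Lp]]|nh] := pselect (exists p, p \in P /\ L (p^-1 * h)%g).
    by rewrite -[h](mulVKg p) -mulgA !vE //; exact: subgrpM.
  rewrite !v0 // => -[p [pP Lp]]; apply: nh; exists p; split => //.
  by rewrite -[(_ * h)%g](mulgK l) -[(_ * _ * l)%g]mulgA; apply: subgrpM => //; exact: subgrpV.
suff vz : forall j h, v j h = 0.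
  move=> j h; apply/eqP/negPn/negP => uh; have [p pP Lp] := su _ _ uh.
  move/eqP: uh; apply; rewrite -[h](mulVKg p) iu // -(vE _ _ 1%g) //.
  by case: sL.
apply: inj => // [j h|i h].
  by apply: contraNP => nh; rewrite v0 // => -[p [pP Lp]]; apply: nh; exists p.
rewrite /opapp.
have [[b [bin [q [qP Lq]]]]|nb] :=
    pselect (exists b, b \in op i /\ exists q, q \in P /\ L (q^-1 * (b.1.2 * h))%g); last first.
  rewrite big_seq_cond big1 // => a /andP[ain _]; rewrite v0 ?mulr0 // => -[p [pP Lp]].
  by apply: nb; exists a; split => //; exists p.
(* Within its coset [h] may be moved so that the term of [b] falls on a point of
   [P]; then the sum for [v] is the sum for [u]. *)
pose h' := (b.1.2^-1 * q)%g.
have hE : h = (h' * (q^-1 * (b.1.2 * h)))%g by rewrite /h' -!mulgA mulVKg mulKg.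
transitivity (opapp u i h'); last exact: u0.
rewrite /opapp big_seq_cond [RHS]big_seq_cond; apply: eq_bigr => a /andP[ain _].
congr (_ * _); rewrite hE mulgA iv //.
have [[p [pP Lp]]|np] := pselect (exists p, p \in P /\ L (p^-1 * (a.1.2 * h'))%g).
  have L'p : L' (p^-1 * (a.1.2 * h'))%g.
    by move: Lp; rewrite /h' !mulgA; exact: (H1 i a b).
  by rewrite -[(a.1.2 * h')%g](mulVKg p) vE // iu.
rewrite v0 //; apply/esym/eqP/negPn/negP => /su [p pP L'p].
by apply: np; exists p; split => //; exact: sub.
Qed.

(** The argument of Gersten and of Howie and Schneebeli: descend from the whole
    group to the trivial subgroup through kernels of homomorphisms to the reals,
    passing each time to the subgroup generated by the finitely many elements
    that identify points of the support or of its neighbourhood; their number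
    drops at every step. *)
Lemma locally_indicable_op_inj P :
  locally_indicable R H -> op_inj P setT -> op_inj P [set 1%g].
Proof.
move=> li inj.
(* [T] collects the elements through which a subgroup can identify two points of
   [P], or two of their translates under the operator. *)
pose D := flatten [seq [seq (a.1.2 * b.1.2^-1)%g | a <- op i, b <- op i] | i <- enum I].
pose T := [seq (p^-1 * q)%g | p <- P, q <- P] ++
  [seq (pd * q)%g | pd <- [seq (p^-1 * d)%g | p <- P, d <- D], q <- P].
have T1 p q : p \in P -> q \in P -> (p^-1 * q)%g \in T.
  move=> pP qP; rewrite mem_cat; apply/orP; left.
  exact: (allpairs_f (fun p q => (p^-1 * q)%g)).
have T2 i a b p q : a \in op i -> b \in op i -> p \in P -> q \in P ->
    (p^-1 * a.1.2 * b.1.2^-1 * q)%g \in T.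
  move=> ai bi pP qP; rewrite mem_cat; apply/orP; right.
  apply: (allpairs_f (fun d q => (d * q)%g)) => //.
  rewrite -mulgA; apply: (allpairs_f (fun p d => (p^-1 * d)%g)) => //; apply/flatten_mapP; exists i.
    by rewrite mem_enum.
  exact: (allpairs_f (fun a b => (a.1.2 * b.1.2^-1)%g)).
(* The number of elements of [T] in the subgroup decreases: each of them that is
   still present lies in the generated subgroup, and [phi] excludes one. *)
suff main n : forall L, subgrp L -> op_inj P L ->
    (count (fun t => `[< L t >]) T < n)%N -> op_inj P [set 1%g].
  by apply: (main _ _ _ inj (ltnSn _)); split.
elim: n => // n IH L sL injL cL.
pose T0 := [seq t <- T | `[< L t >]].
have sT0 : genby T0 `<=` L.
  by apply: genby_sub => // t; rewrite mem_filter => /andP[/asboolP].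
have gT0 t : t \in T -> L t -> genby T0 t.
  by move=> tT Lt; apply: genby_mem; rewrite mem_filter tT andbT; apply/asboolP.
have sg := genby_subgrp T0.
have inj0 : op_inj P (genby T0).
  apply: op_inj_sub injL => // [i a b p q ai bi pP qP|p q pP qP]; apply: gT0.
    exact: (T2 i a b).
  exact: T1.
have [/allP t1|] := boolP (all (pred1 1%g) T0).
  have s01 : genby T0 `<=` [set 1%g].
    apply: genby_sub => [|t /t1 /eqP //].
    by split => // x y -> ->; rewrite mulVg.
  apply: op_inj_sub inj0 => //.
  - by split => // x y -> ->; rewrite mulVg.
  - by move=> x ->; case: sg.
  - by move=> i a b p q _ _ _ _; exact: s01.
  - by move=> p q _ _; exact: s01.
move=> /allPn[t tT0 tn1]; have [phi [phiM [t' t'T0 pt']]] := li T0 (ex_intro2 _ _ t tT0 tn1).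
apply: (IH [set l | genby T0 l /\ phi l = 0]).
- split=> [|x y [gx px] [gy py]] /=.
    by split; [case: sg|exact: (phi1 sg phiM)].
  split; first exact: sg.2.
  by rewrite phiM ?(phiV sg phiM) ?px ?py ?oppr0 ?addr0 //; exact: (subgrpV sg).
- exact: (op_inj_ker sg).
rewrite -ltnS; apply: leq_ltn_trans cL; rewrite -[X in (_ < X)%N]size_filter -/T0.
rewrite (@eq_in_count _ _ (predI (fun t => `[<genby T0 t /\ phi t = 0>]) (fun t => `[<L t>]))).
  rewrite -count_filter -/T0 ltn_neqAle count_size andbT -all_count.
  apply/allPn; exists t' => //; apply/asboolP => -[_ p0]; by rewrite p0 eqxx in pt'.
move=> x _ /=; apply/asboolP/andP => [[gx px]|[/asboolP]//].
by split; apply/asboolP => //; exact: sT0.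
Qed.

End Tower.

(** * Conradian orders *)

Definition left_order (H : groupType) (le : H -> H -> Prop) : Prop :=
    [/\ forall x, le x x,
        forall x y, le x y -> le y x -> x = y,
        forall x y z, le x y -> le y z -> le x z,
        forall x y, le x y \/ le y x &
        forall g x y, le x y -> le (g * x)%g (g * y)%g].

Section ZPower.
Variable H : groupType.
Implicit Types (t : H) (a b : int).

Definition zexp t a : H :=
  match a with Posz n => (t ^+ n)%g | Negz n => ((t ^+ n.+1)^-1)%g end.

Lemma zexpS t a : zexp t (a + 1) = (zexp t a * t)%g.
Proof.
case: a => [n|[|n]]; first by rewrite -PoszD addn1 /= expgSr.
  by rewrite (_ : Negz 0 + 1 = 0) //= expg1 mulVg.
have -> : Negz n.+1 + 1 = Negz n by rewrite !NegzE (@intS n.+1) opprD addrAC addNr add0r.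
by rewrite /= [in RHS]expgS invgM mulgVK.
Qed.

Lemma zexpB t a : zexp t (a - 1) = (zexp t a * t^-1)%g.
Proof. by apply: (mulIg t); rewrite -zexpS subrK mulgVK. Qed.

Lemma zexpD t a b : zexp t (a + b) = (zexp t a * zexp t b)%g.
Proof.
elim: b => [|n IH|n IH]; first by rewrite addr0 mulg1.
  by rewrite -addn1 PoszD addrA !zexpS IH mulgA.
by rewrite -addn1 PoszD opprD addrA !zexpB IH mulgA.
Qed.

Lemma zexp1 t : zexp t 1 = t. Proof. by []. Qed.

Lemma zexpN t a : zexp t (- a) = (zexp t a)^-1%g.
Proof. by apply: (mulIg (zexp t a)); rewrite -zexpD addNr mulVg. Qed.

Lemma subgrp_zexp (L : set H) t a : subgrp L -> L t -> L (zexp t a).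
Proof.
move=> sL Lt; elim: a => [|n IH|n IH]; first by case: sL.
  by rewrite -addn1 PoszD zexpS; exact: (subgrpM sL).
by rewrite -addn1 PoszD opprD zexpB; apply: (subgrpM sL) => //; exact: (subgrpV sL).
Qed.

End ZPower.

Section LeftOrder.
Variables (H : groupType) (le : H -> H -> Prop).
Hypothesis lo : left_order le.
Implicit Types x y z u v s t f g k w : H.

Local Notation lt x y := (~ le y x).

Lemma lo_refl x : le x x. Proof. by case: lo. Qed.
Lemma lo_anti x y : le x y -> le y x -> x = y. Proof. by case: lo => _ + _ _ _; apply. Qed.
Lemma lo_trans y x z : le x y -> le y z -> le x z.
Proof. by case: lo => _ _ + _ _; apply. Qed.
Lemma lo_mul g x y : le x y -> le (g * x)%g (g * y)%g.
Proof. by case: lo => _ _ _ _; apply. Qed.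
Lemma lo_ltW x y : lt x y -> le x y.
Proof. by case: lo => _ _ _ tot _ xy; case: (tot x y) => // /xy. Qed.
Lemma lo_le_lt y x z : le x y -> lt y z -> lt x z.
Proof. by move=> xy yz zx; apply: yz; exact: lo_trans xy. Qed.
Lemma lo_lt_le y x z : lt x y -> le y z -> lt x z.
Proof. by move=> xy yz zx; apply: xy; exact: lo_trans zx. Qed.
Lemma lo_mulK g x y : le (g * x)%g (g * y)%g -> le x y.
Proof. by move=> /(lo_mul g^-1%g); rewrite !mulKg. Qed.
Lemma lo_ltM g x y : lt x y -> lt (g * x)%g (g * y)%g.
Proof. by move=> xy /lo_mulK. Qed.
Lemma lo_ltMr x t : lt 1%g t -> lt x (x * t)%g.
Proof. by move=> /(lo_ltM (g := x)); rewrite mulg1. Qed.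
Lemma lo_neq x y : le x y -> x <> y -> lt x y.
Proof. by move=> xy nxy yx; apply: nxy; exact: lo_anti. Qed.

Lemma lo_exp_ge1 u n : le 1%g u -> le 1%g (u ^+ n)%g.
Proof.
move=> u1; elim: n => [|n IH]; first exact: lo_refl.
rewrite expgSr; apply: lo_trans IH _.
by rewrite -[X in le X _]mulg1; exact: lo_mul.
Qed.

Lemma lo_exp_gt1 u n : lt 1%g u -> lt 1%g (u ^+ n.+1)%g.
Proof.
move=> u1; rewrite expgSr; apply: lo_le_lt (lo_ltMr u1).
by apply: lo_exp_ge1; exact: lo_ltW.
Qed.

Lemma lo_zexp_lt t a b : lt 1%g t -> a < b -> lt (zexp t a) (zexp t b).
Proof.
move=> t1 ab; rewrite -[b](subrKC a) zexpD -[X in lt X _]mulg1; apply: lo_ltM.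
have : 0 < b - a by rewrite subr_gt0.
by case: (b - a) => // -[|n] // _; exact: lo_exp_gt1.
Qed.

Lemma lo_zexp_le t a b : lt 1%g t -> a <= b -> le (zexp t a) (zexp t b).
Proof.
move=> t1; rewrite le_eqVlt => /orP[/eqP -> |ab]; first exact: lo_refl.
by apply: lo_ltW; exact: lo_zexp_lt.
Qed.

Definition conradian := forall f g, lt 1%g f -> lt 1%g g ->
  exists n, lt g (f * g ^+ n)%g.

Hypothesis con : conradian.

(** If [f * g * g <= g], then all products [k ^+ n * g] with [k = f * g] stay below
    [g], against the Conrad property of [f] and [k]. *)
Lemma conradian2 f g : lt 1%g f -> lt 1%g g -> lt g (f * g * g)%g.
Proof.
move=> f1 g1 fgg; pose k := (f * g)%g.
have k1 : lt 1%g k.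
  apply: lo_lt_le f1 _; rewrite -[X in le X _]mulg1; apply: lo_mul; exact: lo_ltW.
have kg n : le (k ^+ n * g)%g g.
  elim: n => [|n IH]; first by rewrite mul1g; exact: lo_refl.
  by rewrite expgSr -mulgA; apply: lo_trans IH; exact: lo_mul.
have [n /(_ _)] := con f1 k1; apply.
apply: (@lo_trans (f * (k ^+ n * g))%g); first by apply: lo_mul; exact/lo_ltW/lo_ltMr.
by rewrite /k; apply: lo_mul.
Qed.

Section Generated.
Variable T : seq H.

Local Notation L := (genby T).

Definition dominates t := lt 1%g t /\ forall s, s \in T -> le s t /\ le s^-1%g t.

Lemma dominates_le t w : dominates t -> le t w -> dominates w.
Proof.
move=> [t1 tT] tw; split; first exact: lo_lt_le tw.
by move=> s /tT[st st']; split; apply: lo_trans tw.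
Qed.

Lemma conradian_up t u n : lt 1%g t -> le 1%g u -> le (t ^+ n)%g (u * t ^+ (n + n))%g.
Proof.
move=> t1 u1; have [<-|/eqP un] := eqVneq 1%g u.
  rewrite mul1g expgnDr -[X in le X _]mulg1; apply: lo_mul.
  by apply: lo_exp_ge1; exact: lo_ltW.
case: n => [|n]; first by rewrite mulg1.
rewrite expgnDr mulgA; apply/lo_ltW/conradian2; first exact: lo_neq.
exact: lo_exp_gt1.
Qed.

Lemma conradian_low t u n : lt 1%g t -> le 1%g u ->
  le 1%g (t ^+ (n + n) * u * (t ^+ n)^-1)%g.
Proof.
move=> t1 u1; have [->|n0] := posnP n; first by rewrite mul1g invg1 mulg1.
apply: contrapT => h; pose z := (t ^+ (n + n) * u * (t ^+ n)^-1)%g.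
have z1 : lt 1%g z^-1%g.
  by move=> /(lo_mul z); rewrite mulgV mulg1; exact: h.
have tn1 : lt 1%g (t ^+ n)%g by rewrite -(prednK n0); exact: lo_exp_gt1.
have := conradian2 z1 tn1; apply.
rewrite /z expgnDr !invgM invgK !mulgA !mulgVK.
rewrite -[X in le _ X]mulg1; apply: lo_mul.
by apply: (@lo_mulK u); rewrite mulgV mulg1.
Qed.

Lemma genby_ind (B : set H) : B 1%g ->
  (forall s b, s \in T -> B b -> B (s * b)%g /\ B (s^-1 * b)%g) -> L `<=` B.
Proof.
move=> B1 BT g Lg.
suff : forall b, B b -> B (g * b)%g /\ B (g^-1 * b)%g.
  by move=> /(_ 1%g B1); rewrite mulg1 => -[].
apply: (Lg [set x | forall b, B b -> B (x * b)%g /\ B (x^-1 * b)%g]).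
  split=> [b Bb|x y xB yB b Bb]; first by rewrite invg1 mul1g.
  rewrite invgM invgK -!mulgA; split; first by apply xB, yB.
  by apply yB, xB.
by move=> s sT b; exact: BT.
Qed.

(** The order is not invariant on the right, so a product of [n] generators need not
    lie below [t ^+ n]; but a further generator no more than doubles the exponent,
    up to one. *)
Lemma cofinal_up t g : dominates t -> L g -> exists n, le g (t ^+ n)%g.
Proof.
move=> [t1 tT]; move: g.
have key s b n : le s t -> le b (t ^+ n)%g -> le (s * b)%g (t ^+ (n + n).+1)%g.
  move=> st bn; apply: (@lo_trans (s * t ^+ n)%g); first exact: lo_mul.
  have u1 : le 1%g (s^-1 * t)%g by apply: (@lo_mulK s); rewrite mulg1 mulVKg.
  have := conradian_up n t1 u1.
  by move=> /(lo_mul s); rewrite !mulgA mulgV mul1g expgS.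
apply: (@genby_ind [set g | exists n, le g (t ^+ n)%g]); first by exists 0%N; exact: lo_refl.
move=> s b /tT[st st'] [n bn].
by split; exists (n + n).+1; apply: key.
Qed.

Lemma cofinal_low t g : dominates t -> L g -> exists n, le (t ^+ n)^-1%g g.
Proof.
move=> [t1 tT]; move: g.
have key s b n : le s^-1%g t -> le (t ^+ n)^-1%g b ->
    le (t ^+ (n.+1 + n.+1))^-1%g (s * b)%g.
  move=> st bn; apply: (@lo_trans (s * (t ^+ n)^-1)%g); last exact: lo_mul.
  have u1 : le 1%g (s * t)%g by apply: (@lo_mulK s^-1%g); rewrite mulg1 mulKg.
  have := conradian_low n.+1 t1 u1.
  move=> /(lo_mul (t ^+ (n.+1 + n.+1))^-1)%g; rewrite mulg1 !mulgA mulVg mul1g.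
  by rewrite [(t ^+ n.+1)%g]expgSr invgM mulgA mulgK.
apply: (@genby_ind [set g | exists n, le (t ^+ n)^-1%g g]).
  by exists 0%N; rewrite invg1; exact: lo_refl.
move=> s b /tT[st st'] [n bn].
by split; exists (n.+1 + n.+1)%N; apply: key => //; rewrite invgK.
Qed.

(** Otherwise the inverse of [y^-1 * u * y] lies above [t], so it dominates the
    generators and its powers are cofinal; but the powers of [u], hence those of
    its conjugate, stay on the other side. *)
Lemma right_invariant_upto t u y : dominates t -> L y -> le 1%g u ->
  lt y (u * y * t)%g.
Proof.
move=> dt Ly u1 uyt; pose w := (y^-1 * (u * y))%g.
have tw : le t w^-1%g.
  apply: (@lo_mulK w); rewrite mulgV /w; apply: (@lo_mulK y).
  by rewrite -!mulgA mulVKg mulg1 mulgA.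
have dW := dominates_le dt tw; have sL := genby_subgrp T.
have Lz : L y^-1%g by exact: (subgrpV sL).
(* A power of [w^-1] carries [y^-1] above its initial position, a power of [u]
   below it. *)
have [n' up] := cofinal_up dW Lz; have [n low] := cofinal_low dW Lz.
set W := (w^-1)%g in dW up low; pose j := (n'.+1 + n)%N.
have zj : lt y^-1%g (W ^+ j * y^-1)%g.
  apply: (lo_le_lt up); apply: (@lo_lt_le (W ^+ n'.+1)%g).
    by rewrite expgSr; apply: lo_ltMr; case: dW.
  apply: (@lo_trans (W ^+ j * (W ^+ n)^-1)%g); last exact: lo_mul.
  by rewrite /j expgnDr mulgK; exact: lo_refl.
apply: zj; apply: (@lo_mulK (w ^+ j)%g); rewrite mulgA.
rewrite /W expVgn mulgV mul1g.
have -> : (w ^+ j)%g = (y^-1 * (u ^+ j * y))%g.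
  by rewrite -[LHS]/(((u ^ y) ^+ j)%g) -conjXg.
rewrite -!mulgA mulgV mulg1 -[X in le X _]mulg1; apply: lo_mul; exact: lo_exp_ge1.
Qed.

Lemma le_mulr_upto t u v y : dominates t -> L y -> le v u ->
  lt (v * y)%g (u * y * t)%g.
Proof.
move=> dt Ly vu; have : le 1%g (v^-1 * u)%g by apply: (@lo_mulK v); rewrite mulg1 mulVKg.
move=> /(right_invariant_upto dt Ly) /(lo_ltM (g := v)).
by rewrite !mulgA mulgV mul1g.
Qed.

Variables (t : H).
Hypotheses (dt : dominates t) (Lt : L t).

Definition floor_at g (a : int) := le (zexp t a) g /\ lt g (zexp t (a + 1)).

Lemma floor_ex g : L g -> exists a, floor_at g a.
Proof.
move=> Lg; have [t1 _] := dt.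
have [m up] := cofinal_up dt Lg; have [n low] := cofinal_low dt Lg.
pose P (i : nat) := `[< le (zexp t (i%:Z - n%:Z)) g >].
have P0 : exists i, P i.
  by exists 0%N; apply/asboolP; rewrite sub0r zexpN.
have Pb (i : nat) : P i -> (i <= n + m)%N.
  move=> /asboolP h; rewrite leqNgt; apply/negP => mk.
  have : lt (t ^+ m)%g (zexp t (i%:Z - n%:Z)).
    by rewrite -[(t ^+ m)%g]/(zexp t m%:Z); apply: lo_zexp_lt => //; lia.
  by apply; apply: lo_trans up.
have [k /asboolP Pk kmax] := ex_maxnP P0 Pb.
exists (k%:Z - n%:Z); split => // h.
have e : k.+1%:Z - n%:Z = k%:Z - n%:Z + 1 by lia.
have /kmax : P k.+1 by apply/asboolP; rewrite e.
by rewrite ltnn.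
Qed.

Lemma floor_le g a b : floor_at g a -> le (zexp t b) g -> b <= a.
Proof.
have [t1 _] := dt.
move=> [_ ga] bg; rewrite leNgt; apply/negP => ab; apply: ga.
by apply: lo_trans bg; apply: lo_zexp_le => //; lia.
Qed.

Lemma floor_lt g a b : floor_at g a -> lt g (zexp t b) -> a < b.
Proof.
have [t1 _] := dt.
move=> [ga _] bg; rewrite ltNge; apply/negP => ab; apply: bg.
by apply: lo_trans ga; apply: lo_zexp_le.
Qed.

Lemma floor_uniq g a b : floor_at g a -> floor_at g b -> a = b.
Proof.
move=> ga gb; apply/le_anti/andP; split.
  by apply: (floor_le gb); case: ga.
by apply: (floor_le ga); case: gb.
Qed.

Lemma floor_t g a : floor_at g a -> floor_at (t * g)%g (1 + a).
Proof.
move=> [h1 h2]; split; first by rewrite zexpD zexp1; exact: lo_mul.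
by rewrite -addrA zexpD zexp1; exact: lo_ltM.
Qed.

(** Right invariance up to one factor [t] makes the position among the powers of [t]
    a quasimorphism. *)
Lemma floor_mul g h a b c : floor_at g a -> floor_at h b ->
  floor_at (g * h)%g c -> `|c - b| <= `|a| + 2.
Proof.
move=> [ga ag] [hb bh] fc; have sL := genby_subgrp T.
have lo1 : a + b - 1 <= c.
  apply: (floor_le fc); apply: (@lo_trans (g * zexp t b)%g); last exact: lo_mul.
  have := le_mulr_upto dt (subgrp_zexp (b - 1) sL Lt) ga.
  by rewrite -zexpD -mulgA -zexpS subrK addrA => /lo_ltW.
have hi : c < a + b + 3.
  apply: (floor_lt fc); apply: (@lo_le_lt (g * zexp t (b + 1))%g).
    by apply: lo_mul; exact: lo_ltW.
  have := le_mulr_upto dt (subgrp_zexp (b + 1) sL Lt) (lo_ltW ag).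
  rewrite -zexpD -zexpS; have -> : a + 1 + (b + 1) + 1 = a + b + 3 by lia.
  by [].
lia.
Qed.

End Generated.
End LeftOrder.

(** * Left orderable amenable groups are locally indicable *)

Section UltraLimits.
Variables (R : realType) (I : Type) (U : set_system I).
Hypothesis uU : UltraFilter U.

Lemma ultra_bounded_cvg (a : I -> R) (B : R) : U [set i | `|a i| <= B] ->
  exists l : R, a @ U --> l.
Proof.
move=> aB; have uaU : UltraFilter (a @ U).
  split; first exact: fmap_proper_filter.
  move=> G pG sub; apply/seteqP; split => // A GA.
  have [//|UnA] := in_ultra_setVsetC (a @^-1` A) uU.
  have /sub GnA : (a @ U) (~` A) by exact: UnA.
  have := filterI GA GnA; rewrite setICr => h0; exact: (False_ind _ (@filter_not_empty _ G pG (h0 _))).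
have := @segment_compact R (- B) B; rewrite compact_ultra => /(_ _ uaU).
case=> [|l [_ al]]; last by exists l.
have : U (a @^-1` `[- B, B]) by apply: filterS aB => i; rewrite /= in_itv /= -ler_norml.
exact.
Qed.

Definition ulim (a : I -> R) : R := xget 0 [set l : R | a @ U --> l].

Lemma ulimP (a : I -> R) (B : R) : U [set i | `|a i| <= B] -> a @ U --> ulim a.
Proof.
by move=> aB; exact: (@xgetPex _ 0 [set l : R | a @ U --> l] (ultra_bounded_cvg aB)).
Qed.

Lemma ulim_unique (a : I -> R) (l : R) : a @ U --> l -> ulim a = l.
Proof.
move=> al; have au : a @ U --> ulim a by exact: (@xgetPex _ 0 [set l : R | a @ U --> l] (ex_intro _ l al)).
exact: (cvg_unique (F := a @ U) _ au al).
Qed.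

End UltraLimits.

Section Folner.
Variables (R : realType) (H : groupType).
Hypothesis am : amenable R H.

Lemma folner (K : seq H) (e : R) : 0 < e -> exists2 F : seq H, uniq F /\ (0 < size F)%N &
  forall g, g \in K -> (count (fun x => (g * x)%g \notin F) F)%:R <= e * (size F)%:R.
Proof.
move=> e0; have [F F0 FK] := am [fset x in K]%fset e0.
exists (enum_fset F); first by rewrite fset_uniq cardfs_gt0.
move=> g gK; apply: le_trans (FK g _); last by rewrite inE.
rewrite ler_nat -size_filter -(size_map (fun x => (g * x)%g)).
have u : uniq [seq (g * x)%g | x <- [seq x <- enum_fset F | (g * x)%g \notin F]].
  by rewrite map_inj_uniq ?filter_uniq ?fset_uniq //; exact: mulgI.
apply: (uniq_leq_size u) => y /mapP[x]; rewrite mem_filter => /andP[gxF xF] ->.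
rewrite inE; apply/orP; left; rewrite inE gxF /=.
by apply/imfsetP; exists x.
Qed.

End Folner.

Section Recurrence.
Variables (R : realType) (H : groupType) (le : H -> H -> Prop).
Hypotheses (am : amenable R H) (lo : left_order le).

(** Failure of recurrence: the inequality [x < h * x] at [x] never returns during the
    next [M] steps of the orbit of [x] under [g]. *)
Definition wandering (M : nat) (g h x : H) :=
  ~ le (h * x)%g x /\
  forall m, (0 < m <= M)%N -> le (h * (g ^+ m * x))%g (g ^+ m * x)%g.

(** The sets [g ^+ m * B], for m up to M and B the set of wandering points, are
    pairwise disjoint. *)
Lemma wandering_count M g h (F : seq H) : uniq F ->
  (\sum_(m < M.+1) (count (fun x => `[< wandering M g h x >]) F -
      count (fun x => (g ^+ m * x)%g \notin F) F) <= size F)%N.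
Proof.
move=> uF; pose B (m : nat) := [seq x <- F | `[< wandering M g h x >] && ((g ^+ m * x)%g \in F)].
pose s := [seq (g ^+ m * x)%g | m <- iota 0 M.+1, x <- B m].
have us : uniq s.
  apply: allpairs_uniq_dep => [|m _|]; [exact: iota_uniq|exact: filter_uniq|].
  have key m1 m2 x1 x2 : (m1 < m2)%N -> (m2 <= M)%N -> wandering M g h x1 ->
      wandering M g h x2 -> (g ^+ m1 * x1)%g = (g ^+ m2 * x2)%g -> False.
    move=> lt12 m2M [w1 _] [_ w2] e.
    have x1E : x1 = (g ^+ (m2 - m1) * x2)%g.
      apply: (mulgI (g ^+ m1)%g); rewrite e mulgA -expgnDr subnKC //; exact: ltnW.
    apply: w1; rewrite x1E; apply: w2.
    by rewrite subn_gt0 lt12 (leq_trans (leq_subr _ _)).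
  move=> [m1 x1] [m2 x2] /allpairsPdep[m1' [x1' [m1M x1B [? ?]]]].
  move=> /allpairsPdep[m2' [x2' [m2M x2B [? ?]]]]; subst m1' m2' x1' x2' => /= e.
  move: m1M m2M x1B x2B; rewrite !mem_iota !add0n !mem_filter => /andP[_ m1M] /andP[_ m2M].
  move=> /andP[/andP[/asboolP w1 _] _] /andP[/andP[/asboolP w2 _] _].
  case: (ltngtP m1 m2) => [l|l|l]; [by case: (key m1 m2 x1 x2)|by case: (key m2 m1 x2 x1)|].
  by subst m2; congr existT; apply: mulgI e.
have ss : {subset s <= F}.
  by move=> y /allpairsPdep[m [x [_ xB ->]]]; move: xB; rewrite mem_filter => /andP[/andP[]].
apply: leq_trans (uniq_leq_size us ss).
rewrite size_allpairs_dep sumnE big_map -[iota 0 M.+1]/(index_iota 0 M.+1) big_mkord.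
apply: leq_sum => m _; rewrite size_filter leq_subLR.
rewrite -[X in (_ <= X)%N]addnC -[X in (X <= _)%N]add0n -count_predUI.
apply: leq_trans (leq_addr _ _); rewrite add0n; apply: sub_count => x /=.
by move=> ->; case: (_ \in _).
Qed.

Lemma wandering_small M g h (F : seq H) (e : R) : uniq F ->
  (forall m, (m <= M)%N ->
     (count (fun x => (g ^+ m * x)%g \notin F) F)%:R <= e * (size F)%:R) ->
  (count (fun x => `[< wandering M g h x >]) F)%:R <=
    (M.+1%:R^-1 + e) * (size F)%:R.
Proof.
move=> uF Fe; have := wandering_count M g h uF.
set b := count _ _; rewrite -(ler_nat R) natr_sum => le1.
have : \sum_(m < M.+1) (b%:R - e * (size F)%:R) <= (size F)%:R.
  apply: le_trans le1; apply: ler_sum => m _; rewrite lerBlDr.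
  apply: le_trans (lerD (lexx _) (Fe m _)); last by rewrite -ltnS.
  by rewrite -natrD ler_nat; lia.
rewrite sumr_const card_ord -[_ *+ M.+1]mulr_natl => le2.
have M0 : 0 < M.+1%:R :> R by rewrite ltr0n.
rewrite mulrDl -lerBlDr -(ler_pM2l M0); apply: le_trans le2 _.
by rewrite mulrA mulfV ?mul1r // gt_eqF.
Qed.

Variable e : nat -> H * H.

(** The points that wander for the pair number [k] make up little more than the
    proportion [2 ^- k.+2] of a Folner set, so that some point wanders for none
    of the first [j] pairs. *)
Lemma recurrent_point (j : nat) : exists x, forall k, (k < j)%N ->
  ~ wandering (2 ^ k.+2) (e k).1 (e k).2 x.
Proof.
(* With this precision the total proportion of wandering points is below
   [1/2 + j / (2 * (j + 1))], hence below 1. *)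
pose K := [seq ((e k).1 ^+ m)%g | k <- iota 0 j, m <- iota 0 (2 ^ k.+2).+1].
have d0 : 0 < (2 * j.+1%:R)^-1 :> R by rewrite invr_gt0 mulr_gt0 ?ltr0n.
have [F [uF F0] FK] := folner am K d0.
pose b k := count (fun x => `[< wandering (2 ^ k.+2) (e k).1 (e k).2 x >]) F.
have bk k : (k < j)%N -> (b k)%:R <= ((2 ^+ k.+2)^-1 + (2 * j.+1%:R)^-1) * (size F)%:R :> R.
  move=> kj; apply: le_trans (@wandering_small (2 ^ k.+2) _ _ F (2 * j.+1%:R)^-1 uF _) _.
    move=> m mM; apply: FK; apply/allpairsPdep; exists k, m.
    by rewrite !mem_iota !add0n ltnS.
  rewrite ler_wpM2r ?ler0n // lerD2r lef_pV2 ?posrE ?ltr0n // -?natrX ?ltr0n ?expn_gt0 //.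
  by rewrite ler_nat.
have sumb i : (i <= j)%N -> \sum_(k < i) (b k)%:R <=
    (2^-1 - (2 ^+ i.+1)^-1 + i%:R * (2 * j.+1%:R)^-1) * (size F)%:R :> R.
  elim: i => [|i IH] ij; first by rewrite big_ord0 expr1 subrr mul0r addr0 mul0r.
  rewrite big_ord_recr /=; apply: le_trans (lerD (IH (ltnW ij)) (bk i ij)) _.
  rewrite -mulrDl ler_wpM2r ?ler0n // -natr1 mulrDl mul1r.
  have -> : (2 ^+ i.+1)^-1 = (2 ^+ i.+2)^-1 + (2 ^+ i.+2)^-1 :> R.
    by rewrite [2 ^+ i.+2]exprS invfM; lra.
  lra.
have tot : (\sum_(k < j) b k < size F)%N.
  rewrite -(ltr_nat R) natr_sum; apply: le_lt_trans (sumb j (leqnn j)) _.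
  rewrite gtr_pMl ?ltr0n //.
  have p0 : 0 < (2 ^+ j.+1)^-1 :> R by rewrite invr_gt0 exprn_gt0.
  have : j%:R * (2 * j.+1%:R)^-1 <= 2^-1 :> R.
    by rewrite invfM mulrCA ler_piMr ?invr_ge0 // ler_pdivrMr ?ltr0n // mul1r ler_nat.
  move: (j%:R / _) (2 ^- _) p0 => u v; lra.
pose W x := [exists k : 'I_j, `[< wandering (2 ^ k.+2) (e k).1 (e k).2 x >]].
have cW : (count W F <= \sum_(k < j) b k)%N.
  rewrite /b; under eq_bigr do rewrite -sum1_count big_mkcond.
  rewrite exchange_big /= -sum1_count big_mkcond; apply: leq_sum => x _.
  by case: ifP => // /existsP[k wk]; rewrite (bigD1 k) //= wk.
have /allPn[x xF /existsPn xn] : ~~ all W F.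
  by rewrite all_count neq_ltn (leq_ltn_trans cW tot).
by exists x => k kj wk; have := xn (Ordinal kj) => /asboolP.
Qed.

End Recurrence.

Section ConradianOrder.
Variables (R : realType) (H : groupType) (le : H -> H -> Prop).
Hypotheses (am : amenable R H) (lo : left_order le).
Variable e : nat -> H.
Hypothesis eP : forall x, exists k, e k = x.

Lemma ultra_bounded_ex (T : Type) (U : set_system T) (P : nat -> set T) n :
  UltraFilter U -> U [set j | exists2 m, (0 < m <= n)%N & P m j] ->
  exists2 m, (0 < m <= n)%N & U (P m).
Proof.
move=> uU; elim: n => [|n IH] UP.
  have : U set0 by apply: filterS UP => j [m] /=; case: m.
  by move/filter_not_empty.
have [UPn|UPn] := in_ultra_setVsetC (P n.+1) uU; first by exists n.+1; rewrite ?leqnn.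
have [m /andP[m0 mn] UPm] : exists2 m, (0 < m <= n)%N & U (P m).
  apply: IH; apply: filterS (filterI UP UPn) => j [[m /andP[m0 mn] Pm] /= nP].
  exists m => //; rewrite m0 /= -ltnS ltn_neqAle mn andbT.
  by apply/eqP => mE; apply: nP; rewrite -mE.
by exists m => //; rewrite m0 ltnW.
Qed.

(** After Morris: the translates of a left order by recurrent points of Folner sets
    accumulate at a left order in which [1 < h] implies [g ^+ m < h * g ^+ m] for
    some positive [m]. If [1 < g], then [g <= g ^+ m], which is the Conrad
    property. *)
Lemma amenable_conradian : exists2 le' : H -> H -> Prop, left_order le' & conradian le'.
Proof.
(* An enumeration of the pairs: every pair is handled by almost all [x j]. *)
pose e2 (k : nat) : H * H := let p := odflt (0%N, 0%N) (@choice.unpickle (nat * nat)%type k) in (e p.1, e p.2).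
have e2P g h : exists k, e2 k = (g, h).
  have [[a <-] [b <-]] := (eP g, eP h).
  by exists (@choice.pickle (nat * nat)%type (a, b)); rewrite /e2 choice.pickleK.
have /choice[x xP] := recurrent_point le am e2.
have [U [uU Uoo]] := @ultraFilterLemma nat \oo _.
pose le' g h := U [set j | le (g * x j)%g (h * x j)%g].
have lo' : left_order le'.
  split.
  - by move=> g; apply: filterE => j /=; exact: lo_refl.
  - move=> g h gh hg; have [j [h1 h2]] := filter_ex (filterI gh hg).
    by apply: (mulIg (x j)); exact: (lo_anti lo).
  - move=> f g h fg gh; apply: filterS2 fg gh => j; exact: lo_trans.
  - move=> g h; have [|nU] := in_ultra_setVsetC [set j | le (g * x j)%g (h * x j)%g] uU.
      by left.
    by right; apply: filterS nU => j /=; exact: (lo_ltW lo).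
  - by move=> f g h; apply: filterS => j /=; rewrite -!mulgA; exact: lo_mul.
exists le' => // h g h1 g1.
have [k ek] := e2P g h.
have nh : U [set j | ~ le (h * x j)%g (1 * x j)%g].
  by have [|] := in_ultra_setVsetC [set j | le (h * x j)%g (1 * x j)%g] uU.
have [n /andP[n0 _] Un] : exists2 m, (0 < m <= 2 ^ k.+2)%N &
    U [set j | ~ le (h * (g ^+ m * x j))%g (g ^+ m * x j)%g].
  apply: (@ultra_bounded_ex _ U (fun m => [set j | ~ le (h * (g ^+ m * x j))%g (g ^+ m * x j)%g])) => //.
  have kk : U [set j | (k < j)%N] by apply: Uoo; exists k.+1.
  apply: filterS2 nh kk => j /= hj kj; rewrite mul1g in hj.
  apply: contrapT => nex; apply: (xP j k kj); rewrite ek; split => // m mk.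
  by apply: contrapT => hm; apply: nex; exists m.
exists n => hle; have gn : le' g (g ^+ n)%g.
  rewrite -(prednK n0) expgS -[X in le' X _]mulg1; apply: (lo_mul lo').
  by apply: (lo_exp_ge1 lo'); exact: (lo_ltW lo').
have le1 := lo_trans lo' hle gn.
have [j [h2 h3]] := filter_ex (filterI le1 Un).
by apply: h3; rewrite mulgA.
Qed.

End ConradianOrder.

Section InvariantMean.
Variables (R : realType) (H : groupType) (e : nat -> H).
Hypotheses (am : amenable R H) (eP : forall x, exists k, e k = x).

(** An ultralimit of averages over Folner sets for larger and larger finite subsets
    of [H]. *)
Lemma invariant_mean : exists mean : (H -> R) -> R,
  [/\ forall f g (B C : R), (forall x, `|f x| <= B) -> (forall x, `|g x| <= C) ->
        mean (fun x => f x + g x) = mean f + mean g,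
      forall f (B : R) h, (forall x, `|f x| <= B) -> mean (fun x => f (h * x)%g) = mean f &
      forall c, mean (fun=> c) = c].
Proof.
have /choice[F FP] (j : nat) : exists F : seq H, (uniq F /\ (0 < size F)%N) /\
  forall g, g \in [seq e k | k <- iota 0 j] ->
    (count (fun x => (g * x)%g \notin F) F)%:R <= j.+1%:R^-1 * (size F)%:R :> R.
  have j0 : 0 < j.+1%:R^-1 :> R by rewrite invr_gt0.
  by have [F F1 F2] := folner am [seq e k | k <- iota 0 j] j0; exists F.
have [U [uU Uoo]] := @ultraFilterLemma nat \oo _.
pose avg (f : H -> R) j := (\sum_(x <- F j) f x) / (size (F j))%:R.
have sF j : 0 < (size (F j))%:R :> R by rewrite ltr0n; case: (FP j) => [[]].
have avgB f (B : R) : (forall x, `|f x| <= B) -> forall j, `|avg f j| <= B.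
  move=> fB j; rewrite normrM normfV [X in _ / X]gtr0_norm // ler_pdivrMr //.
  apply: le_trans (ler_norm_sum _ _ _) _.
  apply: (@le_trans _ _ (\sum_(x <- F j) B)); first by apply: ler_sum => x _.
  by rewrite big_const_seq count_predT iter_addr addr0 mulr_natr.
have avgU f (B : R) : (forall x, `|f x| <= B) -> avg f @ U --> ulim U (avg f).
  by move=> fB; apply: (ulimP uU (B := B)); apply: filterE => j; exact: avgB.
exists (fun f => ulim U (avg f)); split.
- move=> f g B C fB gC; apply: ulim_unique.
  have -> : avg (fun x => f x + g x) = avg f \+ avg g.
    by apply/funext => j; rewrite /avg big_split mulrDl.
  by apply: cvgD; [exact: avgU fB|exact: avgU gC].
- move=> f B h fB; apply: ulim_unique.
  have -> : avg (fun x => f (h * x)%g) =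
      avg f \+ (fun j => avg (fun x => f (h * x)%g) j - avg f j).
    by apply/funext => j /=; rewrite subrKC.
  rewrite -[X in _ --> X]addr0; apply: cvgD; first exact: avgU fB.
  have small j : h \in [seq e k | k <- iota 0 j] -> h^-1%g \in [seq e k | k <- iota 0 j] ->
      `|avg (fun x => f (h * x)%g) j - avg f j| <= 2 * B * j.+1%:R^-1.
    move=> hj hVj; have [[uF F0] Fh] := FP j.
    rewrite -mulrBl normrM normfV [X in _ / X]gtr0_norm // ler_pdivrMr //.
    rewrite (bigID (fun x => (h * x)%g \in F j)) [X in _ - X](bigID (fun x => (h^-1 * x)%g \in F j)) /=.
    have -> : \sum_(x <- F j | (h * x)%g \in F j) f (h * x)%g =
        \sum_(x <- F j | (h^-1 * x)%g \in F j) f x.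
      rewrite -big_filter -[RHS]big_filter -(big_map (fun x => (h * x)%g) xpredT f).
      apply: perm_big; apply: uniq_perm; [|exact: filter_uniq|].
        by rewrite map_inj_uniq ?filter_uniq //; exact: mulgI.
      move=> y; rewrite mem_filter; apply/mapP/andP => [[x]|[hy yF]].
        by rewrite mem_filter => /andP[hx xF] ->; rewrite mulKg.
      by exists (h^-1 * y)%g; rewrite ?mem_filter ?mulVKg // yF.
    rewrite opprD addrACA subrr add0r; apply: le_trans (ler_normB _ _) _.
    have bnd g (k : H -> H) : g \in [seq e k | k <- iota 0 j] ->
        `|\sum_(x <- F j | (g * x)%g \notin F j) f (k x)| <= B * j.+1%:R^-1 * (size (F j))%:R.
      move=> gj; apply: le_trans (ler_norm_sum _ _ _) _.
      apply: (@le_trans _ _ (\sum_(x <- F j | (g * x)%g \notin F j) B)); first by apply: ler_sum => x _.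
      rewrite big_const_seq iter_addr addr0 -[X in X <= _]mulr_natr -mulrA.
      apply: ler_wpM2l; last exact: Fh.
      exact: le_trans (normr_ge0 _) (fB 1%g).
    apply: le_trans (lerD (bnd h (fun x => (h * x)%g) hj) (bnd h^-1%g id hVj)) _.
    by rewrite -!mulrDl mulr_natl mulr2n.
  have [[k1 k1E] [k2 k2E]] := (eP h, eP h^-1%g).
  have z : (fun j => 2 * B * j.+1%:R^-1 : R) @ \oo --> (0 : R).
    by rewrite -[X in _ --> X](mulr0 (2 * B)); apply: cvgMr; exact: cvg_harmonic.
  have z' : (fun j => 2 * B * j.+1%:R^-1 : R) @ U --> (0 : R) by apply: cvg_trans z => A /=; exact: Uoo.
  apply: (@squeeze_cvgr _ _ _ _ (fun j => - (2 * B * j.+1%:R^-1)) (fun j => 2 * B * j.+1%:R^-1)).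
  + apply: Uoo; exists (k1 + k2).+1 => // j /= kj; rewrite -ler_norml; apply: small.
      by apply/mapP; exists k1 => //; rewrite mem_iota; lia.
    by apply/mapP; exists k2 => //; rewrite mem_iota; lia.
  + by rewrite -oppr0; exact: cvgN.
  + exact: z'.
- move=> c; apply: ulim_unique.
  have -> : avg (fun=> c) = fun=> c.
    apply/funext => j; rewrite /avg big_const_seq count_predT iter_addr addr0 -[_ *+ _]mulr_natr.
    by rewrite mulfK // gt_eqF.
  exact: cvg_cst.
Qed.

End InvariantMean.

(** Divide by a representative of the coset [L x]. *)
Lemma coset_projection (H : groupType) (L : set H) : subgrp L ->
  exists p : H -> H, (forall x, L (p x)) /\ forall l x, L l -> p (l * x)%g = (l * p x)%g.
Proof.
move=> sL; pose c x := xget 1%g [set y | L (x * y^-1)%g].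
have cP x : L (x * (c x)^-1)%g.
  by apply: (@xgetI _ _ [set y | L (x * y^-1)%g] x); rewrite /= mulgV; case: sL.
exists (fun x => (x * (c x)^-1)%g); split => // l x Ll; rewrite mulgA; congr (_ * _^-1)%g.
rewrite /c; congr (xget _ _); apply/seteqP; split => y /= h.
  have := subgrpM sL (subgrpV sL Ll) h; by rewrite !mulgA mulVg mul1g.
by rewrite -mulgA; exact: (subgrpM sL).
Qed.

Section LocalIndicability.
Variables (R : realType) (H : groupType) (e : nat -> H).
Hypotheses (am : amenable R H) (eP : forall x, exists k, e k = x).

Lemma max_exists (le : H -> H -> Prop) (s : seq H) x : left_order le -> x \in s ->
  exists2 t, t \in s & forall y, y \in s -> le y t.
Proof.
move=> lo; elim: s x => // a s IH x _; case: s IH => [|b s] IH.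
  exists a; first exact: mem_head.
  by move=> y; rewrite inE => /eqP ->; exact: (lo_refl lo).
have [t ts tm] := IH b (mem_head _ _).
have [at_|ta] : le a t \/ le t a by case: lo.
  exists t; first by rewrite inE ts orbT.
  by move=> y; rewrite inE => /orP[/eqP ->|/tm].
exists a; first exact: mem_head.
move=> y; rewrite inE => /orP[/eqP ->|/tm yt]; first exact: (lo_refl lo).
exact: (lo_trans lo) yt ta.
Qed.

(** For a dominating [t], the position of [g] among the powers of [t] is a
    quasimorphism; averaging its variation under left translation gives a
    homomorphism, which takes the value 1 at [t]. *)
Lemma left_orderable_amenable_locally_indicable :
  left_orderable H -> locally_indicable R H.
Proof.
move=> [le0 lo0] T [x xT x1].
have [le lo con] := amenable_conradian am lo0 eP.
have sL := genby_subgrp T.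
have [|t tT tm] := @max_exists le (T ++ [seq s^-1%g | s <- T]) x lo.
  by rewrite mem_cat xT.
have t1 : ~ le t 1%g.
  move=> t1; have x1' : le x 1%g by apply: (lo_trans lo) t1; apply: tm; rewrite mem_cat xT.
  have : le x^-1%g 1%g.
    by apply: (lo_trans lo) t1; apply: tm; rewrite mem_cat map_f ?orbT.
  move=> /(lo_mul lo x); rewrite mulgV mulg1 => x1''.
  by move/eqP: x1; apply; exact: (lo_anti lo).
have dt : dominates le T t.
  split => // s sT; split; apply: tm; rewrite mem_cat ?sT //.
  by rewrite map_f ?orbT.
have Lt : genby T t.
  move: tT; rewrite mem_cat => /orP[|/mapP[s sT ->]]; first exact: genby_mem.
  by apply: (subgrpV sL); exact: genby_mem.
pose N g := xget 0 [set a | floor_at le t g a].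
have NP g : genby T g -> floor_at le t g (N g).
  by move=> Lg; exact: (xgetPex 0 (floor_ex lo con dt Lg)).
have [p [Lp pM]] := coset_projection sL.
have [mean [meanD meanT meanC]] := invariant_mean am eP.
(* Positions only make sense in the subgroup, to which [p] projects the group. *)
pose d g x : R := (N (g * p x)%g)%:~R - (N (p x))%:~R.
have dB g y : genby T g -> `|d g y| <= (`|N g| + 2)%:~R.
  move=> Lg; rewrite /d -intrB -intr_norm ler_int.
  exact: (floor_mul lo con dt Lt (NP _ Lg) (NP _ (Lp y)) (NP _ (subgrpM sL Lg (Lp y)))).
pose phi g := mean (d g).
have phiM g h : genby T g -> genby T h -> phi (g * h)%g = phi g + phi h.
  move=> Lg Lh; rewrite -[phi g](meanT _ _ h (fun y => dB g y Lg)).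
  rewrite -(meanD _ _ _ _ (fun y => dB g (h * y)%g Lg) (fun y => dB h y Lh)).
  congr mean; apply/funext => y; rewrite /d pM // mulgA.
  by rewrite addrA subrK.
have phit : phi t = 1.
  rewrite -[RHS]meanC; congr mean; apply/funext => y; rewrite /d.
  have f1 := floor_t lo (NP _ (Lp y)).
  rewrite (floor_uniq lo dt (NP _ (subgrpM sL Lt (Lp y))) f1).
  by rewrite intrD addrK.
exists phi; split => //; move: tT; rewrite mem_cat => /orP[tT|/mapP[s sT tE]].
  by exists t => //; rewrite phit oner_eq0.
exists s => //; apply/eqP => ps; have := phiV sL phiM (genby_mem sT).
by rewrite -tE phit ps oppr0 => /eqP; rewrite oner_eq0.
Qed.

End LocalIndicability.

(** * Spectra of integer matrices *)

Local Notation toC := (real_complex _).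

(** The cross terms cancel by symmetry. *)
Lemma hermitian_form_split (R : realType) D (v : 'rV[R[i]]_D) (B : 'M[R]_D)
    (a := map_mx (@complex.Re R) v) (b := map_mx (@complex.Im R) v) : B^T = B ->
  (v *m map_mx toC B *m (map_mx Num.conj v)^T) 0 0 =
    toC ((a *m B *m a^T) 0 0 + (b *m B *m b^T) 0 0).
Proof.
move=> Bsym.
have ve : v = map_mx toC a + ('i)%C *: map_mx toC b.
  by apply/matrixP => i j; rewrite !mxE -complexE.
have vce : map_mx Num.conj v = map_mx toC a - ('i)%C *: map_mx toC b.
  apply/matrixP => i j; rewrite !mxE; case: (v i j) => x y /=.
  by rewrite [LHS]complexE /= rmorphN mulrN.
rewrite vce ve; clearbody a b; move=> {ve vce v}.
have cross : a *m B *m b^T = b *m B *m a^T.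
  transitivity (a *m B *m b^T)^T; last by rewrite !trmx_mul trmxK Bsym mulmxA.
  by apply/matrixP => i j; rewrite [RHS]mxE !ord1.
rewrite linearB linearZ /= !map_trmx.
rewrite mulmxBr !mulmxDl -!scalemxAl -!scalemxAr -!map_mxM -cross.
rewrite scalerA -expr2 sqr_i scaleN1r opprD opprK addrA addrK.
by rewrite !mxE rmorphD.
Qed.

(** The spectral theorem for normal complex matrices, applied to a real symmetric
    one; each eigenvalue is a sum of values of the real quadratic form at the
    real and imaginary parts of an eigenvector. *)
Lemma psd_diagonalization (R : realType) D (A : 'M[R]_D) (C : R) : A^T = A ->
  (forall v : 'rV[R]_D, 0 <= (v *m A *m v^T) 0 0 <= C * (v *m v^T) 0 0) ->
  exists (P : 'M[R[i]]_D) (lam : 'I_D -> R), [/\ P \in unitmx,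
    map_mx toC A = invmx P *m diag_mx (\row_i toC (lam i)) *m P &
    forall i, 0 <= lam i <= C].
Proof.
move=> Asym Apos; pose AC := map_mx toC A.
have ACn : AC \is normalmx.
  apply: symmetric_normalmx.
    by apply/is_hermitianmxP; rewrite expr0 scale1r map_mx_id // /AC map_trmx Asym.
  apply/mxOverP => i j; rewrite mxE realE !lecE /= eqxx /=; exact: le_total.
have ACE := elimT (@orthomx_spectralP _ _ AC) ACn; rewrite /= in ACE.
have Pu := spectral_unit AC; have := spectral_unitarymx AC.
move: (spectralmx AC) (spectral_diag AC) Pu ACE => P d Pu ACE /unitarymxP PPt.
have rowE (B : 'M[R[i]]_D) i :
    (row i P *m B *m (map_mx Num.conj (row i P))^T) 0 0 = (P *m B *m map_mx Num.conj P^T) i i.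
  by rewrite -row_mul mxE [RHS]mxE; apply: eq_bigr => j _; rewrite !mxE.
pose lam i : R := complex.Re (d 0 i).
have lamP i : d 0 i = toC (lam i) /\ 0 <= lam i <= C.
  have e1 := hermitian_form_split (row i P) (trmx1 R D).
  rewrite map_mx1 rowE !mulmx1 PPt mxE eqxx in e1.
  have e2 := hermitian_form_split (row i P) Asym.
  rewrite rowE -/AC ACE !mulmxA mulmxV // mul1mx -mulmxA PPt mulmx1 mxE eqxx mulr1n in e2.
  move: e1 e2; move: (map_mx (@complex.Re R) _) (map_mx (@complex.Im R) _) => a b e1 e2.
  have l : lam i = (a *m A *m a^T) 0 0 + (b *m A *m b^T) 0 0 by rewrite /lam e2.
  split; first by rewrite l.
  have n1 : (a *m a^T) 0 0 + (b *m b^T) 0 0 = 1.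
    by move: e1 => /(congr1 (@complex.Re R)) /= <-.
  rewrite l; have /andP[b1 b2] := Apos b; have /andP[a1 a2] := Apos a.
  rewrite addr_ge0 //=.
  by apply: le_trans (lerD a2 b2) _; rewrite -mulrDr n1 mulr1.
have dE : d = \row_i toC (lam i) by apply/rowP => i; rewrite mxE; case: (lamP i).
exists P, lam; split; [exact: Pu|by rewrite -dE; exact: ACE|].
by move=> i; case: (lamP i).
Qed.

Section DiagonalizedMatrix.
Variables (R : realType) (D : nat) (A : 'M[R]_D) (P : 'M[R[i]]_D) (lam : 'I_D -> R).
Hypotheses (Pu : P \in unitmx)
  (AE : map_mx toC A = invmx P *m diag_mx (\row_i toC (lam i)) *m P).

Lemma trace_power_eigenvalues c k :
  \tr ((1 - c *: A) ^+ k) = \sum_i (1 - c * lam i) ^+ k.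
Proof.
have diagE (a b : 'I_D -> R[i]) : (forall i, a i = b i) -> diag_mx (\row_i a i) = diag_mx (\row_i b i).
  by move=> ab; congr diag_mx; apply/rowP => i; rewrite !mxE.
have diagM (a b : 'I_D -> R[i]) : diag_mx (\row_i a i) *m diag_mx (\row_i b i) =
    diag_mx (\row_i (a i * b i)).
  by rewrite mulmx_diag; congr diag_mx; apply/rowP => i; rewrite !mxE.
have diag1 : diag_mx (\row_(i < D) (1 : R[i])) = 1%:M.
  by apply/matrixP => i j; rewrite !mxE.
have [Q [QP PQ QE]] : exists Q : 'M[R[i]]_D, [/\ Q *m P = 1%:M, P *m Q = 1%:M & invmx P = Q].
  by exists (invmx P); rewrite mulVmx ?mulmxV.
move: AE; rewrite QE => AQ.
have e : map_mx toC (1 - c *: A) = Q *m diag_mx (\row_i toC (1 - c * lam i)) *m P.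
  have -> : diag_mx (\row_i toC (1 - c * lam i)) = 1%:M - toC c *: diag_mx (\row_i toC (lam i)).
    apply/matrixP => i j; rewrite !mxE; case: (i == j); rewrite ?mulr1n ?mulr0n ?mulr0 ?subrr //.
    by rewrite rmorphB rmorph1 rmorphM.
  by rewrite mulmxBr mulmx1 mulmxBl QP -scalemxAr -scalemxAl -AQ map_mxB map_mxZ map_mx1.
have ek : map_mx toC ((1 - c *: A) ^+ k) =
    Q *m diag_mx (\row_i toC ((1 - c * lam i) ^+ k)) *m P.
  elim: k => [|k IH].
    by rewrite expr0 map_mx1 (diagE _ (fun=> 1)) ?diag1 ?mulmx1.
  rewrite exprS -mulmxE map_mxM IH e.
  rewrite -!mulmxA [P *m (Q *m _)]mulmxA PQ mul1mx [diag_mx _ *m (_ *m P)]mulmxA diagM.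
  by congr (_ *m (_ *m _)); apply: diagE => i; rewrite exprS rmorphM.
apply: (@complexI R).
rewrite -(trace_map_mx toC) ek mxtrace_mulC mulmxA PQ mul1mx mxtrace_diag.
by rewrite rmorph_sum; apply: eq_bigr => i _; rewrite mxE.
Qed.

Lemma rank_eigenvalues : (\rank A <= \sum_i (lam i != 0%R))%N.
Proof.
rewrite -(mxrank_map toC) AE; apply: leq_trans (mxrankM_maxl _ _) _.
apply: leq_trans (mxrankM_maxr _ _) _.
have -> : diag_mx (\row_i toC (lam i)) = \sum_i toC (lam i) *: delta_mx i i.
  apply/matrixP => i j; rewrite !mxE summxE (bigD1 i) //= big1 ?addr0 => [|l li].
    by rewrite !mxE eqxx /= [j == i]eq_sym; case: eqP => _; rewrite ?mulr1 ?mulr0.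
  by rewrite !mxE [i == l]eq_sym (negPf li) mulr0.
elim/big_ind2: _ => [|B1 n1 B2 n2 h1 h2|i _]; first by rewrite mxrank0.
  exact: leq_trans (mxrank_add _ _) (leq_add h1 h2).
have [->|l0] := eqVneq (lam i) 0; first by rewrite rmorph0 scale0r mxrank0.
by apply: leq_trans (mxrank_scale _ _) _; rewrite mxrank_delta.
Qed.

(** The nonzero eigenvalues multiply, up to sign, to the lowest nonzero
    coefficient of the characteristic polynomial, which is an integer. *)
Lemma integer_eigenvalue_product (T : 'M[int]_D) : A = map_mx intr T ->
  1 <= \prod_(i | lam i != 0) `|lam i|.
Proof.
move=> AT; (* The multiplicity of the eigenvalue 0. *)
pose z := (\sum_(i | lam i == 0%R) 1)%N.
have cp : map_poly toC (char_poly A) = \prod_i ('X - (toC (lam i))%:P).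
  rewrite map_char_poly AE /char_poly.
  have -> : char_poly_mx (invmx P *m diag_mx (\row_i toC (lam i)) *m P) =
     map_mx polyC (invmx P) *m char_poly_mx (diag_mx (\row_i toC (lam i))) *m map_mx polyC P.
    rewrite /char_poly_mx mulmxBr mulmxBl -!map_mxM; congr (_ - _).
    by rewrite mul_mx_scalar -scalemxAl -map_mxM mulVmx // map_mx1 scalemx1.
  rewrite !det_mulmx !det_map_mx det_inv mulrAC -rmorphM /= mulVr ?mul1r -?unitmxE //.
  rewrite -[\det (char_poly_mx _)]/(char_poly _) char_poly_trig ?diag_mx_is_trig //.
  by apply: eq_bigr => i _; rewrite !mxE eqxx mulr1n.
have cpR : char_poly A = \prod_i ('X - (lam i)%:P).
  apply: (@map_poly_inj _ _ toC); rewrite cp rmorph_prod.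
  by apply: eq_bigr => i _; rewrite rmorphB /= map_polyX map_polyC.
have coefz : (char_poly A)`_z = \prod_(i | lam i != 0) (- lam i).
  rewrite cpR (bigID (fun i => lam i == 0)) /= (eq_bigr (fun=> 'X)); last first.
    by move=> i /eqP ->; rewrite subr0.
  rewrite prodr_const -[#|_|]sum1_card -/z coefXnM ltnn subnn -horner_coef0 horner_prod.
  by apply: eq_bigr => i _; rewrite hornerXsubC sub0r.
have coefT : (char_poly A)`_z = ((char_poly T)`_z)%:~R by rewrite AT -map_char_poly coef_map.
rewrite -(eq_bigr _ (fun i _ => normrN (lam i))) -normr_prod -coefz coefT.
rewrite -intr_norm -[1]/(1%:~R) ler_int -gtz0_ge1 normr_gt0.
rewrite -(intr_eq0 R) -coefT coefz prodf_seq_neq0.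
by apply/allP => i _; rewrite oppr_eq0; apply/implyP.
Qed.

End DiagonalizedMatrix.

(** The nonzero eigenvalues have product at least 1 and are at most [C], so at most
    [D / L] of them can lie below [C ^- L]; each of the larger ones contributes
    at most the power in the last term. *)
Lemma integer_trace_power (R : realType) D (T : 'M[int]_D) (C L m : nat)
    (A := map_mx intr T : 'M[R]_D) : T^T = T -> (2 <= C)%N -> (0 < L)%N ->
  (forall v : 'rV[R]_D, 0 <= (v *m A *m v^T) 0 0 <= C%:R * (v *m v^T) 0 0) ->
  \tr ((1 - C%:R^-1 *: A) ^+ m) <=
    (D - \rank A)%:R + D%:R / L%:R + D%:R * (1 - C%:R^-1 ^+ L.+1) ^+ m.
Proof.
move=> Tsym C2 L0 Apos.
have Asym : A^T = A by rewrite /A map_trmx Tsym.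
have [P [lam [Pu AE lamP]]] := psd_diagonalization Asym Apos.
have C0 : 0 < C%:R :> R by rewrite ltr0n; lia.
pose eps : R := C%:R^-1 ^+ L.
have eps0 : 0 < eps by rewrite exprn_gt0 ?invr_gt0.
have eps1 : C%:R^-1 * eps <= 1.
  rewrite -exprS; apply: exprn_ile1; rewrite ?invr_ge0 ?ler0n // invf_le1 // ler1n; lia.
pose small i := (lam i != 0) && (lam i <= eps).
rewrite (trace_power_eigenvalues Pu AE).
have step i : (1 - C%:R^-1 * lam i) ^+ m <=
    (lam i == 0)%:R + (small i)%:R + (1 - C%:R^-1 ^+ L.+1) ^+ m.
  have /andP[l0 lC] := lamP i.
  have h0 : 0 <= 1 - C%:R^-1 * lam i by rewrite subr_ge0 mulrC ler_pdivrMr // mul1r.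
  have e0 : 0 <= 1 - C%:R^-1 ^+ L.+1 :> R by rewrite subr_ge0 exprS.
  have p0 : 0 <= (1 - C%:R^-1 ^+ L.+1) ^+ m :> R by rewrite exprn_ge0.
  have le1 : (1 - C%:R^-1 * lam i) ^+ m <= 1.
    by rewrite exprn_ile1 // lerBlDr lerDl mulr_ge0 ?invr_ge0 // ltW.
  rewrite /small; have [l|l] /= := eqVneq (lam i) 0; first by rewrite addr0; lra.
  have [leps|leps] := leP (lam i) eps; first by rewrite /=; lra.
  rewrite !add0r; apply: lerXn2r; rewrite ?nnegrE //.
  rewrite lerD2l lerN2 exprS ler_pM2l ?invr_gt0 //; exact: ltW.
apply: le_trans (ler_sum _ (fun i _ => step i)) _.
rewrite !big_split /= sumr_const card_ord -[_ *+ D]mulr_natl lerD2r; apply: lerD.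
  rewrite -natr_sum ler_nat.
  have := rank_eigenvalues AE.
  have : (\sum_i (lam i == 0)%R + \sum_i (lam i != 0)%R = D)%N.
    rewrite -big_split /= -[RHS]card_ord -sum1_card; apply: eq_bigr => i _.
    by case: eqP.
  move=> h1 h2; rewrite -[X in (X <= _)%N](addnK (\sum_i (lam i != 0%R))%N) h1.
  exact: leq_sub2l.
rewrite -natr_sum; set s := (\sum_i _)%N.
rewrite ler_pdivlMr ?ltr0n // -natrM ler_nat.
have := integer_eigenvalue_product Pu AE erefl.
have Ce : C%:R * eps ^+ 0 = C%:R :> R by rewrite mulr1.
have bnd : \prod_(i | lam i != 0) `|lam i| <= \prod_(i : 'I_D) (C%:R * eps ^+ small i).
  rewrite big_mkcond /=; apply: ler_prod => i _.
  have /andP[l0 lC] := lamP i; have Cge1 : 1 <= C%:R :> R by rewrite ler1n; lia.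
  rewrite /small; have [l|l] /= := eqVneq (lam i) 0; first by rewrite ler01 mulr1.
  rewrite normr_ge0 ger0_norm //=; have [leps|leps] := leP (lam i) eps; last by rewrite mulr1.
  by apply: le_trans leps _; rewrite expr1 ler_peMl // ltW.
move=> /le_trans /(_ bnd); rewrite big_split /= prodr_const card_ord prodrXr -/s.
rewrite /eps -exprM exprVn ler_pdivlMr ?mul1r ?exprn_gt0 // -!natrX ler_nat.
by rewrite leq_exp2l // mulnC.
Qed.

(** * Summable and square summable families *)

Section Sums.
Variables (R : realType) (X : choiceType).
Implicit Types (f g a b : X -> R) (s : seq X).

(** Summability of a nonnegative family, as a bound on its finite sums; sums in the
    extended reals are handled through such bounds. *)
Definition sum_le (B : R) f := forall s, uniq s -> \sum_(x <- s) f x <= B.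
Definition nnsum f : R := fine (\esum_(x in [set: X]) (f x)%:E).

Lemma esum_ge_seq f s : (forall x, 0 <= f x) -> uniq s ->
  ((\sum_(x <- s) f x)%:E <= \esum_(x in [set: X]) (f x)%:E)%E.
Proof.
move=> f0 us; apply: esum_ge; exists [set` s]; first by split => //; exact: finite_seq.
by rewrite -fsbig_seq // -sumEFin.
Qed.

Lemma esum_le_seq f (B : R) : sum_le B f -> (\esum_(x in [set: X]) (f x)%:E <= B%:E)%E.
Proof.
move=> fB; apply: ge_ereal_sup => _ [A [finA _] <-].
by rewrite fsbig_finite // sumEFin lee_fin; apply: fB; exact: fset_uniq.
Qed.

Lemma nnsumE f (B : R) : (forall x, 0 <= f x) -> sum_le B f ->
  (\esum_(x in [set: X]) (f x)%:E = (nnsum f)%:E)%E.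
Proof.
move=> f0 /esum_le_seq fB; rewrite /nnsum fineK // ge0_fin_numE.
  by apply: le_lt_trans fB _; rewrite ltry.
by apply: esum_ge0 => x _; rewrite lee_fin.
Qed.

Lemma nnsum_ge f (B : R) s : (forall x, 0 <= f x) -> sum_le B f -> uniq s ->
  \sum_(x <- s) f x <= nnsum f.
Proof. by move=> f0 fB us; rewrite -lee_fin -(nnsumE f0 fB); exact: esum_ge_seq. Qed.

Lemma nnsum_le f (B : R) : (forall x, 0 <= f x) -> sum_le B f -> nnsum f <= B.
Proof. by move=> f0 fB; rewrite -lee_fin -(nnsumE f0 fB); exact: esum_le_seq. Qed.

Lemma nnsum_ge0 f : (forall x, 0 <= f x) -> 0 <= nnsum f.
Proof. by move=> f0; apply: fine_ge0; apply: esum_ge0 => x _; rewrite lee_fin. Qed.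

Lemma sum_leD (B C : R) f g : sum_le B f -> sum_le C g -> sum_le (B + C) (fun x => f x + g x).
Proof. by move=> fB gC s us; rewrite big_split lerD ?fB ?gC. Qed.

Lemma le_sum_le (B : R) f g : (forall x, f x <= g x) -> sum_le B g -> sum_le B f.
Proof. by move=> fg gB s us; apply: le_trans (gB s us); apply: ler_sum. Qed.

Lemma nnsumD f g (B C : R) : (forall x, 0 <= f x) -> (forall x, 0 <= g x) ->
  sum_le B f -> sum_le C g -> nnsum (fun x => f x + g x) = nnsum f + nnsum g.
Proof.
move=> f0 g0 fB gC; have fg0 x : 0 <= f x + g x by rewrite addr_ge0.
apply: EFin_inj; rewrite -(nnsumE fg0 (sum_leD fB gC)) EFinD.
rewrite -(nnsumE f0 fB) -(nnsumE g0 gC) -esumD //= => [x _|x _]; by rewrite lee_fin.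
Qed.

Definition summ a := exists B, sum_le B (fun x => `|a x|).

Lemma summ_nn f : (forall x, 0 <= f x) -> summ f -> exists B, sum_le B f.
Proof.
move=> f0 [B fB]; exists B; apply: le_sum_le fB => x; exact: ler_norm.
Qed.

Lemma le_summ a b : (forall x, `|a x| <= `|b x|) -> summ b -> summ a.
Proof. by move=> ab [B bB]; exists B; exact: le_sum_le bB. Qed.

Lemma summD a b : summ a -> summ b -> summ (fun x => a x + b x).
Proof.
move=> [B aB] [C bC]; exists (B + C); apply: le_sum_le (sum_leD aB bC) => x.
exact: ler_normD.
Qed.

Lemma summ0 : summ (fun=> 0).
Proof. by exists 0 => s _; rewrite big1 // => x _; rewrite normr0. Qed.

Lemma rsumE a : rsum a = nnsum (fun x => Num.max (a x) 0) - nnsum (fun x => Num.max (- a x) 0).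
Proof. by []. Qed.

(** Every decomposition into nonnegative summable families computes the sum, not only
    the one into positive and negative parts; additivity follows. *)
Lemma rsumB_nn f g : (forall x, 0 <= f x) -> (forall x, 0 <= g x) -> summ f -> summ g ->
  rsum (fun x => f x - g x) = nnsum f - nnsum g.
Proof.
move=> f0 g0 sf sg; have [B fB] := summ_nn f0 sf; have [C gC] := summ_nn g0 sg.
rewrite rsumE; set p := fun x => Num.max (f x - g x) 0; set q := fun x => Num.max (- (f x - g x)) 0.
have p0 x : 0 <= p x by rewrite le_max lexx orbT.
have q0 x : 0 <= q x by rewrite le_max lexx orbT.
have pB : sum_le B p.
  by apply: le_sum_le fB => x; rewrite ge_max f0 lerBlDr lerDl g0.
have qC : sum_le C q.
  by apply: le_sum_le gC => x; rewrite ge_max g0 opprB lerBlDr lerDl f0.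
have : nnsum (fun x => p x + g x) = nnsum (fun x => q x + f x).
  congr nnsum; apply/funext => x; rewrite /p /q.
  by case: (leP 0 (f x - g x)) => h; [rewrite max_r|rewrite max_l]; lra.
rewrite (nnsumD p0 g0 pB gC) (nnsumD q0 f0 qC fB); lra.
Qed.

Lemma rsum_nn f : (forall x, 0 <= f x) -> rsum f = nnsum f.
Proof.
move=> f0; rewrite rsumE [X in X - _](_ : _ = nnsum f); last first.
  by congr nnsum; apply/funext => x; rewrite max_l.
rewrite [X in _ - X](_ : _ = 0) ?subr0 // /nnsum esum1 // => x _.
by rewrite max_r // oppr_le0.
Qed.

Lemma eq_rsum a b : (forall x, a x = b x) -> rsum a = rsum b.
Proof. by move=> ab; congr rsum; apply/funext. Qed.

Lemma rsumN a : rsum (fun x => - a x) = - rsum a.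
Proof.
by rewrite !rsumE opprB; congr (_ - nnsum _); apply/funext => x; rewrite opprK.
Qed.

Lemma pos_part_summ a : summ a ->
  summ (fun x => Num.max (a x) 0) /\ summ (fun x => Num.max (- a x) 0).
Proof.
move=> sa; split; apply: le_summ sa => x.
  by case: (leP (a x) 0) => h; [rewrite normr0|].
by case: (leP (- a x) 0) => h; [rewrite normr0|rewrite normrN].
Qed.

Lemma rsumD a b : summ a -> summ b -> rsum (fun x => a x + b x) = rsum a + rsum b.
Proof.
move=> sa sb; have [sa1 sa2] := pos_part_summ sa; have [sb1 sb2] := pos_part_summ sb.
pose mx (u : R) := Num.max u 0.
have m0 u : 0 <= mx u by rewrite /mx le_max lexx orbT.
have mE u : mx u - mx (- u) = u.
  by rewrite /mx; case: (leP u 0) => h; [rewrite max_l|rewrite max_r]; lra.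
rewrite (@eq_rsum _ (fun x => (mx (a x) + mx (b x)) - (mx (- a x) + mx (- b x)))); last first.
  by move=> x; rewrite -{1}(mE (a x)) -{1}(mE (b x)); lra.
have n0 u v : 0 <= mx u + mx v by rewrite addr_ge0.
rewrite rsumB_nn //; try exact: summD.
have [A1 B1] := summ_nn (fun x => m0 (a x)) sa1; have [A2 B2] := summ_nn (fun x => m0 (- a x)) sa2.
have [A3 B3] := summ_nn (fun x => m0 (b x)) sb1; have [A4 B4] := summ_nn (fun x => m0 (- b x)) sb2.
rewrite (nnsumD (fun x => m0 (a x)) (fun x => m0 (b x)) B1 B3).
rewrite (nnsumD (fun x => m0 (- a x)) (fun x => m0 (- b x)) B2 B4).
by rewrite !rsumE /mx; lra.
Qed.

Lemma nnsumZ (c : R) f (B : R) : 0 <= c -> (forall x, 0 <= f x) -> sum_le B f ->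
  nnsum (fun x => c * f x) = c * nnsum f.
Proof.
move=> c0 f0 fB; have cf0 x : 0 <= c * f x by rewrite mulr_ge0.
have cfB : sum_le (c * nnsum f) (fun x => c * f x).
  by move=> s us; rewrite -mulr_sumr ler_wpM2l // (nnsum_ge f0 fB).
apply/le_anti/andP; split; first exact: (nnsum_le cf0 cfB).
have [->|cn0] := eqVneq c 0; first by rewrite mul0r nnsum_ge0 // => x; rewrite mul0r.
have {cn0} c1 : 0 < c by rewrite lt_def cn0.
rewrite mulrC -ler_pdivlMr //; apply: (nnsum_le f0) => s us.
rewrite ler_pdivlMr // mulrC mulr_sumr; exact: (nnsum_ge cf0 cfB).
Qed.

Lemma rsumZ (c : R) a : summ a -> rsum (fun x => c * a x) = c * rsum a.
Proof.
move=> sa; wlog c0 : c / 0 <= c => [h|].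
  have [/h //|/ltW c0] := leP 0 c.
  rewrite -[c]opprK mulNr -(h (- c)) ?oppr_ge0 // -rsumN.
  by apply: eq_rsum => x; rewrite mulNr.
have [sa1 sa2] := pos_part_summ sa.
have m0 (u : R) : 0 <= Num.max u 0 by rewrite le_max lexx orbT.
have [A1 B1] := summ_nn (fun x => m0 (a x)) sa1; have [A2 B2] := summ_nn (fun x => m0 (- a x)) sa2.
rewrite !rsumE mulrBr -(nnsumZ c0 (fun x => m0 (a x)) B1) -(nnsumZ c0 (fun x => m0 (- a x)) B2).
by congr (nnsum _ - nnsum _); apply/funext => x; rewrite maxr_pMr // mulr0 // mulrN.
Qed.

Lemma rsum0 : rsum (fun _ : X => 0 : R) = 0 :> R.
Proof. by rewrite rsum_nn // /nnsum esum1. Qed.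

Lemma rsum_sum (I : Type) (r : seq I) (P : pred I) (F : I -> X -> R) :
  (forall i, summ (F i)) ->
  rsum (fun x => \sum_(i <- r | P i) F i x) = \sum_(i <- r | P i) rsum (F i).
Proof.
move=> sF.
suff : summ (fun x => \sum_(i <- r | P i) F i x) /\
  rsum (fun x => \sum_(i <- r | P i) F i x) = \sum_(i <- r | P i) rsum (F i) by case.
elim: r => [|i r [IH1 IH2]].
  rewrite big_nil (_ : (fun x => _) = fun=> 0); last by apply/funext => x; rewrite big_nil.
  by split; [exact: summ0|exact: rsum0].
rewrite big_cons (_ : (fun x => _) =
    fun x => if P i then F i x + \sum_(i <- r | P i) F i x else \sum_(i <- r | P i) F i x).
  by case: ifP => // Pi; split; [exact: summD|rewrite rsumD // IH2].
by apply/funext => x; rewrite big_cons.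
Qed.

Lemma rsum_ge_seq f s : (forall x, 0 <= f x) -> summ f -> uniq s ->
  \sum_(x <- s) f x <= rsum f.
Proof.
by move=> f0 sf us; have [B fB] := summ_nn f0 sf; rewrite rsum_nn // (nnsum_ge f0 fB).
Qed.

Lemma rsum_le f (B : R) : (forall x, 0 <= f x) -> sum_le B f -> rsum f <= B.
Proof. by move=> f0 fB; rewrite rsum_nn // nnsum_le. Qed.

Lemma rsum_ge0 f : (forall x, 0 <= f x) -> 0 <= rsum f.
Proof. by move=> f0; rewrite rsum_nn // nnsum_ge0. Qed.

Lemma rsum_seq a s : uniq s -> (forall x, x \notin s -> a x = 0) ->
  rsum a = \sum_(x <- s) a x.
Proof.
have key f : uniq s -> (forall x, 0 <= f x) -> (forall x, x \notin s -> f x = 0) ->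
    nnsum f = \sum_(x <- s) f x.
  move=> us f0 fs.
  have fB : sum_le (\sum_(x <- s) f x) f.
    move=> s' us'; rewrite (bigID (mem s)) /= [X in _ + X]big1 ?addr0; last by move=> x /fs.
    rewrite -big_filter; have : perm_eq [seq x <- s' | x \in s] [seq x <- s | x \in s'].
      by apply: uniq_perm; rewrite ?filter_uniq // => x; rewrite !mem_filter andbC.
    move/(perm_big _) ->; rewrite big_filter [leRHS](bigID (fun x => x \in s')) /=.
    by rewrite lerDl sumr_ge0.
  apply/le_anti/andP; split; first exact: (nnsum_le f0).
  exact: (nnsum_ge f0 fB).
have m0 (u : R) : 0 <= Num.max u 0 by rewrite le_max lexx orbT.
move=> us as_; rewrite rsumE !key //; try by move=> x /as_ ->; rewrite ?oppr0 maxxx.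
rewrite -sumrB; apply: eq_bigr => x _.
by case: (leP (a x) 0) => h; [rewrite max_l|rewrite max_r]; lra.
Qed.

End Sums.

Lemma sum_le_bij (R : realType) (X Y : choiceType) (h : X -> Y) (f : Y -> R) (B : R) :
  injective h -> sum_le B f -> sum_le B (f \o h).
Proof.
move=> ih fB s us; rewrite -(big_map h xpredT f); apply: fB.
by rewrite map_inj_uniq.
Qed.

Lemma rsum_bij (R : realType) (X Y : choiceType) (h : X -> Y) (f : Y -> R) :
  bijective h -> rsum (f \o h) = rsum f.
Proof.
move=> bh; have hb : set_bij [set: X] [set: Y] h by rewrite setTT_bijective.
by rewrite /rsum; congr (fine _ - fine _); rewrite [RHS](reindex_esum _ _ _ _ hb).
Qed.

(** The first order condition at a minimum. *)
Lemma quadratic_nonneg_linear (R : realType) (b c : R) : 0 <= b ->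
  (forall t, 0 <= t ^+ 2 * b + 2 * t * c) -> c = 0.
Proof.
move=> b0 /(_ (- (c / (b + 1)))).
have b1 : b + 1 != 0 by rewrite gt_eqF //; lra.
have -> : c = c / (b + 1) * (b + 1) by rewrite divfK.
rewrite mulfK //; move: (c / (b + 1)) => t h.
have -> : t = 0 by apply/eqP; rewrite -sqrf_eq0; apply/eqP; nra.
by rewrite mul0r.
Qed.

Section SquareSummable.
Variables (R : realType) (X : choiceType).
Implicit Types (u v : X -> R) (s : seq X).

Definition sqs u := exists B, sum_le B (fun x => u x ^+ 2).
Definition ip1 u v : R := rsum (fun x => u x * v x).

Lemma sqs_mul u v : sqs u -> sqs v -> summ (fun x => u x * v x).
Proof.
move=> [B uB] [C vC]; exists (B + C); apply: le_sum_le (sum_leD uB vC) => x.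
rewrite -[u x ^+ 2](real_normK (num_real _)) -[v x ^+ 2](real_normK (num_real _)) normrM.
have := sqr_ge0 (`|u x| - `|v x|); have := normr_ge0 (u x); have := normr_ge0 (v x).
move: `|u x| `|v x| => a b; nra.
Qed.

Lemma le_sqs u v : (forall x, `|u x| <= `|v x|) -> sqs v -> sqs u.
Proof.
move=> uv [B vB]; exists B; apply: le_sum_le vB => x.
by rewrite -[u x ^+ 2](real_normK (num_real _)) -[v x ^+ 2](real_normK (num_real _)) lerXn2r ?nnegrE.
Qed.

Lemma sqsD u v : sqs u -> sqs v -> sqs (fun x => u x + v x).
Proof.
move=> [B uB] [C vC]; exists (2 * B + 2 * C) => s us.
have hv := uB s us; have hu := vC s us.
apply: (@le_trans _ _ (2 * (\sum_(x <- s) u x ^+ 2) + 2 * (\sum_(x <- s) v x ^+ 2))); last by lra.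
rewrite !mulr_sumr -big_split; apply: ler_sum => x _ /=.
by have := sqr_ge0 (u x - v x); nra.
Qed.

Lemma sqsZ (c : R) u : sqs u -> sqs (fun x => c * u x).
Proof.
move=> [B uB]; exists (c ^+ 2 * B) => s us.
under eq_bigr do rewrite exprMn.
by rewrite -mulr_sumr ler_wpM2l ?sqr_ge0 ?uB.
Qed.

Lemma sqsN u : sqs u -> sqs (fun x => - u x).
Proof. by apply: le_sqs => x; rewrite normrN. Qed.

Lemma sqs0 : sqs (fun=> 0).
Proof. by exists 0 => s _; rewrite big1 // => x _; rewrite expr0n. Qed.

Lemma sqs_sum (I : Type) (r : seq I) (P : pred I) (F : I -> X -> R) :
  (forall i, sqs (F i)) -> sqs (fun x => \sum_(i <- r | P i) F i x).
Proof.
move=> sF; elim: r => [|i r IH].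
  rewrite (_ : (fun x => _) = fun=> 0); first exact: sqs0.
  by apply/funext => x; rewrite big_nil.
rewrite (_ : (fun x => _) =
    fun x => if P i then F i x + \sum_(i <- r | P i) F i x else \sum_(i <- r | P i) F i x).
  by case: (P i) => //; exact: sqsD.
by apply/funext => x; rewrite big_cons.
Qed.

Lemma sqs_seq u s : (forall x, x \notin s -> u x = 0) -> sqs u.
Proof.
move=> us; exists (\sum_(x <- undup s) u x ^+ 2) => s' us'.
rewrite (bigID (mem s)) /= [X in _ + X]big1 ?addr0; last by move=> x /us ->; rewrite expr0n.
rewrite -big_filter; have : perm_eq [seq x <- s' | x \in s] [seq x <- undup s | x \in s'].
  by apply: uniq_perm; rewrite ?filter_uniq ?undup_uniq // => x; rewrite !mem_filter mem_undup andbC.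
move/(perm_big _) ->; rewrite big_filter [leRHS](bigID (fun x => x \in s')) /=.
by rewrite lerDl sumr_ge0 // => x _; rewrite sqr_ge0.
Qed.

Lemma ip1C u v : ip1 u v = ip1 v u.
Proof. by apply: eq_rsum => x; rewrite mulrC. Qed.

Lemma ip1Dl u u' v : sqs u -> sqs u' -> sqs v ->
  ip1 (fun x => u x + u' x) v = ip1 u v + ip1 u' v.
Proof.
move=> su su' sv; rewrite /ip1 -rsumD; try exact: sqs_mul.
by apply: eq_rsum => x; rewrite mulrDl.
Qed.

Lemma ip1Zl c u v : sqs u -> sqs v -> ip1 (fun x => c * u x) v = c * ip1 u v.
Proof.
move=> su sv; rewrite /ip1 -rsumZ; last exact: sqs_mul.
by apply: eq_rsum => x; rewrite mulrA.
Qed.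

Lemma ip1_suml (I : Type) (r : seq I) (P : pred I) (F : I -> X -> R) v :
  (forall i, sqs (F i)) -> sqs v ->
  ip1 (fun x => \sum_(i <- r | P i) F i x) v = \sum_(i <- r | P i) ip1 (F i) v.
Proof.
move=> sF sv; rewrite /ip1 -rsum_sum; last by move=> i; exact: sqs_mul.
by apply: eq_rsum => x; rewrite mulr_suml.
Qed.

Lemma ip1_seq u v s : uniq s -> (forall x, x \notin s -> v x = 0) ->
  ip1 u v = \sum_(x <- s) u x * v x.
Proof. by move=> us vs; apply: rsum_seq => // x /vs ->; rewrite mulr0. Qed.

Lemma ip1_ge0 u : 0 <= ip1 u u.
Proof. by apply: rsum_ge0 => x; rewrite -expr2 sqr_ge0. Qed.

Lemma ip1_ge_seq u s : sqs u -> uniq s -> \sum_(x <- s) u x ^+ 2 <= ip1 u u.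
Proof.
move=> su us; have := @rsum_ge_seq _ _ (fun x => u x * u x) s.
under eq_bigr do rewrite -expr2.
by apply=> // [x|]; [rewrite -expr2 sqr_ge0|exact: sqs_mul].
Qed.

Lemma ip1_le (B : R) u : sum_le B (fun x => u x ^+ 2) -> ip1 u u <= B.
Proof. by move=> uB; apply: rsum_le => [x|s /uB //]; rewrite -expr2 sqr_ge0. Qed.

End SquareSummable.

Lemma sqs_bij (R : realType) (X Y : choiceType) (h : X -> Y) (u : Y -> R) :
  injective h -> sqs u -> sqs (u \o h).
Proof. by move=> ih [B uB]; exists B; exact: (sum_le_bij ih uB). Qed.

(** Reindexing along a bijection: translations are unitary. *)
Lemma ip1_shift (R : realType) (X Y : choiceType) (h : X -> Y) (h' : Y -> X) (u : Y -> R) (v : X -> R) :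
  cancel h h' -> cancel h' h -> ip1 (u \o h) v = ip1 u (v \o h').
Proof.
move=> hh' h'h; rewrite /ip1 -(rsum_bij (h := h)); last by exists h'.
by apply: eq_rsum => x /=; rewrite hh'.
Qed.

Section Cochains.
Variables (R : realType) (X : choiceType) (n : nat).
Implicit Types y z : 'I_n -> X -> R.

Definition l2f y := forall k, sqs (y k).
Definition ip y z : R := \sum_k ip1 (y k) (z k).
Definition delta (K : pzRingType) (j : 'I_n) (x : X) : 'I_n -> X -> K :=
  fun k g => ((k == j) && (g == x))%:R.

Lemma ipC y z : ip y z = ip z y.
Proof. by apply: eq_bigr => k _; rewrite ip1C. Qed.

Lemma ipDl y y' z : l2f y -> l2f y' -> l2f z ->
  ip (fun k x => y k x + y' k x) z = ip y z + ip y' z.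
Proof.
move=> ly ly' lz; rewrite /ip -big_split; apply: eq_bigr => k _.
exact: ip1Dl.
Qed.

Lemma ipZl c y z : l2f y -> l2f z -> ip (fun k x => c * y k x) z = c * ip y z.
Proof. by move=> ly lz; rewrite /ip mulr_sumr; apply: eq_bigr => k _; exact: ip1Zl. Qed.

Lemma l2fD y z : l2f y -> l2f z -> l2f (fun k x => y k x + z k x).
Proof. by move=> ly lz k; exact: sqsD. Qed.

Lemma l2fZ c y : l2f y -> l2f (fun k x => c * y k x).
Proof. by move=> ly k; exact: sqsZ. Qed.

Lemma ip_ge0 y : 0 <= ip y y.
Proof. by apply: sumr_ge0 => k _; exact: ip1_ge0. Qed.

Lemma ip_norm_lin a b y z : l2f y -> l2f z ->
  ip (fun k x => a * y k x + b * z k x) (fun k x => a * y k x + b * z k x) =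
  a ^+ 2 * ip y y + 2 * a * b * ip y z + b ^+ 2 * ip z z.
Proof.
move=> ly lz; have lay := l2fZ a ly; have lbz := l2fZ b lz.
rewrite ipDl //; last exact: l2fD.
rewrite !ipZl //; try exact: l2fD.
rewrite [X in a * X]ipC [X in b * X]ipC !ipDl // !ipZl // [ip z y]ipC.
by ring.
Qed.

Lemma cauchy_schwarz y z : l2f y -> l2f z -> ip y z ^+ 2 <= ip y y * ip z z.
Proof.
move=> ly lz; have := ip_ge0 z; rewrite le_eqVlt => /predU1P[z0|zp].
  suff -> : ip y z = 0 by rewrite expr0n -z0 mulr0.
  apply: (quadratic_nonneg_linear (ip_ge0 y)) => a.
  by have := ip_ge0 (fun k x => a * y k x + 1 * z k x); rewrite ip_norm_lin // -z0; lra.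
have := ip_ge0 (fun k x => ip z z * y k x + (- ip y z) * z k x).
rewrite ip_norm_lin //; set p := ip y y; set q := ip y z; set r := ip z z in zp *.
have -> : r ^+ 2 * p + 2 * r * - q * q + (- q) ^+ 2 * r = r * (p * r - q ^+ 2) by ring.
by rewrite pmulr_rge0 // subr_ge0.
Qed.

Lemma l2f_delta j x : l2f (delta R j x).
Proof.
move=> k; apply: (@sqs_seq _ _ _ [:: x]) => g; rewrite inE /delta => /negPf ->.
by rewrite andbF.
Qed.

Lemma ip_delta y j x : ip y (delta R j x) = y j x.
Proof.
rewrite /ip (bigD1 j) //= big1 ?addr0 => [|k kj].
  rewrite (@ip1_seq _ _ _ _ [:: x]) // ?big_seq1 ?/delta ?eqxx ?mulr1 // => g.
  by rewrite inE => /negPf ->.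
by rewrite (@ip1_seq _ _ _ _ [::]) ?big_nil // => g _; rewrite /delta (negPf kj).
Qed.

End Cochains.

(** * Local operators on graphs with labelled edges *)

Definition linv n (a : 'I_n * bool) : 'I_n * bool := (a.1, ~~ a.2).
Definition inv_word n (w : word n) : word n := rev [seq linv a | a <- w].

Lemma linvK n : involutive (@linv n).
Proof. by move=> [k b]; rewrite /linv /= negbK. Qed.

Lemma inv_wordK n : involutive (@inv_word n).
Proof.
move=> w; rewrite /inv_word map_rev revK -map_comp map_id_in // => a _.
exact: linvK.
Qed.

Lemma size_inv_word n (w : word n) : size (inv_word w) = size w.
Proof. by rewrite size_rev size_map. Qed.

(** A graph in which every vertex has one outgoing edge for each letter. *)
Section Walks.
Variables (n : nat) (X : Type) (st : 'I_n * bool -> X -> X).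
Hypothesis stK : forall a, cancel (st a) (st (linv a)).

Definition walk (w : word n) (x : X) : X := foldl (fun x a => st a x) x w.

Lemma walk_cat w1 w2 x : walk (w1 ++ w2) x = walk w2 (walk w1 x).
Proof. exact: foldl_cat. Qed.

Lemma walkK w : cancel (walk w) (walk (inv_word w)).
Proof.
move=> x; elim: w x => [|a w IH] x //.
rewrite /inv_word map_cons rev_cons -cats1 walk_cat /= -/(inv_word w).
by rewrite IH stK.
Qed.

Lemma walkVK w : cancel (walk (inv_word w)) (walk w).
Proof. by move=> x; rewrite -{1}[w]inv_wordK walkK. Qed.

End Walks.

(** A row is a finite linear form on cochains with integer coefficients, given
    around every vertex by the words leading to the edges it involves. *)
Definition rowop n := seq (int * word n * 'I_n).

Section Operators.
Variables (n : nat) (X : choiceType) (st : 'I_n * bool -> X -> X) (K : pzRingType).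
Implicit Types (y : 'I_n -> X -> K) (th : rowop n).

Definition row_app th y (x : X) : K :=
  \sum_(t <- th) t.1.1%:~R * y t.2 (walk st t.1.2 x).

(** The formal adjoint of [row_app]; see [ip_row_adj]. *)
Definition row_adj th (u : X -> K) (j : 'I_n) (x : X) : K :=
  \sum_(t <- th | t.2 == j) t.1.1%:~R * u (walk st (inv_word t.1.2) x).

(** A positive operator whose kernel is the common kernel of the rows. *)
Definition lap (Ms : seq (rowop n)) y (j : 'I_n) (x : X) : K :=
  \sum_(th <- Ms) row_adj th (row_app th y) j x.

End Operators.

Section OperatorsL2.
Variables (R : realType) (n : nat) (X : choiceType) (st : 'I_n * bool -> X -> X).
Hypothesis stK : forall a, cancel (st a) (st (linv a)).
Implicit Types (y z : 'I_n -> X -> R) (th : rowop n) (u : X -> R).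

Lemma sqs_row_app th y : l2f y -> sqs (row_app st th y).
Proof.
move=> ly; apply: sqs_sum => t; apply: sqsZ.
by apply: (sqs_bij (h := walk st t.1.2)); [exact: can_inj (walkK stK _)|exact: ly].
Qed.

Lemma l2f_row_adj th u : sqs u -> l2f (row_adj st th u).
Proof.
move=> su j; apply: sqs_sum => t; apply: sqsZ.
by apply: (sqs_bij (h := walk st (inv_word t.1.2))); [exact: can_inj (walkVK stK _)|].
Qed.

Lemma l2f_lap Ms y : l2f y -> l2f (lap st Ms y).
Proof. by move=> ly j; apply: sqs_sum => th; apply: l2f_row_adj; exact: sqs_row_app. Qed.

Lemma ip_row_adj th y u : l2f y -> sqs u ->
  ip1 (row_app st th y) u = ip y (row_adj st th u).
Proof.
move=> ly su.
have s0 (t : int * word n * 'I_n) : sqs (fun x => y t.2 (walk st t.1.2 x)).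
  apply: (sqs_bij (h := walk st t.1.2) (u := y t.2)); last exact: ly.
  exact: can_inj (walkK stK _).
have s1 (t : int * word n * 'I_n) : sqs (fun x => t.1.1%:~R * y t.2 (walk st t.1.2 x)).
  by apply: sqsZ; apply: (sqs_bij (h := walk st t.1.2)); [exact: can_inj (walkK stK _)|].
have s2 (t : int * word n * 'I_n) : sqs (fun x => u (walk st (inv_word t.1.2) x)).
  by apply: (sqs_bij (h := walk st (inv_word t.1.2))); [exact: can_inj (walkVK stK _)|].
rewrite /row_app (ip1_suml _ _ s1 su).
under [RHS]eq_bigr => j _ do rewrite ip1C /row_adj (ip1_suml _ _ (fun t => sqsZ _ (s2 t)) (ly j)).
rewrite (exchange_big_dep xpredT) //=; apply: eq_bigr => t _.
rewrite (big_pred1 t.2); last by move=> j; rewrite /= eq_sym.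
rewrite (ip1Zl _ (s0 t) su) (ip1Zl _ (s2 t) (ly t.2)) [in RHS]ip1C; congr (_ * _).
exact: (ip1_shift (h := walk st t.1.2) _ _ (walkK stK _) (walkVK stK _)).
Qed.

Lemma ip_lap Ms y z : l2f y -> l2f z ->
  ip (lap st Ms y) z = \sum_(th <- Ms) ip1 (row_app st th y) (row_app st th z).
Proof.
move=> ly lz; rewrite /ip /lap.
have s1 j th : sqs (row_adj st th (row_app st th y) j) by apply: l2f_row_adj; exact: sqs_row_app.
under eq_bigr => j _ do rewrite (ip1_suml _ _ (s1 j) (lz j)).
rewrite exchange_big; apply: eq_bigr => th _ /=.
rewrite ip1C ip_row_adj //; last exact: sqs_row_app.
by rewrite ipC.
Qed.

End OperatorsL2.

(** A bound for the squared operator norm, coming from the inequality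
    [(a + b) ^+ 2 <= 2 * (a ^+ 2 + b ^+ 2)] at each term. *)
Fixpoint row_norm n (th : rowop n) : nat :=
  if th is t :: th' then (2 * (`|t.1.1| ^ 2 + row_norm th'))%N else 0%N.

Lemma row_app_norm (R : realType) n (X : choiceType) (st : 'I_n * bool -> X -> X)
    (th : rowop n) (y : 'I_n -> X -> R) :
  (forall a, cancel (st a) (st (linv a))) -> l2f y ->
  ip1 (row_app st th y) (row_app st th y) <= (row_norm th)%:R * ip y y.
Proof.
move=> stK ly; apply: ip1_le => s us; elim: th => [|t th IH] /=.
  by rewrite mul0r big1 // => x _; rewrite /row_app big_nil expr0n.
apply: (@le_trans _ _ (2 * (\sum_(x <- s) (t.1.1%:~R * y t.2 (walk st t.1.2 x)) ^+ 2 +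
    \sum_(x <- s) row_app st th y x ^+ 2))).
  rewrite -big_split mulr_sumr; apply: ler_sum => x _; rewrite /row_app big_cons /=.
  move: (_ * _) (\sum_(_ <- th) _) => a b; have := sqr_ge0 (a - b); nra.
rewrite natrM -mulrA; apply: ler_wpM2l => //; rewrite natrD mulrDl; apply: lerD => //.
under eq_bigr do rewrite exprMn.
rewrite -mulr_sumr natrX natr_absz -[t.1.1%:~R ^+ 2](real_normK (num_real _)) -intr_norm.
apply: ler_wpM2l; first exact: sqr_ge0.
apply: (@le_trans _ _ (ip1 (y t.2) (y t.2))).
  rewrite -(big_map (walk st t.1.2) xpredT (fun x => y t.2 x ^+ 2)); apply: ip1_ge_seq => //.
  by rewrite map_inj_uniq //; exact: can_inj (walkK stK _).
by rewrite /ip (bigD1 t.2) //= lerDl sumr_ge0 // => k _; exact: ip1_ge0.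
Qed.

Section LocalComparison.
Variables (K : pzRingType) (n : nat) (X X' : choiceType).
Variables (st : 'I_n * bool -> X -> X) (st' : 'I_n * bool -> X' -> X').
Variables (x0 : X) (x0' : X').

(** Balls about base points of two graphs are compared along walks, which does not
    require them to be isomorphic as graphs. *)
Definition agree (r : nat) (y : 'I_n -> X -> K) (y' : 'I_n -> X' -> K) :=
  forall w j, (size w <= r)%N -> y j (walk st w x0) = y' j (walk st' w x0').

Definition row_radius (l : nat) (th : rowop n) := all (fun t => (size t.1.2 <= l)%N) th.

Lemma agree_lap l (Ms : seq (rowop n)) r y y' : all (row_radius l) Ms ->
  agree (r + 2 * l) y y' -> agree r (lap st Ms y) (lap st' Ms y').
Proof.
move=> /allP Ml yy' w j wr; rewrite /lap big_seq [RHS]big_seq; apply: eq_bigr => th thM.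
have /allP tl := Ml _ thM; rewrite /row_adj big_seq_cond [RHS]big_seq_cond.
apply: eq_bigr => t /andP[tth _]; congr (_ * _).
rewrite /row_app big_seq [RHS]big_seq; apply: eq_bigr => t' t'th; congr (_ * _).
rewrite -!walk_cat; apply: yy'; rewrite !size_cat size_inv_word.
have h1 : (size t.1.2 <= l)%N := tl _ tth; have h2 : (size t'.1.2 <= l)%N := tl _ t'th.
by rewrite mul2n -addnn addnA !addnA !leq_add.
Qed.

Lemma agree_delta r j : (forall w, (size w <= r)%N -> walk st w x0 = x0 <-> walk st' w x0' = x0') ->
  agree r (delta K j x0) (delta K j x0').
Proof.
move=> h w k wr; rewrite /delta; congr (_ && _)%:R.
by apply/eqP/eqP; apply h.
Qed.

End LocalComparison.

Section Compression.
Variables (R : realType) (n : nat) (X : choiceType) (st : 'I_n * bool -> X -> X).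
Variables (Ms : seq (rowop n)) (c : R).

Definition contraction (y : 'I_n -> X -> R) : 'I_n -> X -> R :=
  fun j x => y j x - c * lap st Ms y j x.

Definition compression (P : seq X) (y : 'I_n -> X -> R) : 'I_n -> X -> R :=
  fun j x => if x \in P then contraction y j x else 0.

End Compression.

Lemma agree_compression (R : realType) n (X X' : choiceType) (st : 'I_n * bool -> X -> X)
    (st' : 'I_n * bool -> X' -> X') x0 x0' (Ms : seq (rowop n)) (c : R) (P : seq X) l r y y' :
  all (row_radius l) Ms -> (forall w, (size w <= r)%N -> walk st w x0 \in P) ->
  agree st st' x0 x0' (r + 2 * l) y y' ->
  agree st st' x0 x0' r (compression st Ms c P y) (contraction st' Ms c y').
Proof.
move=> Ml wP yy' w j wr; rewrite /compression wP // /contraction.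
by rewrite (agree_lap Ml yy') // yy' //; lia.
Qed.

(** Each application of the operator looks no farther than [2 * l], so the entry only
    depends on the ball of radius [2 * l * m], where the compression is not felt. *)
Lemma agree_iter_compression (R : realType) n (X X' : choiceType) (st : 'I_n * bool -> X -> X)
    (st' : 'I_n * bool -> X' -> X') x0 x0' (Ms : seq (rowop n)) (c : R) (P : seq X) l m j :
  all (row_radius l) Ms -> (forall w, (size w <= 2 * l * m)%N -> walk st w x0 \in P) ->
  (forall w, (size w <= 2 * l * m)%N -> walk st w x0 = x0 <-> walk st' w x0' = x0') ->
  iter m (compression st Ms c P) (delta R j x0) j x0 =
  iter m (contraction st' Ms c) (delta R j x0') j x0'.
Proof.
move=> Ml wP loc.
suff h k r : (k <= m)%N -> (r + 2 * l * k <= 2 * l * m)%N ->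
    agree st st' x0 x0' r (iter k (compression st Ms c P) (delta R j x0))
      (iter k (contraction st' Ms c) (delta R j x0')).
  by apply: (h m 0%N _ _ [::] j).
elim: k r => [|k IH] r km rk.
  by apply: agree_delta => w wr; apply: loc; lia.
apply: (@agree_compression _ _ _ _ _ _ _ _ _ _ _ l) => //; first by move=> w wr; apply: wP; lia.
by apply: IH; lia.
Qed.

Section IntegerCompression.
Variables (R : realType) (n : nat) (X : choiceType) (st : 'I_n * bool -> X -> X).
Hypothesis stK : forall a, cancel (st a) (st (linv a)).
Variables (Ms : seq (rowop n)) (P : seq X).
Hypothesis uP : uniq P.

Let I : finType := ('I_n * 'I_(size P))%type.
Let D := #|I|.
Let e (i : 'I_D) : 'I_n * X := ((enum_val i).1, tnth (in_tuple P) (enum_val i).2).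

Let e_inj : injective e.
Proof.
move=> i i' [e1 e2]; apply: enum_val_inj; case: (enum_val i) (enum_val i') e1 e2 => a b [a' b'] /= -> h.
by congr pair; move: h; apply/tuple_uniqP.
Qed.

Let eP i : (e i).2 \in P.
Proof. exact: mem_tnth. Qed.

Let e_surj j x : x \in P -> exists i, e i = (j, x).
Proof.
move=> xP; have /tnthP[b ->] : x \in in_tuple P by [].
by exists (enum_rank (j, b)); rewrite /e enum_rankK.
Qed.

Lemma lap_delta_int j x k z :
  lap st Ms (delta R j x) k z = (lap st Ms (delta int j x) k z)%:~R.
Proof.
rewrite /lap rmorph_sum; apply: eq_bigr => th _; rewrite /row_adj rmorph_sum.
apply: eq_bigr => t _; rewrite rmorphM /= intz; congr (_ * _).
rewrite /row_app rmorph_sum; apply: eq_bigr => t' _.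
by rewrite rmorphM /= intz /delta; congr (_ * _); case: (_ && _).
Qed.

Lemma row_app_sum (r : nat) (a : 'I_r -> R) (F : 'I_r -> 'I_n -> X -> R) th x :
  row_app st th (fun k x => \sum_i a i * F i k x) x = \sum_i a i * row_app st th (F i) x.
Proof.
rewrite /row_app; under [RHS]eq_bigr do rewrite mulr_sumr.
rewrite [RHS]exchange_big; apply: eq_bigr => t _; rewrite mulr_sumr.
by apply: eq_bigr => i _; rewrite mulrCA.
Qed.

Lemma lap_sum (r : nat) (a : 'I_r -> R) (F : 'I_r -> 'I_n -> X -> R) k x :
  lap st Ms (fun k x => \sum_i a i * F i k x) k x = \sum_i a i * lap st Ms (F i) k x.
Proof.
rewrite /lap; under [RHS]eq_bigr do rewrite mulr_sumr.
rewrite [RHS]exchange_big; apply: eq_bigr => th _; rewrite /row_adj.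
under [RHS]eq_bigr do rewrite mulr_sumr.
rewrite [RHS]exchange_big; apply: eq_bigr => t _; rewrite row_app_sum mulr_sumr.
by apply: eq_bigr => i _; rewrite mulrCA.
Qed.

Let dl i : 'I_n -> X -> R := delta R (e i).1 (e i).2.
Let T : 'M[int]_D := \matrix_(i, i') lap st Ms (delta int (e i').1 (e i').2) (e i).1 (e i).2.
Let A : 'M[R]_D := map_mx intr T.

Let AE i i' : A i i' = lap st Ms (dl i') (e i).1 (e i).2.
Proof. by rewrite !mxE lap_delta_int. Qed.

Let fn (v : 'rV[R]_D) : 'I_n -> X -> R := fun k x => \sum_i v 0 i * dl i k x.

Let fn_l2 v : l2f (fn v).
Proof. by move=> k; apply: sqs_sum => i; apply: sqsZ; exact: l2f_delta. Qed.

Let dlE i i' : dl i (e i').1 (e i').2 = (i == i')%:R.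
Proof.
rewrite /dl /delta -xpair_eqE -!surjective_pairing eq_sym.
by rewrite (inj_eq e_inj).
Qed.

Let fn_at v i : fn v (e i).1 (e i).2 = v 0 i.
Proof.
rewrite /fn (bigD1 i) //= dlE eqxx mulr1 big1 ?addr0 // => i' /negPf ni.
by rewrite dlE ni mulr0.
Qed.

Let fn_out v k x : x \notin P -> fn v k x = 0.
Proof.
move=> xP; rewrite /fn big1 // => i _; rewrite /dl /delta.
case: (x =P (e i).2) => [xe|]; last by rewrite andbF mulr0.
by move: xP; rewrite xe eP.
Qed.

Let fnE (y : 'I_n -> X -> R) : (forall k x, x \notin P -> y k x = 0) ->
  y = fn (\row_i y (e i).1 (e i).2).
Proof.
move=> yP; apply/funext => k; apply/funext => x; have [xP|xP] := boolP (x \in P).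
  by have [i ei] := e_surj k xP; have := fn_at (\row_i y (e i).1 (e i).2) i; rewrite mxE ei /= => ->.
by rewrite yP // fn_out.
Qed.

Let ip_fn y v : l2f y -> ip y (fn v) = \sum_i v 0 i * y (e i).1 (e i).2.
Proof.
move=> ly; rewrite /ip.
have s1 k i : sqs (fun x => v 0 i * dl i k x) by apply: sqsZ; exact: l2f_delta.
under eq_bigr => k _ do rewrite ip1C (ip1_suml _ _ (s1 k) (ly k)).
rewrite exchange_big; apply: eq_bigr => i _ /=.
have -> : y (e i).1 (e i).2 = ip y (dl i) by rewrite ip_delta.
rewrite /ip mulr_sumr; apply: eq_bigr => k _.
by rewrite ip1Zl; [rewrite ip1C|exact: l2f_delta|exact: ly].
Qed.

Let quad v : (v *m A *m v^T) 0 0 =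
  \sum_(th <- Ms) ip1 (row_app st th (fn v)) (row_app st th (fn v)).
Proof.
rewrite -ip_lap //.
rewrite ip_fn; last by apply: l2f_lap.
rewrite mxE; under eq_bigr do rewrite mxE mulr_suml.
rewrite exchange_big; apply: eq_bigr => i _ /=; rewrite lap_sum mulr_sumr.
by apply: eq_bigr => i' _; rewrite -mulrA AE [v^T i' 0]mxE [_ * v 0 i']mulrC.
Qed.

Let Tsym : T^T = T.
Proof.
apply/matrixP => i i'; rewrite mxE; apply: (@intr_inj R).
have h k k' : (T k k')%:~R = A k k' by rewrite !mxE.
rewrite !h !AE -!ip_delta ip_lap; [|by []|exact: l2f_delta|exact: l2f_delta].
rewrite ip_lap; [|by []|exact: l2f_delta|exact: l2f_delta].
by apply: eq_bigr => th _; rewrite ip1C.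
Qed.

Let power c m i i' : ((1 - c *: A) ^+ m) i i' =
  iter m (compression st Ms c P) (dl i') (e i).1 (e i).2.
Proof.
have out k k' x : x \notin P -> iter k (compression st Ms c P) (dl i') k' x = 0.
  case: k => [|k] xP /=; last by rewrite /compression (negPf xP).
  rewrite /dl /delta; case: (x =P (e i').2) => [xe|]; last by rewrite andbF.
  by move: xP; rewrite xe eP.
elim: m i => [|m IH] i; first by rewrite expr0 /= dlE mxE eq_sym.
have entry j : (1 - c *: A) i j = (i == j)%:R - c * A i j.
  by rewrite -[1]/(1%:M : 'M[R]_D) !mxE.
rewrite exprS -mulmxE mxE iterS.
set y := iter m _ _; have yE : y = fn (\row_k ((1 - c *: A) ^+ m) k i').
  by rewrite [LHS](fnE (out m)); congr fn; apply/rowP => k; rewrite !mxE IH.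
rewrite /compression eP /contraction yE fn_at lap_sum mxE.
under eq_bigr do rewrite entry mulrBl.
rewrite sumrB (bigD1 i) //= eqxx mul1r big1 ?addr0 => [|i'' ni]; last first.
  by rewrite eq_sym (negPf ni) mul0r.
congr (_ - _); rewrite mulr_sumr; apply: eq_bigr => i'' _.
by rewrite AE mxE -mulrA [_ * lap _ _ _ _ _]mulrC.
Qed.

(** On the functions supported on [P] the operator [lap] is a symmetric integer
    matrix, to which [integer_trace_power] applies. Its nullity is at most the
    number of edges outside a set [W] that supports no element of the kernel. *)
Lemma compression_trace (C L m : nat) (W : seq ('I_n * X)) :
  (2 <= C)%N -> (0 < L)%N ->
  (forall y : 'I_n -> X -> R, l2f y ->
     \sum_(th <- Ms) ip1 (row_app st th y) (row_app st th y) <= C%:R * ip y y) ->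
  uniq W -> (forall w, w \in W -> w.2 \in P) ->
  (forall y : 'I_n -> X -> R, (forall k x, y k x != 0 -> (k, x) \in W) ->
     (forall th, th \in Ms -> forall x, row_app st th y x = 0) -> forall k x, y k x = 0) ->
  \sum_(x <- P) \sum_j iter m (compression st Ms C%:R^-1 P) (delta R j x) j x <=
    (size P * n - size W)%:R + (size P * n)%:R / L%:R
    + (size P * n)%:R * (1 - C%:R^-1 ^+ L.+1) ^+ m.
Proof.
move=> C2 L0 bound uW WP inj.
have DE : D = (size P * n)%N by rewrite /D card_prod !card_ord mulnC.
have trE : \sum_(x <- P) \sum_j iter m (compression st Ms C%:R^-1 P) (delta R j x) j x =
    \tr ((1 - C%:R^-1 *: A) ^+ m).
  rewrite /mxtrace; under [RHS]eq_bigr do rewrite power.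
  pose G (a : I) := iter m (compression st Ms C%:R^-1 P) (delta R a.1 (tnth (in_tuple P) a.2)) a.1 (tnth (in_tuple P) a.2).
  rewrite -[RHS]/(\sum_(i < D) G (enum_val i)) -(big_enum_val G) /=.
  rewrite big_tnth exchange_big pair_big /=; exact: eq_bigr.
have Apos (v : 'rV[R]_D) : 0 <= (v *m A *m v^T) 0 0 <= C%:R * (v *m v^T) 0 0.
  rewrite quad sumr_ge0 => [|th _]; last exact: ip1_ge0.
  apply: le_trans (bound _ (fn_l2 v)) _; rewrite ip_fn // mxE.
  by apply: ler_wpM2l => //; apply: ler_sum => i _; rewrite fn_at mxE.
rewrite trE; apply: le_trans (integer_trace_power _ Tsym C2 L0 Apos) _.
rewrite -DE lerD2r lerD2r ler_nat leq_sub2l //.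
have fex (i : 'I_(size W)) : exists i', e i' = tnth (in_tuple W) i.
  have iW : tnth (in_tuple W) i \in W by exact: mem_tnth.
  by have [i' e'] := e_surj (tnth (in_tuple W) i).1 (WP _ iW); exists i'; rewrite e' -surjective_pairing.
have /choice[f fP] := fex.
have f_inj : injective f.
  move=> i i' /(congr1 e); rewrite !fP => ii'.
  by have /tuple_uniqP tinj : uniq (in_tuple W) by []; exact: tinj.
pose E : 'M[R]_(size W, D) := \matrix_(i, k) (k == f i)%:R.
suff free : row_free (E *m A *m E^T).
  rewrite -[X in (X <= _)%N](eqP free); apply: leq_trans (mxrankM_maxl _ _) _.
  exact: mxrankM_maxr.
rewrite -kermx_eq0; apply/rowV0P => u /sub_kermxP uE0.
pose v := u *m E.
have vf i : v 0 (f i) = u 0 i.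
  rewrite mxE (bigD1 i) //= mxE eqxx mulr1 big1 ?addr0 // => i' ni.
  by rewrite mxE (inj_eq f_inj) eq_sym (negPf ni) mulr0.
have v0 : (v *m A *m v^T) 0 0 = 0.
  have -> : v *m A *m v^T = u *m (E *m A *m E^T) *m u^T by rewrite /v trmx_mul !mulmxA.
  by rewrite uE0 mul0mx mxE.
rewrite quad in v0.
have fn0 : forall k x, fn v k x = 0.
  apply: inj => [k x fx|th thM x].
    have xP : x \in P by apply: contraNT fx => /fn_out ->.
    have [i ei] := e_surj k xP; move: fx; have := fn_at v i; rewrite ei /= => ->.
    have [[i0 ii0] _|ni] := pselect (exists i0, i = f i0); first by rewrite -ei ii0 fP mem_tnth.
    rewrite /v mxE big1 ?eqxx // => i0 _; rewrite mxE.
    by case: eqP => [ii0|]; [case: ni; exists i0|rewrite mulr0].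
  have := v0 => /eqP; rewrite psumr_eq0 => [|th' _]; last exact: ip1_ge0.
  move=> /allP /(_ _ thM) /= /eqP z.
  have := ip1_ge_seq (sqs_row_app stK th (fn_l2 v)) (isT : uniq [:: x]).
  by rewrite big_seq1 z -[_ ^+ 2 <= 0]/(_ <= 0) => h; apply/eqP; rewrite -sqrf_eq0 eq_le h sqr_ge0.
by apply/rowP => i; rewrite -vf -fn_at fn0 mxE.
Qed.

End IntegerCompression.

Lemma contraction_self_adjoint (R : realType) n (X : choiceType) (st : 'I_n * bool -> X -> X)
    (Ms : seq (rowop n)) (c : R) y z : (forall a, cancel (st a) (st (linv a))) ->
  l2f y -> l2f z -> ip (contraction st Ms c y) z = ip y (contraction st Ms c z).
Proof.
move=> stK ly lz; have ll := l2f_lap stK Ms.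
have e (y' z' : 'I_n -> X -> R) : l2f y' -> l2f z' ->
    ip (contraction st Ms c y') z' = ip y' z' - c * ip (lap st Ms y') z'.
  move=> ly' lz'; have := ipDl ly' (l2fZ (- c) (ll _ _ ly')) lz'.
  rewrite (ipZl _ (ll _ _ ly') lz') mulNr => <-.
  by apply: eq_bigr => k _; apply: eq_rsum => x; rewrite mulNr.
rewrite e // [RHS]ipC e // [ip z y]ipC !ip_lap //.
by congr (_ - _ * _); apply: eq_bigr => th _; rewrite ip1C.
Qed.

Lemma l2f_iter_contraction (R : realType) n (X : choiceType) (st : 'I_n * bool -> X -> X)
    (Ms : seq (rowop n)) (c : R) m y : (forall a, cancel (st a) (st (linv a))) ->
  l2f y -> l2f (iter m (contraction st Ms c) y).
Proof.
move=> stK ly; elim: m => //= m IH k; apply: sqsD; first exact: IH.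
by apply: sqsN; apply: sqsZ; exact: l2f_lap.
Qed.

(** The projection [p] of a unit vector to the kernel of the rows is fixed by
    the contraction, so its norm is at most that of the contracted vector. *)
Lemma projection_le_contraction (R : realType) n (X : choiceType)
    (st : 'I_n * bool -> X -> X) (Ms : seq (rowop n)) (c : R) m (p : 'I_n -> X -> R) j x :
  (forall a, cancel (st a) (st (linv a))) -> l2f p ->
  (forall th, th \in Ms -> forall z, row_app st th p z = 0) -> p j x = ip p p ->
  p j x <= iter (m + m) (contraction st Ms c) (delta R j x) j x.
Proof.
move=> stK lp p0 pp; set A := contraction st Ms c.
have ld := @l2f_delta R X n j x.
have lA k : l2f (iter k A (delta R j x)) by exact: l2f_iter_contraction.
have lap0 k z : lap st Ms p k z = 0.
  rewrite /lap big_seq big1 // => th thM; rewrite /row_adj big1 // => t _.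
  by rewrite p0 // mulr0.
have Ap : A p = p by apply/funext => k; apply/funext => z; rewrite /A /contraction lap0 mulr0 subr0.
have pA k : ip p (iter k A (delta R j x)) = p j x.
  elim: k => [|k IH]; first by rewrite ip_delta.
  by rewrite /= -contraction_self_adjoint // -/A Ap.
have AA k l : ip (iter k A (delta R j x)) (iter l A (delta R j x)) =
    ip (iter (k + l) A (delta R j x)) (delta R j x).
  elim: l k => [|l IH] k; first by rewrite addn0.
  rewrite /= -contraction_self_adjoint // -/A -[A (iter k A _)]/(iter k.+1 A _) IH.
  by rewrite addSnnS.
have cs := cauchy_schwarz lp (lA m); rewrite pA AA ip_delta -pp expr2 in cs.
have := ip_ge0 p; rewrite -pp le_eqVlt => /predU1P[<-|p1].
  by rewrite -(ip_delta (iter (m + m) A (delta R j x))) -AA; exact: ip_ge0.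
by rewrite -(ler_pM2l p1).
Qed.

(** * Words and marked groups *)

Section Words.
Variables (G : groupType) (n : nat).
Implicit Types (S : 'I_n -> G) (w : word n).

Definition letter_eval S (a : 'I_n * bool) : G := if a.2 then S a.1 else (S a.1)^-1%g.

Lemma word_eval_nil S : word_eval S [::] = 1%g. Proof. exact: big_nil. Qed.

Lemma word_eval_cons S a w : word_eval S (a :: w) = (letter_eval S a * word_eval S w)%g.
Proof. exact: big_cons. Qed.

Lemma word_eval_cat S w1 w2 : word_eval S (w1 ++ w2) = (word_eval S w1 * word_eval S w2)%g.
Proof. exact: big_cat. Qed.

Lemma word_eval1 S a : word_eval S [:: a] = letter_eval S a.
Proof. by rewrite word_eval_cons word_eval_nil mulg1. Qed.

Lemma letter_eval_inv S a : letter_eval S (linv a) = (letter_eval S a)^-1%g.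
Proof. by case: a => k [] //=; rewrite /letter_eval /= invgK. Qed.

Lemma word_eval_inv S w : word_eval S (inv_word w) = (word_eval S w)^-1%g.
Proof.
elim: w => [|a w IH]; first by rewrite /inv_word /= word_eval_nil invg1.
rewrite /inv_word map_cons rev_cons -cats1 word_eval_cat -/(inv_word w) IH.
by rewrite word_eval1 letter_eval_inv word_eval_cons invgM.
Qed.

(** The Cayley graph with an edge from [g] to [(S k)^-1 * g] for each generator: the
    relation of a cocycle at a product is then additivity along walks, and right
    translations are automorphisms. *)
Definition gstep S (a : 'I_n * bool) (g : G) : G := ((letter_eval S a)^-1 * g)%g.

Lemma gstepK S a : cancel (gstep S a) (gstep S (linv a)).
Proof. by move=> g; rewrite /gstep letter_eval_inv invgK mulVKg. Qed.

Lemma walk_gstep S w g : walk (gstep S) w g = ((word_eval S w)^-1 * g)%g.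
Proof.
elim: w g => [|a w IH] g /=; first by rewrite word_eval_nil invg1 mul1g.
by rewrite IH word_eval_cons invgM /gstep mulgA.
Qed.

End Words.

Section Reduction.
Variable n : nat.
Implicit Types w : word n.

Definition reduce_cons (a : 'I_n * bool) w : word n :=
  if w is b :: w' then (if noncancelling a b then a :: w else w') else [:: a].

Definition reduce w : word n := foldr reduce_cons [::] w.

Lemma reduce_reduced w : reduced (reduce w).
Proof.
elim: w => //= a w; move: (reduce w) => [|b v] //= rv; case: ifP => h /=; first by rewrite h.
by move: rv; rewrite /reduced /=; exact: path_sorted.
Qed.

Lemma size_reduce w : (size (reduce w) <= size w)%N.
Proof.
elim: w => //= a w; move: (reduce w) => [|b v] //= sv; case: ifP => h //=.
by apply: leq_trans (leqW _) (leqW sv).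
Qed.

Lemma word_eval_reduce (G : groupType) (S : 'I_n -> G) w : word_eval S (reduce w) = word_eval S w.
Proof.
elim: w => //= a w; rewrite word_eval_cons; move: (reduce w) => [|b v] /= <-.
  by rewrite word_eval_cons.
case: ifP; first by rewrite word_eval_cons.
move=> /negbFE /andP[/eqP ab ab2]; rewrite word_eval_cons.
suff -> : a = linv b by rewrite letter_eval_inv mulKg.
by case: a b ab ab2 => k s [k' s'] /= -> ss; congr pair; case: s s' ss => [] [].
Qed.

End Reduction.

Definition subst_word n m (u : 'I_n -> word m) (w : word n) : word m :=
  flatten [seq (if a.2 then u a.1 else inv_word (u a.1)) | a <- w].

Lemma word_eval_subst (G : groupType) n m (S : 'I_m -> G) (u : 'I_n -> word m) (w : word n) :
  word_eval S (subst_word u w) = word_eval (fun k => word_eval S (u k)) w.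
Proof.
elim: w => [|a w IH]; first by rewrite !word_eval_nil.
rewrite /subst_word /= word_eval_cat -/(subst_word u w) IH word_eval_cons; congr (_ * _)%g.
by case: a => k [] //=; rewrite word_eval_inv.
Qed.

Lemma size_subst_word n m (u : 'I_n -> word m) (w : word n) (B : nat) :
  (forall k, size (u k) <= B)%N -> (size (subst_word u w) <= B * size w)%N.
Proof.
move=> uB; elim: w => [|a w IH] //=; rewrite /subst_word /= size_cat mulnS leq_add //.
by case: ifP => _; rewrite ?size_inv_word uB.
Qed.

Lemma free_ball_sub n r k : (r <= k)%N -> @free_ball n r `<=` free_ball k.
Proof. by move=> rk w [rw sw]; split => //; exact: leq_trans rk. Qed.

(** Words in [S] are rewritten in the generators of the convergent sequence, which
    enlarges their lengths by a bounded factor. *)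
Lemma marked_limit_approx (R : realType) (C : groupType -> Prop) (G : groupType) :
  marked_limit R C G -> forall n (S : 'I_n -> G) r,
  exists (H : groupType) (T : 'I_n -> H) (e : nat -> H), [/\ C H, forall x, exists k, e k = x &
    forall w : word n, (size w <= r)%N -> word_eval T w = 1%g <-> word_eval S w = 1%g].
Proof.
move=> [m [H [T [S0 [CH gT gS0 lim]]]]] n S r.
have /choice[u uS] : forall k, exists w, word_eval S0 w = S k by move=> k; exact: gS0.
pose B := (\sum_k size (u k))%N.
have uB k : (size (u k) <= B)%N by rewrite /B (bigD1 k) //= leq_addr.
pose r' := (B * r)%N.
have e0 : 0 < 2 ^- r' :> R by rewrite invr_gt0 exprn_gt0.
have /cvgr_dist_lt /(_ _ e0) [i0 _ /(_ i0 (leqnn _))] /= := lim.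
rewrite sub0r normrN => dlt.
have agree : marked_kernel (T i0) `&` free_ball r' = marked_kernel S0 `&` free_ball r'.
  have : marked_dist R (marked_kernel (T i0)) (marked_kernel S0) < 2 ^- r'.
    exact: le_lt_trans (ler_norm _) dlt.
  rewrite /marked_dist => /inf_lt; case.
    exists (2 ^- 0); exists 0%N => //=; apply/seteqP; split => w [[rw ww] [_ sw]]; split => //; split => //;
      move: sw; rewrite leqn0 size_eq0 => /eqP ->; exact: word_eval_nil.
  move=> _ [k /= kE <-]; rewrite ltf_pV2 ?posrE ?exprn_gt0 // => lt.
  have rk : (r' <= k)%N.
    by rewrite ltnW // -(ltr_eXn2l (x := 2 : R)) // ltr1n.
  have sub : free_ball k `&` @free_ball m r' = free_ball r'.
    by apply/setIidPr; exact: free_ball_sub.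
  by rewrite -sub (setIA (marked_kernel (T i0))) kE -(setIA (marked_kernel S0)).
have red w : (size w <= r')%N -> word_eval (T i0) w = 1%g <-> word_eval S0 w = 1%g.
  move=> sw; rewrite -(word_eval_reduce (T i0)) -(word_eval_reduce S0).
  have rb : free_ball r' (reduce w).
    by split; [exact: reduce_reduced|exact: leq_trans (size_reduce w) sw].
  have rr := reduce_reduced w.
  split => h.
    have : (marked_kernel (T i0) `&` free_ball r') (reduce w) by split.
    by rewrite agree => -[[]].
  have : (marked_kernel S0 `&` free_ball r') (reduce w) by split.
  by rewrite -agree => -[[]].
exists (H i0), (fun k => word_eval (T i0) (u k)).
exists (fun k => word_eval (T i0) (odflt [::] (@choice.unpickle (word m) k))); split => //.
  by move=> x; have [w <-] := gT i0 x; exists (@choice.pickle (word m) w); rewrite choice.pickleK.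
move=> w wr; have -> : S = (fun k => word_eval S0 (u k)) by apply/funext => k; rewrite uS.
rewrite -!word_eval_subst; apply: red; apply: leq_trans (size_subst_word w uB) _.
by rewrite leq_mul2l wr orbT.
Qed.

(** * Harmonic cochains and the first l2-Betti number *)

Section PathSums.
Variable n : nat.

(** The letter (k, false) runs backwards along the edge of (k, true). *)
Definition edge_row (a : 'I_n * bool) : int * word n * 'I_n :=
  if a.2 then (1, [::], a.1) else (-1, [:: a], a.1).

(** The Fox derivatives of a word, which express the sum of a cochain along the
    walk. *)
Fixpoint fox (w : word n) : rowop n :=
  if w is a :: w' then edge_row a :: [seq (t.1.1, a :: t.1.2, t.2) | t <- fox w'] else [::].

(** The adjoint of the coboundary. *)
Definition div_row : rowop n :=
  flatten [seq [:: (1, [:: (k, false)], k); (-1, [::], k)] | k <- enum 'I_n].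

Variables (X : choiceType) (st : 'I_n * bool -> X -> X) (K : pzRingType).
Hypothesis stK : forall a, cancel (st a) (st (linv a)).
Implicit Types (y : 'I_n -> X -> K) (w : word n).

Definition path_sum y w x : K := row_app st (fox w) y x.

Definition edge_val y (a : 'I_n * bool) x : K := if a.2 then y a.1 x else - y a.1 (st a x).

Lemma path_sum_nil y x : path_sum y [::] x = 0.
Proof. by rewrite /path_sum /row_app big_nil. Qed.

Lemma path_sum_cons y a w x : path_sum y (a :: w) x = edge_val y a x + path_sum y w (st a x).
Proof.
rewrite /path_sum /row_app big_cons big_map; congr (_ + _).
by case: a => k [] /=; rewrite ?mul1r // mulrNz mulr1z mulN1r.
Qed.

Lemma path_sum1 y k x : path_sum y [:: (k, true)] x = y k x.
Proof. by rewrite path_sum_cons path_sum_nil addr0. Qed.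

Lemma path_sum_cat y w1 w2 x :
  path_sum y (w1 ++ w2) x = path_sum y w1 x + path_sum y w2 (walk st w1 x).
Proof.
elim: w1 x => [|a w1 IH] x; first by rewrite path_sum_nil add0r.
by rewrite cat_cons !path_sum_cons IH addrA.
Qed.

Lemma path_sum_inv y w x : path_sum y (inv_word w) (walk st w x) = - path_sum y w x.
Proof.
elim: w x => [|a w IH] x; first by rewrite !path_sum_nil oppr0.
rewrite path_sum_cons opprD -IH /inv_word map_cons rev_cons -cats1 path_sum_cat.
rewrite -/(inv_word w) /= walkK // addrC; congr (_ + _).
rewrite path_sum_cons path_sum_nil addr0 /edge_val; case: a => k [] /=; rewrite ?opprK //.
by rewrite (stK (k, true)).
Qed.

Lemma div_rowE y x :
  row_app st div_row y x = \sum_k (y k (st (k, false) x) - y k x).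
Proof.
rewrite /row_app /div_row big_flatten big_map enumT; apply: eq_bigr => k _.
by rewrite big_cons big_seq1 /= mul1r mulrNz mulr1z mulN1r.
Qed.

Lemma div_row_adj (u : X -> K) j x : row_adj st div_row u j x = u (st (j, true) x) - u x.
Proof.
rewrite /row_adj /div_row big_flatten big_map enumT (bigD1 j) //= !big_cons big_nil /= eqxx.
rewrite big1 ?addr0 => [|k kj]; last by rewrite !big_cons big_nil /= (negPf kj).
by rewrite mul1r mulrNz mulr1z mulN1r.
Qed.

End PathSums.

Section PathIndependence.
Variables (G : groupType) (n : nat) (S : 'I_n -> G) (K : pzRingType).
Variables (X : choiceType) (st : 'I_n * bool -> X -> X).
Hypothesis stK : forall a, cancel (st a) (st (linv a)).
Hypothesis walkS : forall w1 w2, word_eval S w1 = word_eval S w2 -> walk st w1 =1 walk st w2.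
Variable y : 'I_n -> X -> K.
Hypothesis yrel : forall w, word_eval S w = 1%g -> forall x, path_sum st y w x = 0.

Lemma path_sum_eval w1 w2 x : word_eval S w1 = word_eval S w2 ->
  path_sum st y w1 x = path_sum st y w2 x.
Proof.
move=> e; have : path_sum st y (w1 ++ inv_word w2) x = 0.
  by apply: yrel; rewrite word_eval_cat word_eval_inv e mulgV.
by rewrite path_sum_cat (walkS e) path_sum_inv // => /eqP; rewrite subr_eq0 => /eqP.
Qed.

End PathIndependence.

Section WeakLimit.
Variables (R : realType) (U : set_system nat).
Hypothesis uU : UltraFilter U.
Variables (n : nat) (X : choiceType) (st : 'I_n * bool -> X -> X).
Variables (y : nat -> 'I_n -> X -> R) (a : nat -> R) (a0 B : R).
Hypotheses (aB : forall i, a i <= B) (aa0 : a @ U --> a0).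
Hypothesis ya : forall s : seq X, uniq s ->
  U [set i | \sum_(x <- s) \sum_k y i k x ^+ 2 <= a i].

(** The norms are only bounded on finite sets and for almost all indices, as is the
    case for cochains pulled back from larger and larger finite quotients. *)
Definition wlim : 'I_n -> X -> R := fun k x => ulim U (fun i => y i k x).

Lemma wlim_cvg k x : (fun i => y i k x) @ U --> wlim k x.
Proof.
apply: (ulimP uU (B := B + 1)); apply: filterS (ya (isT : uniq [:: x])) => i /=.
rewrite big_seq1 => /le_trans /(_ (aB i)) h.
have h2 : y i k x ^+ 2 <= B.
  by apply: le_trans h; rewrite (bigD1 k) //= lerDl sumr_ge0 // => k' _; exact: sqr_ge0.
rewrite -(real_normK (num_real _)) in h2; have := normr_ge0 (y i k x); nra.
Qed.

Lemma cvg_sum_seq (I : Type) (s : seq I) (f : nat -> I -> R) (l : I -> R) :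
  (forall x, (fun i => f i x) @ U --> l x) ->
  (fun i => \sum_(x <- s) f i x) @ U --> \sum_(x <- s) l x.
Proof.
move=> fl; elim: s => [|x s IH].
  by rewrite big_nil (_ : (fun i => _) = fun=> 0); [exact: cvg_cst|apply/funext => i; rewrite big_nil].
rewrite big_cons (_ : (fun i => _) = (fun i => f i x) \+ (fun i => \sum_(x <- s) f i x)).
  by apply: cvgD.
by apply/funext => i; rewrite big_cons.
Qed.

Lemma wlim_sum s : uniq s -> \sum_(x <- s) \sum_k wlim k x ^+ 2 <= a0.
Proof.
move=> us; apply: (ler_cvg_to _ aa0 (ya us)).
apply: cvg_sum_seq => x; apply: cvg_sum_seq => k.
rewrite (_ : (fun i => y i k x ^+ 2) = (fun i => y i k x) \* (fun i => y i k x)) // expr2.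
by apply: cvgM; exact: wlim_cvg.
Qed.

Lemma wlim_l2 : l2f wlim.
Proof.
move=> k; exists a0 => s us; apply: le_trans (wlim_sum us); apply: ler_sum => x _.
by rewrite [leRHS](bigD1 k) //= lerDl sumr_ge0 // => k' _; exact: sqr_ge0.
Qed.

Lemma wlim_norm : ip wlim wlim <= a0.
Proof.
rewrite /ip /ip1 -rsum_sum; last by move=> k; apply: sqs_mul; exact: wlim_l2.
apply: rsum_le => [x|s us]; first by apply: sumr_ge0 => k _; rewrite -expr2 sqr_ge0.
exact: wlim_sum.
Qed.

Lemma wlim_row th x (c : R) : U [set i | row_app st th (y i) x = c] -> row_app st th wlim x = c.
Proof.
move=> rc; have cv : (fun i => row_app st th (y i) x) @ U --> row_app st th wlim x.
  by apply: cvg_sum_seq => t; apply: cvgMr; exact: wlim_cvg.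
have cc : (fun i => row_app st th (y i) x) @ U --> c.
  apply: cvg_near_cst; exact: rc.
exact: (cvg_unique _ cv cc).
Qed.

End WeakLimit.

Section Harmonic.
Variables (R : realType) (G : groupType) (n : nat) (S : 'I_n -> G).
Implicit Types (y v p : 'I_n -> G -> R).
Local Notation st := (gstep S).

(** The real cocycles orthogonal to the coboundaries: the divergence is the adjoint
    of the coboundary. *)
Definition harmonic y :=
  [/\ l2f y, forall w, word_eval S w = 1%g -> forall x, path_sum st y w x = 0 &
      forall x, row_app st (div_row n) y x = 0].

Lemma row_app_lin (X : choiceType) (st' : 'I_n * bool -> X -> X) th (a b : R) (y v : 'I_n -> X -> R) x :
  row_app st' th (fun k g => a * y k g + b * v k g) x =
  a * row_app st' th y x + b * row_app st' th v x.
Proof.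
rewrite /row_app !mulr_sumr -big_split; apply: eq_bigr => t _ /=.
by rewrite mulrDr mulrCA [_ * (b * _)]mulrCA.
Qed.

Lemma harmonic_lin a b y v : harmonic y -> harmonic v ->
  harmonic (fun k g => a * y k g + b * v k g).
Proof.
move=> [ly ry dy] [lv rv dv]; split.
- by apply: l2fD; apply: l2fZ.
- by move=> w w1 x; rewrite /path_sum row_app_lin -!/(path_sum _ _ _ _) ry // rv // !mulr0 addr0.
- by move=> x; rewrite row_app_lin dy dv !mulr0 addr0.
Qed.

Lemma harmonic0 : harmonic (fun _ _ => 0).
Proof.
split=> [k|w _ x|x]; first exact: sqs0.
  by rewrite /path_sum /row_app big1 // => t _; rewrite mulr0.
by rewrite /row_app big1 // => t _; rewrite mulr0.
Qed.

(** A minimizing sequence for the distance has a pointwise limit along an ultrafilter,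
    which is harmonic and no farther away. *)
Lemma harmonic_projection_ex j : exists p, harmonic p /\ forall v, harmonic v -> ip p v = v j 1%g.
Proof.
pose e := delta R j (1%g : G); have le := @l2f_delta R G n j 1%g.
pose D v := ip (fun k g => 1 * e k g + -1 * v k g) (fun k g => 1 * e k g + -1 * v k g).
pose E := [set D v | v in harmonic].
have E0 : has_inf E.
  split; first by exists (D (fun _ _ => 0)); exists (fun _ _ => 0) => //; exact: harmonic0.
  by exists 0 => _ [v _ <-]; exact: ip_ge0.
have /choice[v vP] (i : nat) : exists v, harmonic v /\ D v < inf E + i.+1%:R^-1.
  have [_ [v hv <-] lt] := @inf_adherent _ E i.+1%:R^-1 ltac:(by rewrite invr_gt0) E0.
  by exists v.
have [U [uU Uoo]] := @ultraFilterLemma nat \oo _.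
pose z i : 'I_n -> G -> R := fun k g => 1 * e k g + -1 * v i k g.
have lz i : l2f (z i).
  by apply: l2fD; apply: l2fZ => //; case: (vP i) => [[]].
pose a i : R := inf E + i.+1%:R^-1.
have aB i : a i <= inf E + 1 by rewrite lerD2l invf_le1 // ler1n.
have acv : a @ U --> inf E.
  rewrite -[X in _ --> X]addr0; apply: cvgD; first exact: cvg_cst.
  apply: cvg_trans (@cvg_harmonic R) => A /=; exact: Uoo.
have za (s : seq G) : uniq s -> U [set i | \sum_(x <- s) \sum_k z i k x ^+ 2 <= a i].
  move=> us; apply: filterE => i /=; apply: le_trans (ltW (vP i).2).
  rewrite exchange_big; apply: ler_sum => k _; exact: (ip1_ge_seq (lz i k) us).
pose zeta := wlim U z.
have lzeta : l2f zeta by exact: (wlim_l2 uU aB acv za).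
have zrow th x : (forall i, row_app st th (v i) x = 0) ->
    row_app st th zeta x = row_app st th e x.
  move=> vi; apply: (wlim_row uU aB za); apply: filterE => i /=.
  by rewrite row_app_lin vi mulr0 addr0 mul1r.
pose p : 'I_n -> G -> R := fun k g => 1 * e k g + -1 * zeta k g.
have hp : harmonic p.
  split; first by apply: l2fD; apply: l2fZ.
  - move=> w w1 x; rewrite /path_sum row_app_lin zrow ?mulN1r ?mul1r ?subrr // => i.
    by case: (vP i) => [[_ + _] _]; apply.
  - move=> x; rewrite row_app_lin zrow ?mulN1r ?mul1r ?subrr // => i.
    by case: (vP i) => [[_ _ +] _]; apply.
have zp : (fun k g => 1 * e k g + -1 * p k g) = zeta.
  by apply/funext => k; apply/funext => g; rewrite /p; ring.
have zmin : ip zeta zeta <= inf E by exact: (wlim_norm uU aB acv za).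
exists p; split => // u hu; have lu : l2f u by case: hu.
have orth : ip zeta u = 0.
  have h t : 0 <= t ^+ 2 * ip u u + 2 * t * ip zeta u.
    have : inf E <= D (fun k g => 1 * p k g + (- t) * u k g).
      apply: (ge_inf E0.2); exists (fun k g => 1 * p k g + (- t) * u k g) => //.
      exact: harmonic_lin.
    rewrite /D (_ : (fun k g => 1 * e k g + -1 * _) = (fun k g => 1 * zeta k g + t * u k g)); last first.
      by apply/funext => k; apply/funext => g; rewrite /p; ring.
    rewrite ip_norm_lin // expr1n mul1r mulr1 => h; lra.
  exact: (quadratic_nonneg_linear (ip_ge0 u) h).
have -> : ip p u = 1 * ip e u + -1 * ip zeta u.
  by rewrite /p ipDl ?ipZl //; apply: l2fZ.
by rewrite orth mulr0 addr0 mul1r ipC ip_delta.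
Qed.

Lemma ip_coboundary y (f : G -> R) : l2f y -> sqs f ->
  ip y (fun k g => f ((S k)^-1 * g)%g - f g) = ip1 (row_app st (div_row n) y) f.
Proof.
move=> ly sf; rewrite (ip_row_adj (@gstepK _ _ S)) //; congr ip.
by apply/funext => k; apply/funext => g; rewrite div_row_adj.
Qed.

End Harmonic.

Section ComplexCochains.
Variables (R : realType) (G : groupType).
Implicit Types (f : G -> R[i]).

Lemma in_l2_sqs f : in_l2 f -> sqs (fun g => complex.Re (f g)) /\ sqs (fun g => complex.Im (f g)).
Proof.
rewrite /in_l2; set h := fun g => complex.Re (f g) ^+ 2 + complex.Im (f g) ^+ 2 => fin.
have h0 g : 0 <= h g by rewrite addr_ge0 ?sqr_ge0.
have e0 : (0 <= \esum_(g in [set: G]) (h g)%:E)%E by apply: esum_ge0 => g _; rewrite lee_fin.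
have hB : sum_le (fine (\esum_(g in [set: G]) (h g)%:E)) h.
  by move=> s us; rewrite -lee_fin fineK ?ge0_fin_numE //; exact: esum_ge_seq.
by split; eexists; apply: le_sum_le hB => g; rewrite /h ?lerDl ?lerDr sqr_ge0.
Qed.

Lemma sqs_in_l2 f : sqs (fun g => complex.Re (f g)) -> sqs (fun g => complex.Im (f g)) -> in_l2 f.
Proof.
move=> [B rB] [C iC]; apply: (@le_lt_trans _ _ (B + C)%:E); last exact: ltry.
by apply: esum_le_seq; exact: sum_leD.
Qed.

End ComplexCochains.

Section L2BettiReal.
Variables (R : realType) (G : groupType) (n : nat) (S : 'I_n -> G).
Hypothesis genS : generates S.
Local Notation st := (gstep S).
Implicit Types (x : 'I_n -> G -> R[i]) (y v : 'I_n -> G -> R).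

Definition re x : 'I_n -> G -> R := fun k g => complex.Re (x k g).
Definition im x : 'I_n -> G -> R := fun k g => complex.Im (x k g).
Definition cplx y : 'I_n -> G -> R[i] := fun k g => Complex (y k g) 0.

Lemma dot_cplx_r x y : dot x (cplx y) = Complex (ip (re x) y) (ip (im x) y).
Proof.
rewrite /dot /csum /ip [RHS]complexE /= !rmorph_sum mulr_sumr -big_split; apply: eq_bigr => k _.
rewrite [LHS]complexE /=; congr ((_ %:C)%C + 'i%C * (_ %:C)%C); apply: eq_rsum => g.
  by rewrite /re /cplx; case: (x k g) => a b /=; rewrite oppr0 mulr0 subr0.
by rewrite /im /cplx; case: (x k g) => a b /=; rewrite oppr0 mulr0 add0r.
Qed.

Lemma dot_cplx_l y x : dot (cplx y) x = Complex (ip y (re x)) (- ip y (im x)).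
Proof.
rewrite /dot /csum /ip [RHS]complexE /= -sumrN !rmorph_sum mulr_sumr -big_split; apply: eq_bigr => k _.
rewrite [LHS]complexE /=; congr ((_ %:C)%C + 'i%C * (_ %:C)%C).
  by apply: eq_rsum => g; rewrite /re /cplx; case: (x k g) => a b /=; rewrite mul0r subr0.
rewrite -rsumN; apply: eq_rsum => g; rewrite /im /cplx; case: (x k g) => a b /=.
by rewrite mul0r addr0 mulrN.
Qed.

Let walkS w1 w2 : word_eval S w1 = word_eval S w2 -> walk st w1 =1 walk st w2.
Proof. by move=> e g; rewrite !walk_gstep e. Qed.

Lemma cocycle_path_sum (c : G -> G -> R) : (forall g h z, c (g * h)%g z = c g z + c h (g^-1 * z)%g) ->
  forall w z, path_sum st (fun k => c (S k)) w z = c (word_eval S w) z.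
Proof.
move=> cM; have c1 z : c 1%g z = 0.
  by apply: (@addrI _ (c 1%g z)); rewrite addr0 -{3}(mul1g 1%g) cM invg1 mul1g.
have cV g z : c g^-1%g z = - c g (g * z)%g.
  by have := cM g^-1%g g z; rewrite mulVg c1 invgK => /esym/eqP; rewrite addr_eq0 => /eqP.
elim=> [|a w IH] z; first by rewrite path_sum_nil word_eval_nil c1.
rewrite path_sum_cons IH word_eval_cons cM -/(gstep S a z); congr (_ + _).
by case: a => k [] //; rewrite /edge_val /letter_eval /= cV /gstep /letter_eval /= invgK.
Qed.

Lemma B1_delta h : B1 S (cplx (fun k g => (((S k)^-1 * g)%g == h)%:R - (g == h)%:R : R)).
Proof.
exists (fun g => Complex ((g == h)%:R : R) 0).
  apply: sqs_in_l2; last exact: sqs0.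
  by apply: (@sqs_seq _ _ _ [:: h]) => g; rewrite inE => /negPf ->.
apply/funext => k; apply/funext => g; rewrite /cplx /lshift.
by rewrite [RHS]complexE /= oppr0 addr0 mulr0 addr0.
Qed.

(** Orthogonality to the coboundary of a point mass is the vanishing of the
    divergence at that point. *)
Lemma reduced_l2_H1_harmonic x : reduced_l2_H1 S x -> harmonic S (re x) /\ harmonic S (im x).
Proof.
move=> [[b [bl2 bM] ->] orth].
have lx : l2f (re (fun k => b (S k))) /\ l2f (im (fun k => b (S k))).
  by split=> k; case: (in_l2_sqs (bl2 (S k))).
have bR g h z : complex.Re (b (g * h)%g z) = complex.Re (b g z) + complex.Re (b h (g^-1 * z)%g).
  by rewrite bM /lshift; case: (b g z) => ? ?; case: (b h _).
have bI g h z : complex.Im (b (g * h)%g z) = complex.Im (b g z) + complex.Im (b h (g^-1 * z)%g).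
  by rewrite bM /lshift; case: (b g z) => ? ?; case: (b h _).
have c1 (c : G -> G -> R) : (forall g h z, c (g * h)%g z = c g z + c h (g^-1 * z)%g) ->
    forall w, word_eval S w = 1%g -> forall z, path_sum st (fun k => c (S k)) w z = 0.
  move=> cM w w1 z; rewrite cocycle_path_sum // w1.
  by apply: (@addrI _ (c 1%g z)); rewrite addr0 -{3}(mul1g 1%g) cM invg1 mul1g.
have dl y h : l2f y -> ip y (fun k g => (((S k)^-1 * g)%g == h)%:R - (g == h)%:R) =
    row_app st (div_row n) y h.
  move=> ly; rewrite (ip_coboundary S (f := fun g => (g == h)%:R) ly).
    rewrite (@ip1_seq _ _ _ _ [:: h]) ?big_seq1 ?eqxx ?mulr1 // => g.
    by rewrite inE => /negPf ->.
  by apply: (@sqs_seq _ _ _ [:: h]) => g; rewrite inE => /negPf ->.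
have dz h := orth _ (B1_delta h).
split; split; [exact: lx.1|exact: c1 bR| |exact: lx.2|exact: c1 bI|] => h.
  rewrite -dl; last exact: lx.1.
  by have := dz h; rewrite dot_cplx_r => -[].
rewrite -dl; last exact: lx.2.
by have := dz h; rewrite dot_cplx_r => -[].
Qed.

(** The cocycle takes [g] to the path sums along any word representing [g]. *)
Lemma harmonic_reduced_l2_H1 y : harmonic S y -> reduced_l2_H1 S (cplx y).
Proof.
move=> [ly ry dy]; have /choice[wd wdP] := genS.
have indep := path_sum_eval (@gstepK _ _ S) walkS ry.
split.
  exists (fun g z => Complex (path_sum st y (wd g) z) 0).
    split=> [g|g h z].
      apply: sqs_in_l2; last exact: sqs0.
      exact: (sqs_row_app (@gstepK _ _ S)).
    rewrite /lshift [RHS]complexE /= addr0 mulr0 addr0; congr Complex.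
    rewrite (indep _ (wd g ++ wd h)) ?word_eval_cat ?wdP // path_sum_cat.
    by rewrite walk_gstep wdP.
  apply/funext => k; apply/funext => z; rewrite /cplx; congr Complex.
  by rewrite -(path_sum1 st) //; apply: indep; rewrite wdP word_eval1.
move=> _ [f fl2 ->]; have [rf imf] := in_l2_sqs fl2.
rewrite dot_cplx_l.
have z0 (f' : G -> R) : sqs f' -> ip y (fun k g => f' ((S k)^-1 * g)%g - f' g) = 0.
  move=> sf; rewrite (ip_coboundary S ly sf) /ip1.
  by rewrite (@eq_rsum _ _ _ (fun=> 0)) ?rsum0 // => g; rewrite dy mul0r.
have -> : re (fun k g => lshift (S k) f g - f g) =
    fun k g => complex.Re (f ((S k)^-1 * g)%g) - complex.Re (f g).
  by apply/funext => k; apply/funext => g; rewrite /re /lshift; case: (f _) => ? ?; case: (f _).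
have -> : im (fun k g => lshift (S k) f g - f g) =
    fun k g => complex.Im (f ((S k)^-1 * g)%g) - complex.Im (f g).
  by apply/funext => k; apply/funext => g; rewrite /im /lshift; case: (f _) => ? ?; case: (f _).
by rewrite !z0 // oppr0.
Qed.

(** The equations of harmonic cochains are real, so that complex projections of real
    vectors are computed by real ones. *)
Lemma l2_betti1_projections : exists p : 'I_n -> 'I_n -> G -> R,
  [/\ forall k, harmonic S (p k),
      forall k v, harmonic S v -> ip (p k) v = v k 1%g &
      l2_betti1 R S = \sum_k p k k 1%g].
Proof.
pose V := @reduced_l2_H1 R G n S.
pose P k := orth_proj V (l2_unit R k).
have ue k : l2_unit R k = cplx (delta R k (1%g : G)).
  apply/funext => j; apply/funext => g; rewrite /l2_unit /cplx /delta.
  by case: (_ && _).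
have PP k : V (P k) /\ forall v : 'I_n -> G -> R[i], V v -> dot (fun j g => l2_unit R k j g - P k j g) v = 0.
  apply: (@xgetPex _ _ [set p | V p /\ forall v : 'I_n -> G -> R[i], V v -> dot (fun j g => l2_unit R k j g - p j g) v = 0]).
  have [p [hp pv]] := harmonic_projection_ex R S k.
  exists (cplx p); split; first exact: harmonic_reduced_l2_H1.
  have lp : l2f p by case: hp.
  have -> : (fun j g => l2_unit R k j g - cplx p j g) =
      cplx (fun j g => 1 * delta R k (1%g : G) j g + -1 * p j g).
    apply/funext => j; apply/funext => g; rewrite ue /cplx [RHS]complexE /= [LHS]complexE /=.
    by rewrite oppr0 addr0 mul1r mulN1r.
  move=> v /reduced_l2_H1_harmonic [hr hi].
  have z (u : 'I_n -> G -> R) : harmonic S u ->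
      ip (fun j g => 1 * delta R k (1%g : G) j g + -1 * p j g) u = 0.
    move=> hu; have lu : l2f u by case: hu.
    have ld := @l2f_delta R G n k 1%g.
    by rewrite ipDl ?ipZl ?pv // ?[ip (delta _ _ _) _]ipC ?ip_delta ?mul1r ?mulN1r ?subrr //; apply: l2fZ.
  by rewrite dot_cplx_l !z // oppr0.
exists (fun k => re (P k)); split.
- by move=> k; case: (reduced_l2_H1_harmonic (PP k).1).
- move=> k v hv; have lv : l2f v by case: hv.
  have [hr _] := reduced_l2_H1_harmonic (PP k).1; have lr : l2f (re (P k)) by case: hr.
  have := (PP k).2 _ (harmonic_reduced_l2_H1 hv); rewrite dot_cplx_r => -[+ _].
  have -> : re (fun j g => l2_unit R k j g - P k j g) =
      fun j g => 1 * delta R k (1%g : G) j g + -1 * re (P k) j g.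
    apply/funext => j; apply/funext => g; rewrite ue /re /cplx mul1r mulN1r.
    by case: (P k j g).
  have ld := @l2f_delta R G n k 1%g.
  rewrite ipDl ?ipZl //; try exact: l2fZ.
  by rewrite mul1r mulN1r ipC ip_delta => /eqP; rewrite subr_eq0 => /eqP.
- apply: eq_bigr => k _; rewrite -/V -/(P k) ue dot_cplx_r /=.
  by rewrite ip_delta.
Qed.

End L2BettiReal.

(** * Finite quotient graphs *)

Section FiniteQuotient.
Variables (G : groupType) (N : set G).
Hypotheses (nN : normal_subgroup N) (fN : finite_index N).

Lemma normal_subgroupV x : N x -> N x^-1%g.
Proof. by case: nN => N1 NB _ Nx; rewrite -[(x^-1)%g]mul1g; exact: NB. Qed.

Lemma normal_subgroupM x y : N x -> N y -> N (x * y)%g.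
Proof.
by case: nN => N1 NB _ Nx Ny; rewrite -[y]invgK; apply: NB => //; exact: normal_subgroupV.
Qed.

Let coset (g : G) : set G := [set (g * x)%g | x in N].

Let coset_eq g h : coset g = coset h <-> N (g^-1 * h)%g.
Proof.
have [N1 _ _] := nN; split => [e|Ngh].
  have : coset h h by exists 1%g; rewrite ?mulg1.
  by rewrite -e => -[x Nx <-]; rewrite mulKg.
apply/seteqP; split => _ [x Nx <-].
  exists (h^-1 * g * x)%g; last by rewrite !mulgA mulgV mul1g.
  by apply: normal_subgroupM => //; have := normal_subgroupV Ngh; rewrite invgM invgK.
exists (g^-1 * h * x)%g; last by rewrite !mulgA mulgV mul1g.
exact: normal_subgroupM.
Qed.

Lemma finite_quotient : exists (kappa : G -> 'I_(subgroup_index N)) (r : 'I_(subgroup_index N) -> G),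
  (forall i, kappa (r i) = i) /\ forall g h, kappa g = kappa h <-> N (g^-1 * h)%g.
Proof.
pose s := enum_fset (fset_set (left_cosets N)).
have ins g : coset g \in s by rewrite in_fset_set //; apply/mem_set; exists g.
have szs : size s = subgroup_index N by [].
have lt g : (index (coset g) s < subgroup_index N)%N by rewrite -szs index_mem.
pose kappa g := Ordinal (lt g).
have kE g h : kappa g = kappa h <-> N (g^-1 * h)%g.
  rewrite -coset_eq; split => [[e]|e]; last by apply/val_inj; rewrite /= e.
  by rewrite -(nth_index set0 (ins g)) e nth_index.
have /choice[r rP] (i : 'I_(subgroup_index N)) : exists g, kappa g = i.
  have : nth set0 s i \in s by rewrite mem_nth.
  rewrite in_fset_set // => /set_mem [g _ e]; exists g; apply/val_inj => /=.
  by rewrite -[coset g]/([set (g * x)%g | x in N]) e index_uniq ?fset_uniq.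
by exists kappa, r.
Qed.

End FiniteQuotient.

Section OrthogonalProjection.
Variables (K : realFieldType) (D : nat).
Implicit Types (v : 'rV[K]_D).

Lemma normv_eq0 v : (v *m v^T) 0 0 = 0 -> v = 0.
Proof.
rewrite mxE => /eqP; rewrite psumr_eq0 => [/allP h|i _]; last by rewrite mxE -expr2 sqr_ge0.
apply/rowP => i; have := h i (mem_index_enum i).
by rewrite /= !mxE -expr2 sqrf_eq0 => /eqP.
Qed.

Lemma gram_unit r (B : 'M[K]_(r, D)) : row_free B -> B *m B^T \in unitmx.
Proof.
move=> fB; rewrite -row_free_unit -kermx_eq0; apply/rowV0P => u /sub_kermxP uG.
have : u *m B = 0.
  by apply: normv_eq0; rewrite trmx_mul -mulmxA (mulmxA B) mulmxA uG mul0mx mxE.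
by move/eqP; rewrite mulmx_free_eq0 // => /eqP.
Qed.

Variables (m : nat) (U : 'M[K]_(m, D)).
Let B := row_base U.
Definition orthproj : 'M[K]_D := B^T *m invmx (B *m B^T) *m B.

Let Gu : B *m B^T \in unitmx.
Proof. by apply: gram_unit; exact: row_base_free. Qed.

Lemma orthproj_sym : orthproj^T = orthproj.
Proof.
rewrite /orthproj; move: (B) => C.
by rewrite trmx_mul [(C^T *m _)^T]trmx_mul trmx_inv [(C *m _)^T]trmx_mul !trmxK mulmxA.
Qed.

Lemma orthproj_sub : (orthproj <= U)%MS.
Proof. by rewrite -(eq_row_base U); exact: submxMl. Qed.

Lemma orthproj_id p (v : 'M[K]_(p, D)) : (v <= U)%MS -> v *m orthproj = v.
Proof.
rewrite -(eq_row_base U) => /submxP[u ->]; rewrite /orthproj -[row_base U]/B; move: (B) Gu u => C GC u.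
by rewrite !mulmxA -(mulmxA u) -(mulmxA u) mulmxV // mulmx1.
Qed.

Lemma orthproj_trace : \tr orthproj = (\rank U)%:R.
Proof. by rewrite /orthproj mxtrace_mulC mulmxA mulmxV // mxtrace1. Qed.

Lemma orthproj_idem : orthproj *m orthproj = orthproj.
Proof. exact: orthproj_id orthproj_sub. Qed.

Lemma orthproj_orth v : (v - v *m orthproj) *m U^T = 0.
Proof.
have UP : U *m orthproj = U by exact: orthproj_id.
rewrite mulmxBl -mulmxA.
have -> : orthproj *m U^T = U^T by rewrite -[in LHS]orthproj_sym -trmx_mul UP.
by rewrite subrr.
Qed.

End OrthogonalProjection.

Section FiniteCochains.
Variables (n q : nat) (st : 'I_n * bool -> 'I_q -> 'I_q).
Let J : finType := ('I_n * 'I_q)%type.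
Local Notation D := #|J|.

Definition vecf (K : Type) (y : 'I_n -> 'I_q -> K) : 'rV[K]_D :=
  \row_j y (enum_val j).1 (enum_val j).2.
Definition fvec (K : Type) (v : 'rV[K]_D) : 'I_n -> 'I_q -> K :=
  fun k i => v 0 (enum_rank (k, i)).

Lemma vecfK (K : Type) (y : 'I_n -> 'I_q -> K) : fvec (vecf y) = y.
Proof. by apply/funext => k; apply/funext => i; rewrite /fvec mxE enum_rankK. Qed.

Lemma fvecK (K : Type) (v : 'rV[K]_D) : vecf (fvec v) = v.
Proof. by apply/rowP => j; rewrite mxE /fvec -surjective_pairing enum_valK. Qed.

Lemma vecf_dot (K : comNzRingType) (y z : 'I_n -> 'I_q -> K) :
  (vecf y *m (vecf z)^T) 0 0 = \sum_k \sum_i y k i * z k i.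
Proof.
rewrite mxE pair_big /= (reindex (@enum_rank J)) /=.
  by apply: eq_bigr => a _; rewrite !mxE enum_rankK.
by exists enum_val => a _; rewrite ?enum_rankK ?enum_valK.
Qed.

Definition row_coef (th : rowop n) (x : 'I_q) (j : 'I_D) : int :=
  row_app st th (fun k i => ((k, i) == enum_val j)%:R) x.

Lemma row_app_coef (K : comNzRingType) th (y : 'I_n -> 'I_q -> K) x :
  row_app st th y x = \sum_j vecf y 0 j * (row_coef th x j)%:~R.
Proof.
under eq_bigr do rewrite /row_coef /row_app rmorph_sum mulr_sumr.
rewrite exchange_big; apply: eq_bigr => t _ /=.
rewrite (bigD1 (enum_rank (t.2, walk st t.1.2 x))) //= big1 ?addr0 => [|j nj].
  by rewrite mxE enum_rankK eqxx /= intz mulr1 mulrC.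
rewrite intz (_ : (_ == _) = false) ?mulr0 ?mulr0z ?mulr0 //.
by apply/negbTE; apply: contraNneq nj => ->; rewrite enum_valK.
Qed.

Section RowMatrix.
Variable Ms : seq (rowop n).
Let I : finType := ('I_(size Ms) * 'I_q)%type.
Local Notation E := #|I|.

Definition row_matrix : 'M[int]_(E, D) :=
  \matrix_(e, j) row_coef (tnth (in_tuple Ms) (enum_val e).1) (enum_val e).2 j.

Lemma row_matrixP (K : comNzRingType) (y : 'I_n -> 'I_q -> K) :
  vecf y *m (map_mx intr row_matrix)^T = 0 <->
  forall th, th \in Ms -> forall x, row_app st th y x = 0.
Proof.
have entry e : (vecf y *m (map_mx intr row_matrix)^T) 0 e =
    row_app st (tnth (in_tuple Ms) (enum_val e).1) y (enum_val e).2.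
  by rewrite mxE row_app_coef; apply: eq_bigr => j _; rewrite [_^T j e]mxE [map_mx _ _ e j]mxE [row_matrix e j]mxE.
split => [h th /(@tnthP _ _ (in_tuple Ms)) [b ->] x|h].
  by have := entry (enum_rank (b, x)); rewrite h mxE enum_rankK.
by apply/rowP => e; rewrite entry mxE h // mem_tnth.
Qed.

End RowMatrix.

(** Take finitely many rows of the largest rational rank: any other row is a rational
    combination of them, which makes sense over every field of characteristic
    zero. *)
Lemma finite_rows (C : set (rowop n)) : exists2 Ms : seq (rowop n),
  (forall th, th \in Ms -> C th) &
  forall (K : realFieldType) (y : 'I_n -> 'I_q -> K),
    (forall th, th \in Ms -> forall x, row_app st th y x = 0) ->
    forall th, C th -> forall x, row_app st th y x = 0.
Proof.
pose rv th x : 'rV[rat]_D := \row_j (row_coef th x j)%:~R.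
pose rows (Ms : seq (rowop n)) := [seq rv th x | th <- Ms, x <- enum 'I_q].
pose P d := `[< exists2 Ms : seq (rowop n), (forall th, th \in Ms -> C th) & \dim <<rows Ms>>%VS = d >].
have P0 : exists d, P d by exists (\dim <<rows [::]>>%VS); apply/asboolP; exists [::].
have Pb d : P d -> (d <= dim 'rV[rat]_D)%N.
  by move=> /asboolP[Ms _ <-]; exact: rank_leq_col.
have [d /asboolP[Ms MsC dimMs] dmax] := ex_maxnP P0 Pb.
exists Ms => // K y yMs th Cth x.
have sub : (<<rows Ms>> <= <<rows (th :: Ms)>>)%VS.
  by apply: sub_span => v vMs; rewrite /rows /= mem_cat vMs orbT.
have eqd : <<rows Ms>>%VS = <<rows (th :: Ms)>>%VS.
  apply/eqP; rewrite eqEdim sub dimMs dmax //; apply/asboolP; exists (th :: Ms) => //.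
  by move=> th'; rewrite inE => /predU1P[-> //|]; exact: MsC.
have : rv th x \in <<rows Ms>>%VS.
  rewrite eqd; apply: memv_span; rewrite /rows /= mem_cat; apply/orP; left.
  by apply/mapP; exists x => //; rewrite mem_enum.
move=> /(coord_span (X := in_tuple (rows Ms))) rvE.
have rvK th' x' : row_app st th' y x' = \sum_j vecf y 0 j * ratr (rv th' x' 0 j).
  by rewrite row_app_coef; apply: eq_bigr => j _; rewrite [X in ratr X]mxE ratr_int.
rewrite rvK rvE; under eq_bigr do rewrite summxE rmorph_sum mulr_sumr.
rewrite exchange_big big1 // => i _ /=.
have : (rows Ms)`_i \in rows Ms by rewrite mem_nth.
move=> /allpairsP[[th' x'] [/= th'Ms _ e]].
under eq_bigr do rewrite [X in ratr X]mxE rmorphM mulrCA.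
by rewrite -mulr_sumr e -rvK yMs // mulr0.
Qed.

End FiniteCochains.

(** * First Betti numbers of finite index normal subgroups *)

Lemma row_app_mul n q (st : 'I_n * bool -> 'I_q -> 'I_q) (K : comNzRingType) (m : nat)
    (u : 'rV[K]_m) (Y : 'M[K]_(m, #|{: 'I_n * 'I_q}|)) th x :
  row_app st th (fvec (u *m Y)) x = \sum_a u 0 a * row_app st th (fvec (row a Y)) x.
Proof.
rewrite /row_app; under [RHS]eq_bigr do rewrite mulr_sumr.
rewrite exchange_big; apply: eq_bigr => t _ /=; rewrite /fvec mxE mulr_sumr.
by apply: eq_bigr => a _; rewrite [row a Y _ _]mxE mulrCA.
Qed.

Lemma row_app_intr n (X : choiceType) (st : 'I_n * bool -> X -> X) (K : pzRingType)
    (y : 'I_n -> X -> int) th x :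
  row_app st th (fun k i => (y k i)%:~R : K) x = (row_app st th y x)%:~R.
Proof.
by rewrite /row_app rmorph_sum; apply: eq_bigr => t _ /=; rewrite rmorphM /= intz.
Qed.

Lemma rat_common_denominator (I : finType) (f : I -> rat) :
  exists2 c : int, c != 0 & exists z : I -> int, forall i, c%:~R * f i = (z i)%:~R.
Proof.
exists (\prod_i denq (f i)); first by apply/prodf_neq0 => i _; exact: denq_neq0.
exists (fun i => numq (f i) * \prod_(j | j != i) denq (f j)) => i.
rewrite (bigD1 i) //= !rmorphM /= mulrAC; congr (_ * _).
by rewrite mulrC -[X in X * _ = _]divq_num_den divfK // intr_eq0 denq_neq0.
Qed.

Section FiniteGraph.
Variables (G : groupType) (N : set G) (nN : normal_subgroup N).
Variables (q : nat) (kappa : G -> 'I_q) (r : 'I_q -> G).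
Hypothesis kappar : forall i, kappa (r i) = i.
Hypothesis kappaE : forall g h, kappa g = kappa h <-> N (g^-1 * h)%g.
Variables (n : nat) (S : 'I_n -> G).

Definition qstep (a : 'I_n * bool) (i : 'I_q) : 'I_q := kappa (gstep S a (r i)).

Lemma kappa_lmul g h : kappa (g * r (kappa h))%g = kappa (g * h)%g.
Proof. by apply/kappaE; rewrite invgM -mulgA mulKg; apply/kappaE; rewrite kappar. Qed.

Lemma kappa_rmul g h k : kappa g = kappa h -> kappa (g * k)%g = kappa (h * k)%g.
Proof.
move=> /kappaE gh; apply/kappaE; rewrite invgM -mulgA.
have [_ _ /(_ k^-1%g _ gh)] := nN; by rewrite invgK !mulgA.
Qed.

Lemma kappa1E g : kappa g = kappa 1%g <-> N g.
Proof.
split=> [/esym/kappaE|Ng]; first by rewrite invg1 mul1g.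
by apply/esym/kappaE; rewrite invg1 mul1g.
Qed.

Lemma qstep_kappa a g : qstep a (kappa g) = kappa (gstep S a g).
Proof. exact: kappa_lmul. Qed.

Lemma qstepK a : cancel (qstep a) (qstep (linv a)).
Proof. by move=> i; rewrite -(kappar i) !qstep_kappa gstepK. Qed.

Lemma walk_qstep w g : walk qstep w (kappa g) = kappa ((word_eval S w)^-1 * g)%g.
Proof.
rewrite -walk_gstep; elim: w g => //= a w IH g; by rewrite qstep_kappa IH.
Qed.

Lemma walk_qstep_eval w1 w2 : word_eval S w1 = word_eval S w2 -> walk qstep w1 =1 walk qstep w2.
Proof. by move=> e i; rewrite -(kappar i) !walk_qstep e. Qed.

(** On a quotient graph, too, the relators are those of [G] and not of the quotient,
    so that a solution may have periods on loops that represent elements of [N]. *)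
Definition harmonic_rows : set (rowop n) :=
  [set th | th = div_row n \/ exists2 w, word_eval S w = 1%g & th = fox w].

Hypothesis genS : generates S.

(** A harmonic cochain on a finite graph without periods is the coboundary of a
    function, hence orthogonal to itself. *)
Lemma harmonic_no_periods (K : realFieldType) (y : 'I_n -> 'I_q -> K) :
  (forall th, harmonic_rows th -> forall i, row_app qstep th y i = 0) ->
  (forall w, N (word_eval S w) -> path_sum qstep y w (kappa 1%g) = 0) ->
  forall k i, y k i = 0.
Proof.
move=> hy per; have /choice[wd wdP] := genS.
pose f i := path_sum qstep y (wd (r i)^-1%g) (kappa 1%g).
have loop w1 w2 : walk qstep w1 (kappa 1%g) = walk qstep w2 (kappa 1%g) ->
    path_sum qstep y w1 (kappa 1%g) = path_sum qstep y w2 (kappa 1%g).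
  move=> e; have : path_sum qstep y (w1 ++ inv_word w2) (kappa 1%g) = 0.
    apply: per; rewrite word_eval_cat word_eval_inv.
    by move: e; rewrite !walk_qstep !mulg1 => /kappaE; rewrite invgK.
  by rewrite path_sum_cat e (path_sum_inv qstepK) => /eqP; rewrite subr_eq0 => /eqP.
have wf i : walk qstep (wd (r i)^-1%g) (kappa 1%g) = i.
  by rewrite walk_qstep wdP invgK mulg1 kappar.
have yf k i : y k i = f (qstep (k, true) i) - f i.
  rewrite /f (loop _ (wd (r i)^-1%g ++ [:: (k, true)])).
    by rewrite path_sum_cat path_sum1 wf addrC addKr.
  by rewrite walk_cat !wf.
have : \sum_k \sum_i y k i ^+ 2 = 0.
  transitivity (\sum_i f i * row_app qstep (div_row n) y i).
    under [RHS]eq_bigr do rewrite div_rowE mulr_sumr.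
    rewrite [RHS]exchange_big; apply: eq_bigr => k _ /=.
    under [RHS]eq_bigr do rewrite mulrBr.
    under [LHS]eq_bigr do rewrite expr2 [X in _ * X]yf mulrBr.
    rewrite !sumrB; congr (_ - _); last by apply: eq_bigr => i _; rewrite mulrC.
    rewrite [RHS](reindex_inj (can_inj (qstepK (k, true)))) /=.
    by apply: eq_bigr => i _; rewrite -[(k, false)]/(linv (k, true)) qstepK mulrC.
  by rewrite big1 // => i _; rewrite hy ?mulr0 //; left.
move=> /eqP; rewrite psumr_eq0 => [/allP h k i|k _]; last by apply: sumr_ge0 => i _; exact: sqr_ge0.
have := h k (mem_index_enum k); rewrite /= psumr_eq0 => [/allP h'|? _]; last exact: sqr_ge0.
by have := h' i (mem_index_enum i); rewrite /= sqrf_eq0 => /eqP.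
Qed.

Lemma hom_to_Z1 f : hom_to_Z N f -> f 1%g = 0.
Proof.
have [N1 _ _] := nN => fM; apply: (@addrI _ (f 1%g)).
by rewrite addr0 -fM // mulg1.
Qed.

Lemma hom_to_ZV f x : hom_to_Z N f -> N x -> f x^-1%g = - f x.
Proof.
move=> fM Nx; apply/eqP; rewrite -addr_eq0; apply/eqP.
by rewrite -fM ?mulVg ?hom_to_Z1 //; exact: normal_subgroupV.
Qed.

(** The coboundary of the extension of [f] from [N] to [G] that sends [g] to
    [f ((r (kappa g))^-1 * g)]; it is invariant under right translation by [N]. *)
Definition hom_cochain (f : G -> int) (k : 'I_n) (i : 'I_q) : int :=
  f ((r (qstep (k, true) i))^-1 * gstep S (k, true) (r i))%g.

Lemma hom_cochain_path f w g : hom_to_Z N f ->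
  path_sum qstep (hom_cochain f) w (kappa g) =
  f ((r (kappa ((word_eval S w)^-1 * g)))^-1 * ((word_eval S w)^-1 * g))%g - f ((r (kappa g))^-1 * g)%g.
Proof.
move=> fM; have Nr h : N ((r (kappa h))^-1 * h)%g by apply/kappaE; rewrite kappar.
have edge k h : hom_cochain f k (kappa h) =
    f ((r (kappa (gstep S (k, true) h)))^-1 * gstep S (k, true) h)%g - f ((r (kappa h))^-1 * h)%g.
  apply/eqP; rewrite eq_sym subr_eq; apply/eqP.
  rewrite /hom_cochain qstep_kappa -fM //.
    by rewrite /gstep !mulgA mulgK.
  by rewrite -qstep_kappa; apply/kappaE; rewrite kappar.
elim: w g => [|a w IH] g; first by rewrite path_sum_nil word_eval_nil invg1 mul1g subrr.
rewrite path_sum_cons qstep_kappa IH word_eval_cons invgM -!mulgA -/(gstep S a g).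
suff -> : edge_val qstep (hom_cochain f) a (kappa g) =
    f ((r (kappa (gstep S a g)))^-1 * gstep S a g)%g - f ((r (kappa g))^-1 * g)%g.
  by rewrite addrC subrKA.
case: a => k [] /=; first exact: edge.
rewrite /edge_val /= qstep_kappa edge -[gstep S (k, true) _]/(gstep S (linv (k, false)) _).
by rewrite gstepK opprB.
Qed.

(** The periods of an integral harmonic cochain define a homomorphism on [N], and
    they determine the cochain by [harmonic_no_periods]. Conversely, the cochain
    of a homomorphism becomes harmonic, with unchanged periods, after projection
    to the orthogonal complement of the coboundaries; of more than [d]
    homomorphisms some combination would have a coboundary as its cochain, hence
    vanish on [N]. *)
Lemma betti1_harmonic (Ms : seq (rowop n)) (Q := row_matrix qstep Ms) :
  (forall th, th \in Ms -> harmonic_rows th) ->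
  (forall (K : realFieldType) (y : 'I_n -> 'I_q -> K),
    (forall th, th \in Ms -> forall i, row_app qstep th y i = 0) ->
    forall th, harmonic_rows th -> forall i, row_app qstep th y i = 0) ->
  betti1 N = \rank (kermx (map_mx intr Q : 'M[rat]__)^T).
Proof.
move=> Msh hMs; set V := kermx _; set d := \rank V.
have /choice[wd wdP] := genS.
have kerP (v : 'rV[rat]_(#|{: 'I_n * 'I_q}|)) : (v <= V)%MS <->
    forall th, harmonic_rows th -> forall i, row_app qstep th (fvec v) i = 0.
  split=> [/sub_kermxP|h].
    by rewrite -{1}(fvecK v) => /row_matrixP /(hMs rat).
  apply/sub_kermxP; rewrite -(fvecK v); apply/row_matrixP => th /Msh; exact: h.
have upper m : has_indep_homs N m -> (m <= d)%N.
  move=> [f [fM indep]]; rewrite leqNgt; apply/negP => dm.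
  pose y a : 'I_n -> 'I_q -> rat := fun k i => (hom_cochain (f a) k i)%:~R.
  pose Y : 'M[rat]_(m, _) := \matrix_(a, j) vecf (y a) 0 j.
  have rowY a : row a Y = vecf (y a) by apply/rowP => j; rewrite !mxE.
  pose Cob : 'M[rat]_(q, #|{: 'I_n * 'I_q}|) :=
    \matrix_(i, j) vecf (fun k h => (qstep (k, true) h == i)%:R - (h == i)%:R) 0 j.
  have cobE (u : 'rV[rat]_q) k i : fvec (u *m Cob) k i = u 0 (qstep (k, true) i) - u 0 i.
    rewrite /fvec mxE; under eq_bigr => j _ do rewrite [Cob j _]mxE mxE enum_rankK /= mulrBr.
    have one h : \sum_j u 0 j * (h == j)%:R = u 0 h.
      rewrite (bigD1 h) //= eqxx mulr1 big1 ?addr0 // => j.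
      by rewrite eq_sym => /negPf ->; rewrite mulr0.
    by rewrite sumrB !one.
  have cobP (u : 'rV[rat]_q) w i : path_sum qstep (fvec (u *m Cob)) w i = u 0 (walk qstep w i) - u 0 i.
    elim: w i => [|a w IH] i; first by rewrite path_sum_nil subrr.
    rewrite path_sum_cons IH /= addrC.
    suff -> : edge_val qstep (fvec (u *m Cob)) a i = u 0 (qstep a i) - u 0 i by rewrite subrKA.
    case: a => k []; rewrite /edge_val /= cobE // opprB.
    by rewrite -[qstep (k, true) _]/(qstep (linv (k, false)) _) qstepK.
  have cob_rel (v : 'rV[rat]__) w i : (v <= Cob)%MS -> word_eval S w = 1%g ->
      path_sum qstep (fvec v) w i = 0.
    by move=> /submxP[u ->] w1; rewrite cobP -(kappar i) walk_qstep w1 invg1 mul1g subrr.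
  (* The rows of [Cob] span the coboundaries, so those of [Z] have no divergence. *)
  pose P := orthproj Cob; pose Z := Y - Y *m P.
  have PC (v : 'rV[rat]__) : (v *m P <= Cob)%MS by rewrite (submx_trans (submxMl _ _)) // orthproj_sub.
  have fB (v v' : 'rV[rat]_(#|{: 'I_n * 'I_q}|)) w i : path_sum qstep (fvec (v - v')) w i =
      path_sum qstep (fvec v) w i - path_sum qstep (fvec v') w i.
    rewrite /path_sum /row_app -sumrB; apply: eq_bigr => t _.
    by rewrite -mulrBr /fvec !mxE.
  have rowZ a : row a Z = row a Y - row a Y *m P by rewrite linearB /= row_mul.
  have ZV : (Z <= V)%MS.
    apply/row_subP => a; apply/kerP => th [->|[w w1 ->]] i.
      have := orthproj_orth Cob (row a Y); rewrite -/P -rowZ.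
      move=> /(congr1 (fun M : 'rV[rat]_q => M 0 i)); rewrite [RHS]mxE => h.
      rewrite -h -[row a Z]fvecK mxE div_rowE; move: (fvec (row a Z)) => z.
      rewrite vecfK.
      transitivity (\sum_k \sum_h z k h * ((qstep (k, true) h == i)%:R - (h == i)%:R)).
        apply: eq_bigr => k _; under eq_bigr do rewrite mulrBr.
        rewrite sumrB (bigD1 (qstep (k, false) i)) //= -[qstep (k, true) _]/(qstep (linv (k, false)) _).
        rewrite qstepK eqxx mulr1 big1 ?addr0 => [|h' nh]; last first.
          rewrite (_ : (_ == _) = false) ?mulr0 //; apply/negbTE; apply: contraNneq nh => <-.
          by rewrite -[(k, false)]/(linv (k, true)) qstepK.
        congr (_ - _); rewrite (bigD1 i) //= eqxx mulr1 big1 ?addr0 // => h' /negPf ->.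
        by rewrite mulr0.
      rewrite -vecf_dot mxE; apply: eq_bigr => j _; congr (_ * _).
      by rewrite [RHS]mxE [RHS]mxE mxE.
    rewrite -/(path_sum _ _ _ _) rowZ fB (cob_rel _ _ _ (PC (row a Y))) // subr0 rowY vecfK.
    rewrite /path_sum /y row_app_intr -(kappar i) -/(path_sum _ _ _ _) hom_cochain_path //.
    by rewrite w1 invg1 mul1g subrr.
  have nfree : ~~ row_free Z.
    by rewrite /row_free neq_ltn; apply/orP; left; apply: leq_ltn_trans (mxrankS ZV) dm.
  have [u u0 uZ] : exists2 u : 'rV[rat]_m, u != 0 & u *m Z = 0.
    move: nfree; rewrite -kermx_eq0 => /rowV0Pn [u /sub_kermxP uZ u0]; by exists u.
  have [c c0 [z zE]] := rat_common_denominator (u 0).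
  have fz : forall x, N x -> \sum_a z a * f a x = 0.
    move=> x Nx; have kx : kappa x^-1%g = kappa 1%g.
      by apply/kappa1E; exact: normal_subgroupV.
    apply: (@intr_inj rat); rewrite rmorph_sum rmorph0 /=.
    transitivity (- c%:~R * path_sum qstep (fvec (u *m Y)) (wd x) (kappa 1%g)).
      rewrite /path_sum row_app_mul mulr_sumr; apply: eq_bigr => a _.
      rewrite rmorphM /= -zE rowY vecfK row_app_intr -/(path_sum _ _ _ _) hom_cochain_path // wdP mulg1 kx.
      have Nr : N ((r (kappa 1))^-1)%g by have /kappaE := kappar (kappa 1%g); rewrite mulg1.
      rewrite mulg1 fM //; last exact: normal_subgroupV.
      by rewrite addrC addKr hom_to_ZV // rmorphN /= mulrN mulrNN mulrA.
    have -> : u *m Y = u *m Y *m P.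
      by apply/eqP; rewrite -subr_eq0 -mulmxA -mulmxBr -/Z uZ.
    have /submxP[h ->] := PC (u *m Y).
    by rewrite cobP walk_qstep wdP mulg1 kx subrr mulr0.
  have z0 := indep z fz.
  move/eqP: u0; apply; apply/rowP => a; rewrite mxE.
  have := zE a; rewrite z0 => /eqP; rewrite mulf_eq0 intr_eq0 (negPf c0) => /eqP; exact.
have lower : has_indep_homs N d.
  pose B := row_base V.
  have [c c0 [z zE]] := rat_common_denominator (fun p : 'I_d * 'I_(#|{: 'I_n * 'I_q}|) => B p.1 p.2).
  pose y a k i : int := z (a, enum_rank (k, i)).
  have yB a : (fun k i => (y a k i)%:~R) = fvec (c%:~R *: row a B).
    by apply/funext => k; apply/funext => i; rewrite /y -zE /fvec !mxE.
  have yh a th i : harmonic_rows th -> row_app qstep th (y a) i = 0.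
    move=> hth; apply: (@intr_inj rat); rewrite -row_app_intr yB; apply: (kerP _).1 => //.
    by rewrite scalemx_sub // (submx_trans (row_sub _ _)) // eq_row_base.
  have yrel a w : word_eval S w = 1%g -> forall i, path_sum qstep (y a) w i = 0.
    by move=> w1 i; apply: yh; right; exists w.
  exists (fun a x => path_sum qstep (y a) (wd x) (kappa 1%g)); split.
    move=> a x x' Nx Nx' /=.
    rewrite (path_sum_eval qstepK walk_qstep_eval (yrel a) (w2 := wd x ++ wd x')); last first.
      by rewrite word_eval_cat !wdP.
    rewrite path_sum_cat walk_qstep wdP mulg1; congr (_ + path_sum _ _ _ _).
    by apply/kappa1E; exact: normal_subgroupV.
  move=> b bz; pose u : 'rV[rat]_d := \row_a (b a)%:~R.
  pose v := u *m (c%:~R *: B).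
  have vV : (v <= V)%MS.
    by rewrite (submx_trans (submxMl _ _)) // scalemx_sub // eq_row_base.
  have v0 : v = 0.
    apply/rowP => j; rewrite [RHS]mxE -[v]fvecK mxE.
    apply: harmonic_no_periods => [|w Nw]; first exact/kerP.
    rewrite /path_sum /v row_app_mul.
    transitivity ((\sum_a b a * path_sum qstep (y a) w (kappa 1%g))%:~R : rat).
      rewrite rmorph_sum; apply: eq_bigr => a _; rewrite rmorphM /= mxE; congr (_ * _).
      rewrite /path_sum -row_app_intr yB; congr (row_app _ _ (fvec _) _).
      by rewrite linearZ.
    rewrite (_ : \sum_a _ = 0) ?rmorph0 //; rewrite -[RHS](bz _ Nw); apply: eq_bigr => a _.
    by congr (_ * _); apply: (path_sum_eval qstepK walk_qstep_eval (yrel a)); rewrite wdP.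
  have : u = 0.
    apply/eqP; move/eqP: v0; rewrite /v -scalemxAr scaler_eq0 intr_eq0 (negPf c0) /=.
    by rewrite mulmx_free_eq0 // row_base_free.
  by move=> u0 a; apply: (@intr_inj rat); move/rowP: u0 => /(_ a); rewrite !mxE.
have [h1 h2] : [set k | has_indep_homs N k /\ forall m, has_indep_homs N m -> (m <= k)%N] (betti1 N).
  by apply: (@xgetPex _ 0%N [set k | has_indep_homs N k /\ forall m, has_indep_homs N m -> (m <= k)%N]); exists d.
by apply/eqP; rewrite eqn_leq upper // h2.
Qed.

End FiniteGraph.

(** * The bound by a single finite quotient *)

(** The edges are a maximal set of linearly independent columns of the system. *)
Lemma independent_edges (R : realType) n q (st : 'I_n * bool -> 'I_q -> 'I_q) (Ms : seq (rowop n)) :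
  exists W : seq ('I_n * 'I_q), [/\ uniq W,
    (size W + \rank (kermx (map_mx intr (row_matrix st Ms) : 'M[R]__)^T) = n * q)%N &
    forall y : 'I_n -> 'I_q -> R, (forall k i, y k i != 0 -> (k, i) \in W) ->
      (forall th, th \in Ms -> forall i, row_app st th y i = 0) -> forall k i, y k i = 0].
Proof.
set A := (map_mx intr _)^T; pose f := maxrankfun A.
have f_inj : injective f by exact: maxrankfun_inj.
exists [seq enum_val (f a) | a <- enum 'I_(\rank A)]; split.
- by rewrite map_inj_uniq ?enum_uniq // => a b /enum_val_inj /f_inj.
- by rewrite size_map size_enum_ord mxrank_ker subnKC ?rank_leq_row // card_prod !card_ord.
move=> y yW /row_matrixP yA.
pose u := \row_b vecf y 0 (f b); pose E := rowsub f (1%:M : 'M[R]_(#|{: 'I_n * 'I_q}|)).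
have vE : vecf y = u *m E.
  apply/rowP => j; rewrite [RHS]mxE.
  have entry b : u 0 b * E b j = vecf y 0 (f b) * (f b == j)%:R by rewrite !mxE.
  under eq_bigr do rewrite entry.
  have [[b ->]|nj] := pselect (exists b, j = f b).
    rewrite (bigD1 b) //= eqxx mulr1 big1 ?addr0 // => b' nb.
    by rewrite (inj_eq f_inj) (negPf nb) mulr0.
  rewrite big1 => [|b _]; last by case: eqP => [jb|]; [case: nj; exists b|rewrite mulr0].
  rewrite mxE; apply/eqP; apply: contraT => /yW; rewrite -surjective_pairing => /mapP[b _ /enum_val_inj e].
  by case: nj; exists b.
have u0 : u = 0.
  have free : row_free (rowsub f A) by exact: maxrowsub_free.
  apply/eqP; rewrite -(mulmx_free_eq0 _ free) rowsubE mulmxA -/E -vE; exact/eqP.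
by move=> k i; rewrite -[y]vecfK vE u0 mul0mx /fvec mxE.
Qed.

Section ProductGraph.
Variables (n : nat) (X Y : choiceType).
Variables (st : 'I_n * bool -> X -> X) (st' : 'I_n * bool -> Y -> Y).

Definition prodstep (a : 'I_n * bool) (x : X * Y) : X * Y := (st a x.1, st' a x.2).

Lemma walk_prodstep w x : walk prodstep w x = (walk st w x.1, walk st' w x.2).
Proof. by elim: w x => [|a w IH] x /=; [rewrite -surjective_pairing|rewrite IH]. Qed.

Lemma prodstepK : (forall a, cancel (st a) (st (linv a))) -> (forall a, cancel (st' a) (st' (linv a))) ->
  forall a, cancel (prodstep a) (prodstep (linv a)).
Proof. by move=> h h' a [x y]; rewrite /prodstep /= h h'. Qed.

End ProductGraph.

(** Functions that are constant along [H] are cochains on the finite graph, so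
    independence there is injectivity of the augmented matrix, which
    [locally_indicable_op_inj] carries over to finite supports. *)
Lemma prod_independent_edges (R : realType) (H : groupType) n q (T : 'I_n -> H)
    (st : 'I_n * bool -> 'I_q -> 'I_q) (Ms : seq (rowop n)) (W : seq ('I_n * 'I_q)) (F : seq H) :
  locally_indicable R H ->
  (forall y : 'I_n -> 'I_q -> R, (forall k i, y k i != 0 -> (k, i) \in W) ->
      (forall th, th \in Ms -> forall i, row_app st th y i = 0) -> forall k i, y k i = 0) ->
  forall y : 'I_n -> H * 'I_q -> R,
    (forall k x, y k x != 0 -> x.1 \in F /\ (k, x.2) \in W) ->
    (forall th, th \in Ms -> forall x, row_app (prodstep (gstep T) st) th y x = 0) ->
    forall k x, y k x = 0.
Proof.
move=> li inj y yW y0.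
pose J : finType := ('I_n * 'I_q)%type; pose I : finType := ('I_(size Ms) * 'I_q + J)%type.
(* The second kind of row forces the components outside [W] to vanish. *)
pose op (a : I) : seq (R * H * J) := match a with
  | inl bi => [seq (t.1.1%:~R, (word_eval T t.1.2)^-1%g, (t.2, walk st t.1.2 bi.2))
                 | t <- tnth (in_tuple Ms) bi.1]
  | inr j => if j \in W then [::] else [:: (1, 1%g, j)] end.
have opT : op_inj op F setT.
  move=> u iu _ u0.
  have uc j h : u j h = u j 1%g by rewrite -[h]mul1g iu.
  suff z : forall k i, u (k, i) 1%g = 0 by move=> [k i] h; rewrite uc z.
  apply: inj => [k i|th /(@tnthP _ _ (in_tuple Ms)) [b ->] i].
    apply: contraNT => nW; have := u0 (inr (k, i)) 1%g.
    by rewrite /opapp /= (negPf nW) big_seq1 /= mul1r mulg1 => ->.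
  rewrite -[RHS](u0 (inl (b, i)) 1%g) /opapp /= big_map; apply: eq_bigr => t _ /=.
  by rewrite [in RHS]uc.
have z := locally_indicable_op_inj li opT.
move=> k [h i]; apply: (z (fun j h => y j.1 (h, j.2)) _ _ _ (k, i)).
- by move=> j h' l ->; rewrite mulg1.
- move=> j h' /yW [/= hF _]; exists h' => //; exact: mulVg.
case=> [[b i'] h'|j h'] /=; rewrite /opapp /=.
  rewrite -[RHS](y0 (tnth (in_tuple Ms) b) (mem_tnth _ _) (h', i')) big_map /row_app.
  by apply: eq_bigr => t _; rewrite walk_prodstep /= walk_gstep.
case: ifP => jW; first by rewrite big_nil.
rewrite big_seq1 mul1r mul1g /=; apply/eqP; apply: contraFT jW => /yW [_ /=].
by rewrite -surjective_pairing.
Qed.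

(** The compression is self-adjoint. *)
Lemma compression_power_ge0 (R : realType) n (X : choiceType) (st : 'I_n * bool -> X -> X)
    (Ms : seq (rowop n)) (c : R) (P : seq X) m j x : (forall a, cancel (st a) (st (linv a))) ->
  x \in P -> 0 <= iter (m + m) (compression st Ms c P) (delta R j x) j x.
Proof.
move=> stK xP; set A := compression st Ms c P.
have supp k k' z : z \notin P -> iter k A (delta R j x) k' z = 0.
  case: k => [|k] zP; last by rewrite /= /A /compression (negPf zP).
  by rewrite /= /delta; case: (z =P x) => [zx|]; [move: zP; rewrite zx xP|rewrite andbF].
have l2A y : l2f y -> l2f (A y).
  move=> ly k; apply: (@le_sqs _ _ _ (contraction st Ms c y k)).
    by move=> z; rewrite /A /compression; case: ifP => // _; rewrite normr0.
  exact: (l2f_iter_contraction Ms c 1 stK ly).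
have lA k : l2f (iter k A (delta R j x)) by elim: k => [|k IH]; [exact: l2f_delta|exact: l2A].
have Aip (y z : 'I_n -> X -> R) : (forall k' w, w \notin P -> z k' w = 0) ->
    ip (A y) z = ip (contraction st Ms c y) z.
  move=> zP; apply: eq_bigr => k _; apply: eq_rsum => w; rewrite /A /compression.
  by case: ifPn => // wP; rewrite zP // !mulr0.
have AA k l : ip (iter k A (delta R j x)) (iter l A (delta R j x)) =
    ip (iter (k + l) A (delta R j x)) (delta R j x).
  elim: l k => [|l IH] k; first by rewrite addn0.
  rewrite -addSnnS -IH /= [RHS]Aip; last exact: supp.
  rewrite [LHS]ipC Aip; last exact: supp.
  by rewrite contraction_self_adjoint // ipC.
by rewrite -(ip_delta (iter (m + m) A (delta R j x))) -AA; exact: ip_ge0.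
Qed.

Fixpoint words_upto n k : seq (word n) :=
  if k is k'.+1 then [::] :: [seq a :: w | a <- enum {: 'I_n * bool}, w <- words_upto n k']
  else [:: [::]].

Lemma mem_words_upto n k (w : word n) : (size w <= k)%N -> w \in words_upto n k.
Proof.
elim: k w => [|k IH] [|a w] //= wk; rewrite inE /=.
by apply/allpairsP; exists (a, w); rewrite /= mem_enum IH.
Qed.

(** Each element of [K] moves few points of a Folner set out of it. *)
Lemma folner_interior (R : realType) (H : groupType) (K : seq H) (e : R) : amenable R H -> 0 < e ->
  exists2 F : seq H, uniq F /\ (0 < size F)%N &
    (1 - e) * (size F)%:R <= (count (fun h => all (fun g => (g * h)%g \in F) K) F)%:R.
Proof.
move=> am e0; have K0 : 0 < e / (size K).+1%:R by rewrite divr_gt0.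
have [F uF FK] := folner am K K0; exists F => //.
pose bad h := ~~ all (fun g => (g * h)%g \in F) K.
have badK : (count bad F)%:R <= e * (size F)%:R.
  apply: (@le_trans _ _ (\sum_(g <- K) (count (fun h => (g * h)%g \notin F) F))%:R).
    rewrite ler_nat -sum1_count; under [leqRHS]eq_bigr do rewrite -sum1_count.
    under [leqRHS]eq_bigr do rewrite big_mkcond; rewrite exchange_big big_mkcond /=.
    apply: leq_sum => h _; case: ifP => // /allPn[g gK gF].
    by rewrite (big_rem g) //= gF.
  rewrite natr_sum big_seq; apply: (@le_trans _ _ (\sum_(g <- K | g \in K) (e / (size K).+1%:R * (size F)%:R))).
    by apply: ler_sum => g /FK.
  rewrite -big_seq big_const_seq count_predT iter_addr_0 -[_ *+ size K]mulr_natr mulrAC; apply: ler_wpM2r => //.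
  by rewrite -mulrA ger_pMr // mulrC ler_pdivrMr // mul1r ler_nat.
have := count_predC (fun h => all (fun g => (g * h)%g \in F) K) F.
rewrite (@eq_count _ (predC _) bad) // => /(congr1 (fun k => k%:R : R)); rewrite natrD.
move: badK; lra.
Qed.

Lemma rows_bound (R : realType) n (X : choiceType) (st : 'I_n * bool -> X -> X) (Ms : seq (rowop n))
    (y : 'I_n -> X -> R) : (forall a, cancel (st a) (st (linv a))) -> l2f y ->
  \sum_(th <- Ms) ip1 (row_app st th y) (row_app st th y) <=
    (2 + \sum_(th <- Ms) row_norm th)%:R * ip y y.
Proof.
move=> stK ly; apply: (@le_trans _ _ ((\sum_(th <- Ms) row_norm th)%:R * ip y y)).
  by rewrite natr_sum mulr_suml; apply: ler_sum => th _; exact: row_app_norm.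
by apply: ler_wpM2r; [exact: ip_ge0|rewrite ler_nat leq_addl].
Qed.

Lemma rows_radius n (Ms : seq (rowop n)) : exists l, all (row_radius l) Ms.
Proof.
exists (\sum_(th <- Ms) \sum_(t <- th) size t.1.2)%N; apply/allP => th thM; apply/allP => t tth.
by rewrite (big_rem th thM) /= (big_rem t tth) /= -addnA leq_addr.
Qed.

Lemma kermx_rank_intr (R : realType) m k (M : 'M[int]_(m, k)) :
  \rank (kermx (map_mx intr M : 'M[R]_(m, k))^T) = \rank (kermx (map_mx intr M : 'M[rat]_(m, k))^T).
Proof.
rewrite !mxrank_ker !mxrank_tr; congr (_ - _)%N; rewrite -(mxrank_map (@ratr R)) -map_mx_comp.
by congr (\rank _); apply/matrixP => i j; rewrite !mxE /= ratr_int.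
Qed.

(** The diagonal entries of powers of the contraction on [G] also occur at the inner
    points of a large finite piece of the product of an approximating group with
    the finite quotient. There the remaining points contribute nonnegatively, and
    the nullity is at most [d] per point of the Folner set. *)
Section UpperBound.
Variables (R : realType) (G : groupType) (n : nat) (S : 'I_n -> G).
Variables (N : set G) (q : nat) (kappa : G -> 'I_q) (r : 'I_q -> G).
Hypothesis kappar : forall i, kappa (r i) = i.
Hypothesis kappaE : forall g h, kappa g = kappa h <-> N (g^-1 * h)%g.
Variable Ms : seq (rowop n).
Let C := (2 + \sum_(th <- Ms) row_norm th)%N.
Let qst := qstep kappa r S.
Let d := \rank (kermx (map_mx intr (row_matrix qst Ms) : 'M[R]__)^T).
Let tau m : R :=
  \sum_j iter (m + m) (contraction (gstep S) Ms C%:R^-1) (delta R j (1%g : G)) j 1%g.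

Lemma tau_ge0 m : 0 <= tau m.
Proof.
apply: sumr_ge0 => j _.
apply: (projection_le_contraction (p := fun _ _ => 0) _ _ (@gstepK _ _ S)).
- by move=> k; exact: sqs0.
- by move=> th _ z; rewrite /row_app big1 // => t _; rewrite mulr0.
- by rewrite /ip big1 // => k _; rewrite /ip1 -[RHS](@rsum0 R G); apply: eq_rsum => x; rewrite mulr0.
Qed.

Lemma tau_approx (H : groupType) (T : 'I_n -> H) m L l e :
  locally_indicable R H -> amenable R H -> 0 < e -> (0 < L)%N -> all (row_radius l) Ms ->
  (forall w : word n, (size w <= 2 * l * (m + m))%N -> word_eval T w = 1%g <-> word_eval S w = 1%g) ->
  (1 - e) * tau m * q%:R <=
    d%:R + (n * q)%:R / L%:R + (n * q)%:R * (1 - C%:R^-1 ^+ L.+1) ^+ (m + m).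
Proof.
move=> li am e0 L0 Ml loc.
pose K := [seq (word_eval T w)^-1%g | w <- words_upto n (2 * l * (m + m))].
have [F [uF F0] goodF] := folner_interior K am e0.
pose good h := all (fun g => (g * h)%g \in F) K.
pose X : choiceType := (H * 'I_q)%type.
pose st : 'I_n * bool -> X -> X := prodstep (gstep T) qst.
have stK a : cancel (st a) (st (linv a)) := prodstepK (@gstepK _ _ T) (qstepK kappar kappaE S) a.
pose P : seq X := [seq (h, i) | h <- F, i <- enum 'I_q].
have uP : uniq P by apply: allpairs_uniq; rewrite ?enum_uniq // => -[? ?] [? ?].
have inP (x : X) : (x \in P) = (x.1 \in F).
  apply/allpairsP/idP => [[[h i] [/= hF _ ->]] //|xF].
  by exists x; rewrite mem_enum -surjective_pairing.
have szP : size P = (size F * q)%N by rewrite size_allpairs size_enum_ord.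
have [W0 [uW0 szW0 injW0]] := independent_edges R qst Ms.
pose W : seq ('I_n * X) := [seq (ki.1, (h, ki.2)) | h <- F, ki <- W0].
have uW : uniq W by apply: allpairs_uniq => // -[h [k i]] [h' [k' i']] _ _ /= [-> -> ->].
have WP w : w \in W -> w.2 \in P.
  by move=> /allpairsP[[h ki] [/= hF _ ->]]; rewrite inP.
have szW : size W = (size F * size W0)%N by rewrite size_allpairs.
have inj (y : 'I_n -> X -> R) : (forall k x, y k x != 0 -> (k, x) \in W) ->
    (forall th, th \in Ms -> forall x, row_app st th y x = 0) -> forall k x, y k x = 0.
  move=> yW; apply: (prod_independent_edges (F := F) li injW0) => k x.
  by move=> /yW /allpairsP[[h [k' i]] [/= hF kiW [-> ->]]].
have C2 : (2 <= C)%N by rewrite leq_addr.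
have := @compression_trace R n X st stK Ms P uP C L (m + m) W C2 L0 (fun y => rows_bound Ms stK (y := y)) uW WP inj.
set c := C%:R^-1; set rhs := (X in _ <= X) => ub.
have diag h i j : h \in F -> good h ->
    iter (m + m) (compression st Ms c P) (delta R j (h, i)) j (h, i) =
    iter (m + m) (contraction (gstep S) Ms c) (delta R j (1%g : G)) j 1%g.
  move=> hF gh; apply: (@agree_iter_compression R n X G st (gstep S) (h, i) 1%g Ms c P l (m + m) j Ml) => w wl.
    rewrite walk_prodstep inP walk_gstep; apply: (allP gh); apply/mapP; exists w => //.
    exact: mem_words_upto.
  have m1 (g z : G) : (g^-1 * z)%g = z <-> g = 1%g.
    by split=> [gz|->]; [apply: invg_inj; apply: (mulIg z); rewrite gz invg1 mul1g|rewrite invg1 mul1g].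
  rewrite walk_prodstep !walk_gstep m1 -loc //.
  split=> [[+ _]|w1]; first by move=> wh; apply: invg_inj; apply: (mulIg h); rewrite wh invg1 mul1g.
  have := walk_qstep kappar kappaE S w (r i); rewrite (loc w wl).1 // kappar.
  by rewrite w1 !invg1 !mul1g kappar => ->.
have lb : (count good F)%:R * q%:R * tau m <= \sum_(x <- P) \sum_j iter (m + m) (compression st Ms c P) (delta R j x) j x.
  rewrite big_allpairs; apply: (@le_trans _ _ (\sum_(h <- F) (if good h then q%:R * tau m else 0))).
    by rewrite -big_mkcond big_const_seq iter_addr_0 -[leRHS]mulr_natl mulrA.
  rewrite [leLHS]big_seq [leRHS]big_seq; apply: ler_sum => h hF; case: ifP => gh.
    rewrite big_enum /= (eq_bigr (fun=> tau m)) ?sumr_const ?card_ord ?mulr_natl // => i _.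
    by apply: eq_bigr => j _; exact: diag.
  by apply: sumr_ge0 => i _; apply: sumr_ge0 => j _; apply: compression_power_ge0; rewrite ?inP.
have F1 : 0 < (size F)%:R :> R by rewrite ltr0n.
rewrite -(ler_pM2l F1).
apply: (@le_trans _ _ ((count good F)%:R * q%:R * tau m)).
  have -> : (size F)%:R * ((1 - e) * tau m * q%:R) = (1 - e) * (size F)%:R * (q%:R * tau m) by ring.
  by rewrite -[leRHS]mulrA; apply: ler_wpM2r goodF; rewrite mulr_ge0 ?tau_ge0.
apply: le_trans lb _; apply: le_trans ub _.
rewrite /rhs szP szW.
have -> : (size F * q * n - size F * size W0)%N = (size F * d)%N.
  by rewrite -mulnA -mulnBr [(q * n)%N]mulnC -szW0 addKn.
have -> : (size F * q * n)%N = (size F * (n * q))%N by rewrite -mulnA [(q * n)%N]mulnC.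
by rewrite !natrM; lra.
Qed.

End UpperBound.

Lemma geometric_small (R : realType) (x e : R) : 0 <= x < 1 -> 0 < e -> exists m, x ^+ (m + m) <= e.
Proof.
move=> /andP[x0 x1] e0; have xn : `|x| < 1 by rewrite ger0_norm.
have /cvgr_dist_lt /(_ _ e0) [m _ /(_ (m + m)%N)] /= := cvg_expr xn.
rewrite leq_addr sub0r normrN ger0_norm ?exprn_ge0 // => h.
by exists m; rewrite ltW // h.
Qed.

(** Let [m] tend to infinity in [tau_approx], then [L]: the diagonal entries bound the
    values of the projections for every [m]. *)
Theorem l2_betti1_le (R : realType) (G : groupType) n (S : 'I_n -> G) (N : set G) :
  marked_limit R (fun H => left_orderable H /\ amenable R H) G ->
  generates S -> normal_subgroup N -> finite_index N ->
  l2_betti1 R S <= (betti1 N)%:R / (subgroup_index N)%:R.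
Proof.
move=> limG genS nN fN; have [kappa [r [kappar kappaE]]] := finite_quotient nN fN.
set q := subgroup_index N in kappa r kappar kappaE *.
have q0 : 0 < q%:R :> R by rewrite ltr0n; case: (kappa 1%g) => i; exact: leq_ltn_trans.
have [Ms Msh Msy] := finite_rows (qstep kappa r S) (harmonic_rows S).
rewrite (betti1_harmonic nN kappar kappaE genS Msh Msy) -(kermx_rank_intr R).
set d := \rank _; rewrite ler_pdivlMr //.
have [p [hp pv ->]] := l2_betti1_projections R genS.
have [l Ml] := rows_radius Ms.
set C := (2 + \sum_(th <- Ms) row_norm th)%N; set c : R := C%:R^-1.
have C2 : (2 <= C)%N by rewrite leq_addr.
pose tau m : R := \sum_j iter (m + m) (contraction (gstep S) Ms c) (delta R j (1%g : G)) j 1%g.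
have ptau m : \sum_k p k k 1%g <= tau m.
  apply: ler_sum => k _; have [lp rp dp] := hp k.
  apply: (projection_le_contraction _ _ (@gstepK _ _ S) lp) => [th /Msh [->|[w w1 ->]]|].
  - exact: dp.
  - exact: rp.
  - by rewrite pv.
have key m L : (0 < L)%N ->
    tau m * q%:R <= d%:R + (n * q)%:R / L%:R + (n * q)%:R * (1 - c ^+ L.+1) ^+ (m + m).
  move=> L0; set rhs := (X in _ <= X).
  have [H [T [e [[lo am] eP loc]]]] := marked_limit_approx limG S (2 * l * (m + m)).
  have li := left_orderable_amenable_locally_indicable am eP lo.
  have t0 : 0 <= tau m := tau_ge0 R S Ms m.
  apply/ler_addgt0Pr => z z0; pose eps := z / (tau m * q%:R + 1).
  have tq1 : 0 < tau m * q%:R + 1 by rewrite ltr_wpDl // mulr_ge0.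
  have eps0 : 0 < eps by rewrite divr_gt0.
  have := tau_approx kappar kappaE li am eps0 L0 Ml loc; rewrite -/d -/C -/c -/(tau m) -/rhs => h.
  have h2 : eps * (tau m * q%:R + 1) = z by rewrite divfK // gt_eqF.
  nra.
apply/ler_addgt0Pr => z z0.
have nq0 : 0 <= (n * q)%:R :> R by [].
have [L L0 Lz] : exists2 L, (0 < L)%N & (n * q)%:R / L%:R <= z / 2.
  exists (Num.truncn ((n * q)%:R / (z / 2))).+1 => //.
  rewrite ler_pdivrMr // mulrC -ler_pdivrMr ?divr_gt0 //.
  exact: ltW (truncnS_gt _).
have c0 : 0 < c by rewrite invr_gt0 ltr0n; exact: leq_trans C2.
have c1 : c <= 1 by rewrite invf_le1 ?ler1n ?ltr0n; lia.
have [m mz] : exists m, (1 - c ^+ L.+1) ^+ (m + m) <= z / 2 / ((n * q)%:R + 1).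
  apply: geometric_small; last by rewrite !divr_gt0 // ltr_wpDl.
  by have := exprn_gt0 L.+1 c0; have := exprn_ile1 L.+1 (ltW c0) c1; lra.
have := key m L L0; have := ler_wpM2r (ltW q0) (ptau m).
have : (n * q)%:R * (1 - c ^+ L.+1) ^+ (m + m) <= z / 2.
  apply: (@le_trans _ _ (((n * q)%:R + 1) * (z / 2 / ((n * q)%:R + 1)))).
    apply: ler_pM => //; last by rewrite lerDl.
    by rewrite exprn_ge0 // subr_ge0 exprn_ile1 // ltW.
  by rewrite mulrC divfK // gt_eqF // ltr_wpDl.
lra.
Qed.

(** * Limits of finite quotients *)

(** Orthogonal projections of basis vectors at a vertex of the quotient graph whose
    share of the trace is at least the average. The quotient map is injective on
    a set [s] as required, and the squares of the entries of a row of a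
    projection add up to its diagonal entry. *)
Lemma finite_harmonic_projections (R : realType) (G : groupType) n (S : 'I_n -> G) (N : set G) :
  generates S -> normal_subgroup N -> finite_index N ->
  exists y : 'I_n -> 'I_n -> G -> R,
    [/\ forall k th, harmonic_rows S th -> forall g, row_app (gstep S) th (y k) g = 0,
        forall k s, uniq s -> {in s &, forall x x', N (x^-1 * x')%g -> x = x'} ->
          \sum_(x <- s) \sum_j y k j x ^+ 2 <= y k k 1%g &
        (betti1 N)%:R / (subgroup_index N)%:R <= \sum_k y k k 1%g].
Proof.
move=> genS nN fN; have [kappa [r [kappar kappaE]]] := finite_quotient nN fN.
set q := subgroup_index N in kappa r kappar kappaE *.
have q0 : 0 < q%:R :> R by rewrite ltr0n; case: (kappa 1%g) => i; exact: leq_ltn_trans.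
pose qst := qstep kappa r S.
have [Ms Msh Msy] := finite_rows qst (harmonic_rows S).
rewrite (betti1_harmonic nN kappar kappaE genS Msh Msy) -(kermx_rank_intr R).
set V := kermx _; pose P := orthproj V.
pose t i := \sum_(k < n) P (enum_rank (k, i)) (enum_rank (k, i)).
have [b tb] : exists b, (\rank V)%:R / q%:R <= t b.
  apply: contrapT => nb.
  have lt i : t i < (\rank V)%:R / q%:R by rewrite ltNge; apply/negP => h; apply: nb; exists i.
  have : \sum_i t i < \sum_(i < q) (\rank V)%:R / q%:R.
    apply: ltr_sum => [|i _]; last exact: lt.
    by apply/hasP; exists (kappa 1%g) => //; rewrite mem_index_enum.
  rewrite sumr_const card_ord -[X in _ < X]mulr_natr divfK ?gt_eqF // -(orthproj_trace V) -/P.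
  rewrite exchange_big pair_big /= /mxtrace (reindex (@enum_rank ('I_n * 'I_q)%type)) /=.
    rewrite (eq_bigr (fun a => P (enum_rank a) (enum_rank a))) ?ltxx // => a _.
    by rewrite -surjective_pairing.
  by exists enum_val => a _; rewrite ?enum_rankK ?enum_valK.
pose z k : 'I_n -> 'I_q -> R := fvec (row (enum_rank (k, b)) P).
have zrow k th : harmonic_rows S th -> forall i, row_app qst th (z k) i = 0.
  apply: Msy; apply/row_matrixP; rewrite fvecK; apply/sub_kermxP.
  by rewrite (submx_trans (row_sub _ _)) // orthproj_sub.
have znorm k : \sum_j \sum_i z k j i ^+ 2 = z k k b.
  rewrite /z /fvec mxE; set e := enum_rank (k, b).
  have := congr1 (fun M : 'M[R]__ => M e e) (orthproj_idem V); rewrite /= -/P => <-.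
  rewrite mxE pair_big /= [RHS](reindex (@enum_rank ('I_n * 'I_q)%type)) /=.
    apply: eq_bigr => a _; rewrite mxE -surjective_pairing expr2; congr (_ * _).
    by have PT : P^T = P := orthproj_sym V; rewrite -[in RHS]PT [RHS]mxE.
  by exists enum_val => a _; rewrite ?enum_rankK ?enum_valK.
(* Translation on the right by [r b] moves the chosen vertex to the base point. *)
exists (fun k j g => z k j (kappa (g * r b)%g)); split.
- move=> k th hth g; rewrite -[RHS](zrow k th hth (kappa (g * r b)%g)) /row_app.
  by apply: eq_bigr => a _; rewrite (walk_qstep kappar kappaE) walk_gstep mulgA.
- move=> k s us inj; rewrite mul1g kappar -znorm exchange_big /=.
  apply: ler_sum => j _; rewrite -(big_map (fun x => kappa (x * r b)%g) xpredT (fun i => z k j i ^+ 2)).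
  have us' : uniq [seq kappa (x * r b)%g | x <- s].
    rewrite map_inj_in_uniq // => x x' xs xs' e; apply: inj => //.
    by apply/kappaE; have := kappa_rmul nN kappaE (r b)^-1%g e; rewrite !mulgK.
  rewrite [leLHS]big_uniq // [leRHS](bigID (mem [seq kappa (x * r b)%g | x <- s])) /= lerDl.
  by apply: sumr_ge0 => i _; exact: sqr_ge0.
- apply: le_trans tb _; rewrite /t; apply: ler_sum => k _.
  by rewrite mul1g kappar /z /fvec [leRHS]mxE.
Qed.

(** Ultralimits of the pulled back projections are harmonic and their squared norms
    are at most their values at the base point. By the Cauchy-Schwarz inequality
    such a vector has at most the value of the projection of the basis vector. *)
Theorem limsup_betti1_le (R : realType) (G : groupType) n (S : 'I_n -> G) (N : nat -> set G) (e : R) :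
  generates S -> (forall i, normal_subgroup (N i)) -> (forall i, finite_index (N i)) ->
  (forall i, N i.+1 `<=` N i) -> \bigcap_i N i = [set 1%g] -> 0 < e ->
  \forall i \near \oo, (betti1 (N i))%:R / (subgroup_index (N i))%:R <= l2_betti1 R S + e.
Proof.
move=> genS nN fN decrN trivN e0.
have /choice[y yP] i := finite_harmonic_projections R genS (nN i) (fN i).
have [p [hp pv pE]] := l2_betti1_projections R genS.
pose A := [set i | (betti1 (N i))%:R / (subgroup_index (N i))%:R <= l2_betti1 R S + e].
suff : (\oo : set_system nat) A by [].
apply: contrapT => nA.
(* If the bound failed infinitely often, it would fail along an ultrafilter. *)
have pF : ProperFilter (within (~` A) \oo).
  apply: Build_ProperFilter_ex => B AB; apply: contrapT => B0; apply: nA.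
  have {}AB : (\oo : set_system nat) [set i | (~` A) i -> B i] := AB.
  apply: filterS AB => i h; apply: contrapT => Ai; apply: B0; exists i; exact: h.
have [U [uU Usub]] := ultraFilterLemma pF.
have UA : U (~` A) by apply: Usub; exact: withinT.
have Uoo B : \oo B -> U B by move=> B'; apply: Usub; apply: filterS B' => i Bi _.
have separated s : uniq s -> U [set i | {in s &, forall x x', N i (x^-1 * x')%g -> x = x'}].
  move=> us; have /choice[m mP] (g : G) : exists m, g <> 1%g -> forall i, (m <= i)%N -> ~ N i g.
    have [->|g1] := eqVneq g 1%g; first by exists 0%N.
    have : ~ (\bigcap_i N i) g by rewrite trivN => /eqP; exact/negP.
    move=> /existsNP[m] /not_implyP[_ mg]; exists m => _ i mi Nig; apply: mg.
    elim: i mi Nig => [|i IH]; first by rewrite leqn0 => /eqP ->.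
    by rewrite leq_eqVlt => /predU1P[-> //|mi] /decrN; exact: IH.
  apply: Uoo; exists (\sum_(x <- s) \sum_(x' <- s) m (x^-1 * x')%g)%N => // i /= mi x x' xs xs' Nx.
  apply: contrapT => nx; apply: (mP (x^-1 * x')%g _ i _ Nx).
    by move=> e1; apply: nx; rewrite -[x]mulg1 -e1 mulVKg.
  by apply: leq_trans mi; rewrite (big_rem x xs) /= (big_rem x' xs') /= -addnA leq_addr.
pose a k i := y i k k 1%g.
have sep1 i : {in [:: 1%g : G] &, forall x x', N i (x^-1 * x')%g -> x = x'}.
  by move=> x x'; rewrite !inE => /eqP -> /eqP ->.
have a01 k i : 0 <= a k i <= 1.
  have [_ /(_ k [:: 1%g] isT (sep1 i)) + _] := yP i.
  rewrite big_seq1 (bigD1 k) //= -/(a k i) => h.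
  have h2 : a k i ^+ 2 <= a k i.
    by apply: le_trans h; rewrite lerDl sumr_ge0 // => j _; exact: sqr_ge0.
  by apply/andP; split; nra.
have aB k i : a k i <= 1 by case/andP: (a01 k i).
have acv k : a k @ U --> ulim U (a k).
  apply: (ulimP uU (B := 1)); apply: filterE => i /=; rewrite ger0_norm ?aB //.
  by case/andP: (a01 k i).
have ya k s : uniq s -> U [set i | \sum_(x <- s) \sum_j y i k j x ^+ 2 <= a k i].
  by move=> us; apply: filterS (separated s us) => i; case: (yP i) => _ + _; apply.
pose xi k := wlim U (fun i => y i k).
have hxi k : harmonic S (xi k).
  have row th : harmonic_rows S th -> forall x, row_app (gstep S) th (xi k) x = 0.
    move=> hth x; apply: (wlim_row uU (aB k) (ya k)); apply: filterE => i /=.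
    by case: (yP i) => + _ _; apply.
  split; first exact: (wlim_l2 uU (aB k) (acv k) (ya k)).
    by move=> w w1; apply: row; right; exists w.
  by apply: row; left.
have xi_norm k : ip (xi k) (xi k) <= xi k k 1%g := wlim_norm uU (aB k) (acv k) (ya k).
have xi_le k : xi k k 1%g <= p k k 1%g.
  have [lp _ _] := hp k; have [lx _ _] := hxi k.
  have := cauchy_schwarz lp lx; rewrite !pv //.
  have := xi_norm k; have := ip_ge0 (xi k); have := ip_ge0 (p k); rewrite pv //; nra.
have : l2_betti1 R S + e <= \sum_k xi k k 1%g.
  have sumcv : (fun i => \sum_k a k i) @ U --> \sum_k xi k k 1%g.
    by apply: cvg_sum_seq => k; exact: acv.
  apply: (ler_cvg_to (cvg_cst (l2_betti1 R S + e)) sumcv); apply: filterS UA => i nAi.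
  have [_ _ h] := yP i; apply: le_trans h; apply: ltW; rewrite ltNge; exact/negP.
have : \sum_k xi k k 1%g <= l2_betti1 R S by rewrite pE; apply: ler_sum => k _; exact: xi_le.
lra.
Qed.

Theorem corollary1p5 (R : realType) (G : groupType)
  (limG : marked_limit R (fun H => left_orderable H /\ amenable R H) G)
  (n : nat) (S : 'I_n -> G) (genS : generates S)
  (N : nat -> set G)
  (normalN : forall i, normal_subgroup (N i))
  (finiteN : forall i, finite_index (N i))
  (decrN : forall i, N i.+1 `<=` N i)
  (trivN : \bigcap_i N i = [set 1%g]) :
  (fun i => (betti1 (N i))%:R / (subgroup_index (N i))%:R : R) @ \oo
    --> l2_betti1 R S.
Proof.
apply/cvgrPdist_le => e e0.
apply: filterS (limsup_betti1_le genS normalN finiteN decrN trivN e0) => i h.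
have := l2_betti1_le limG genS (normalN i) (finiteN i).
by rewrite distrC ler_norml; move: h; lra.
Qed.
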